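(* Consider the flat Riemannian superspace $\mathbb{R}^{m|2n}$ with the metric described below. (i) The group of supermanifold diffeomorphisms $\Phi=(\phi,\phi^\sharp)$ of $\mathbb{R}^{m|2n}$ which preserve the metric, i.e. $\phi^\sharp(\langle Y^1_\phi| Y^2_\phi\rangle)=\langle Y^1|Y^2\rangle$ for all vector fields $Y^1,Y^2$ where $Y_\phi=(\phi^\sharp)^{-1}\circ Y\circ\phi^\sharp$, and which stabilize the origin ($\delta_0^\sharp\circ\phi^\sharp=\delta_0^\sharp$), is exactly $O(m)\times Sp(2n)$, acting by $f(\mathbf{x})\mapsto f(S^{-1}\mathbf{x})$. (ii) The homogeneous vector fields $F$ on $\mathbb{R}^{m|2n}$ which are graded Killing, i.e. $F\langle Y|Z\rangle=\langle [F,Y]|Z\rangle+(-1)^{|F||Y|}\langle Y|[F,Z]\rangle$ for all homogeneous vector fields $Y,Z$, and which satisfy $\delta_0^\sharp\circ F=0$, span exactly the Lie superalgebra $\mathfrak{osp}(m|2n)$ realized by the operators $L_{ij}$, $1\le i\le j\le m+2n$. Consequently the supergroup of isometries of $\mathbb{R}^{m|2n}$ stabilizing the origin is the Lie supergroup $OSp(m|2n)$ with Harish-Chandra pair $(O(m)\times Sp(2n),\mathfrak{osp}(m|2n))$.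
   Context: $\mathbb{R}^{m|2n}=(\mathbb{R}^m,\mathcal{C}^\infty_{\mathbb{R}^m}\otimes\Lambda_{2n})$ with coordinates $\mathbf{x}=(X_1,\dots,X_{m+2n})=(x_1,\dots,x_m,\grave{x}_1,\dots,\grave{x}_{2n})$, $x_i$ even, $\grave{x}_j$ odd; $[i]=0$ for $i\le m$ and $[i]=1$ otherwise, $X_iX_j=(-1)^{[i][j]}X_jX_i$. Set $\partial_{X^i}=\partial_{x_i}$ for $i\le m$, $\partial_{X^{m+2k-1}}=2\partial_{\grave{x}_{2k}}$, $\partial_{X^{m+2k}}=-2\partial_{\grave{x}_{2k-1}}$. The metric is the $\mathcal{O}$-bilinear (graded) form on vector fields with $\langle \partial_{X_j}|\partial_{X^k}\rangle=\delta_j^k$ and $\langle f\partial_{X_j}|h\partial_{X^k}\rangle=(-1)^{|h|[j]}\delta_j^k fh$. $O(m)\times Sp(2n)$ is the group of block matrices $S=\mathrm{diag}(A,B)$ with $A^TA=I_m$, $B^TJB=J$, where $J=\frac12\mathrm{diag}\big(\begin{smallmatrix}0&-1\\1&0\end{smallmatrix},\dots,\begin{smallmatrix}0&-1\\1&0\end{smallmatrix}\big)$ ($n$ blocks). The operators $L_{ij}=X_i\partial_{X^j}-(-1)^{[i][j]}X_j\partial_{X^i}$ realize $\mathfrak{osp}(m|2n)$. *)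

(* Defs.v *)
From mathcomp Require Import all_boot.
From Stdlib Require Import Reals ClassicalEpsilon.
Delimit Scope R_scope with R.
Set Implicit Arguments. Unset Strict Implicit. Unset Printing Implicit Defensive.

(* Smooth functions on R^m.  A point is a map nat -> R of which only the
   first m coordinates are relevant (functions on R^m are required to be
   independent of the other coordinates).                              *)
Definition pt := nat -> R.

Definition upd (x : pt) (i : nat) (t : R) : pt :=
  fun k => if Nat.eqb k i then t else x k.

Definition pd (i : nat) (f : pt -> R) : pt -> R := fun x =>
  epsilon (inhabits 0%R)
    (fun l => derivable_pt_lim (fun t => f (upd x i t)) (x i) l).

Definition pds (ls : seq nat) (f : pt -> R) : pt -> R := foldr pd f ls.

Definition contm (m : nat) (g : pt -> R) : Prop :=
  forall (x : pt) (eps : R), (0 < eps)%R ->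
    exists delta : R, (0 < delta)%R /\
      forall y : pt, (forall i, i < m -> (Rabs (y i - x i) < delta)%R) ->
        (Rabs (g y - g x) < eps)%R.

Definition local (m : nat) (f : pt -> R) : Prop :=
  forall x y : pt, (forall i, i < m -> x i = y i) -> f x = f y.

Definition smooth (m : nat) (f : pt -> R) : Prop :=
  local m f /\
  forall ls : seq nat, all (fun i => i < m) ls ->
    contm m (pds ls f) /\
    (forall i, i < m -> forall x : pt,
        exists l, derivable_pt_lim (fun t => pds ls f (upd x i t)) (x i) l).

(* Superfunctions on R^{m|2n}: elements of C^infty(R^m) (x) Lambda_{2n},
   written  F = sum_S F S  xi_S  where S ranges over subsets of the 2n odd
   generators and xi_S is the product of the xi_a, a in S, in increasing
   order.                                                             *)
Definition sfun (n : nat) := {set 'I_(2 * n)} -> pt -> R.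

Definition sO (m n : nat) (F : sfun n) : Prop := forall S : {set 'I_(2 * n)}, smooth m (F S).
Arguments sO : clear implicits.

Definition szero n : sfun n := fun _ _ => 0%R.
Arguments szero : clear implicits.
Definition sone n : sfun n := fun S _ => if S == set0 then 1%R else 0%R.
Arguments sone : clear implicits.
Definition sadd n (F G : sfun n) : sfun n := fun S x => (F S x + G S x)%R.
Definition sscale n (c : R) (F : sfun n) : sfun n := fun S x => (c * F S x)%R.

(* xi_A xi_B = sgnAB A B xi_(A u B) for disjoint A, B *)
Definition sgnAB k (A B : {set 'I_k}) : R :=
  if odd #|[set p : 'I_k * 'I_k | (p.1 \in A) && (p.2 \in B) && (p.2 < p.1)]|
  then (-1)%R else 1%R.

Definition smul n (F G : sfun n) : sfun n := fun S x =>
  \big[Rplus/0%R]_(A in powerset S) (sgnAB A (S :\: A) * F A x * G (S :\: A) x)%R.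

Definition hom n (b : bool) (F : sfun n) : Prop :=
  forall S : {set 'I_(2 * n)}, odd #|S| != b -> F S = (fun _ => 0%R).

Definition sinv n (F : sfun n) : sfun n :=
  fun S x => if odd #|S| then (- F S x)%R else F S x.

Definition sgnb (b : bool) : R := if b then (-1)%R else 1%R.

Definition delta0 n (F : sfun n) : R := F set0 (fun _ => 0%R).

Definition semb n (f : pt -> R) : sfun n := fun S x => if S == set0 then f x else 0%R.

Definition gen n (a : nat) : sfun n := fun S _ =>
  if [exists i : 'I_(2 * n), (S == [set i]) && (nat_of_ord i == a)] then 1%R else 0%R.

Definition coord (m n k : nat) : sfun n :=
  if k < m then @semb n (fun x => x k) else @gen n (k - m).
Arguments coord : clear implicits.

Definition par (m k : nat) : bool := m <= k.

Definition deven n (i : nat) (F : sfun n) : sfun n := fun S => pd i (F S).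

Definition dodd n (a : nat) (F : sfun n) : sfun n := fun S x =>
  \big[Rplus/0%R]_(i : 'I_(2 * n) | (nat_of_ord i == a) && (i \notin S))
     (sgnAB [set i] S * F (i |: S) x)%R.

Definition dlow (m n k : nat) : sfun n -> sfun n :=
  if k < m then @deven n k else @dodd n (k - m).
Arguments dlow : clear implicits.

(* d_{X^k}: d_{x_k} for k < m; for the odd pair (2i, 2i+1) (0-based, i.e.
   1-based (2i+1, 2i+2)):  d_{X^{m+2i}} = 2 d/dxi_{2i+1},
   d_{X^{m+2i+1}} = -2 d/dxi_{2i}                                       *)
Definition dup (m n k : nat) : sfun n -> sfun n :=
  if k < m then @deven n k
  else if odd (k - m) then (fun F => sscale (-2)%R (@dodd n (k - m).-1 F))
  else (fun F => sscale 2%R (@dodd n (k - m).+1 F)).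
Arguments dup : clear implicits.

Definition gmet (m k j : nat) : R :=
  if (k < m) && (j < m) then (if k == j then 1%R else 0%R)
  else if (m <= k) && (m <= j) then
    (if ~~ odd (k - m) && (j - m == (k - m).+1) then (/2)%R
     else if odd (k - m) && (j - m == (k - m).-1) then (- / 2)%R
     else 0%R)
  else 0%R.

(* Vector fields = superderivations of O(R^{m|2n}) *)
Definition hder (m n : nat) (p : bool) (Y : sfun n -> sfun n) : Prop :=
  (forall F, sO m n F -> sO m n (Y F)) /\
  (forall F G, sO m n F -> sO m n G -> Y (sadd F G) = sadd (Y F) (Y G)) /\
  (forall c F, sO m n F -> Y (sscale c F) = sscale c (Y F)) /\
  (forall q F, sO m n F -> hom q F -> hom (xorb p q) (Y F)) /\
  (forall q F G, sO m n F -> sO m n G -> hom q F ->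
     Y (smul F G) = sadd (smul (Y F) G) (sscale (sgnb (p && q)) (smul F (Y G)))).
Arguments hder : clear implicits.

Definition vfield (m n : nat) (Y : sfun n -> sfun n) : Prop :=
  exists Y0 Y1, hder m n false Y0 /\ hder m n true Y1 /\
    forall F, sO m n F -> Y F = sadd (Y0 F) (Y1 F).
Arguments vfield : clear implicits.

(* the metric:  <f d_{X_j} | h d_{X_k}> = (-1)^{|h|[j]} f h g_jk,
   with Y = sum_j Y(X_j) d_{X_j} *)
Definition metric (m n : nat) (Y Z : sfun n -> sfun n) : sfun n :=
  \big[@sadd n/szero n]_(0 <= j < m + 2 * n) \big[@sadd n/szero n]_(0 <= k < m + 2 * n)
    sscale (gmet m j k)
      (smul (Y (coord m n j))
            (if par m j then sinv (Z (coord m n k)) else Z (coord m n k))).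
Arguments metric : clear implicits.

Definition sbr n (p q : bool) (F Y : sfun n -> sfun n) : sfun n -> sfun n :=
  fun G => sadd (F (Y G)) (sscale (- sgnb (p && q))%R (Y (F G))).

Definition killing (m n : nat) (p : bool) (F : sfun n -> sfun n) : Prop :=
  forall q r Y Z, hder m n q Y -> hder m n r Z ->
    F (metric m n Y Z) =
    sadd (metric m n (sbr p q F Y) Z)
         (sscale (sgnb (p && q)) (metric m n Y (sbr p r F Z))).
Arguments killing : clear implicits.

Definition Lop (m n i j : nat) : sfun n -> sfun n := fun F =>
  sadd (smul (coord m n i) (dup m n j F))
       (sscale (- sgnb (par m i && par m j))%R (smul (coord m n j) (dup m n i F))).
Arguments Lop : clear implicits.

Definition in_span (m n : nat) (P : (sfun n -> sfun n) -> Prop)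
    (T : sfun n -> sfun n) : Prop :=
  exists s : seq (R * (sfun n -> sfun n)),
    (forall cU, List.In cU s -> P cU.2) /\
    forall F, sO m n F ->
      T F = foldr (fun cU acc => sadd (sscale cU.1 (cU.2 F)) acc) (szero n) s.
Arguments in_span : clear implicits.

(* Superdiffeomorphisms, given by their (mutually inverse) pullbacks on
   the superalgebra of global superfunctions. *)
Definition smorph (m n : nat) (phi : sfun n -> sfun n) : Prop :=
  (forall F, sO m n F -> sO m n (phi F)) /\
  (forall F G, sO m n F -> sO m n G -> phi (sadd F G) = sadd (phi F) (phi G)) /\
  (forall c F, sO m n F -> phi (sscale c F) = sscale c (phi F)) /\
  (forall F G, sO m n F -> sO m n G -> phi (smul F G) = smul (phi F) (phi G)) /\
  phi (sone n) = sone n /\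
  (forall q F, sO m n F -> hom q F -> hom q (phi F)).
Arguments smorph : clear implicits.

Definition sdiffeo (m n : nat) (phi psi : sfun n -> sfun n) : Prop :=
  smorph m n phi /\ smorph m n psi /\
  forall F, sO m n F -> psi (phi F) = F /\ phi (psi F) = F.
Arguments sdiffeo : clear implicits.

Definition preserves_metric (m n : nat) (phi psi : sfun n -> sfun n) : Prop :=
  forall Y1 Y2, vfield m n Y1 -> vfield m n Y2 ->
    phi (metric m n (fun F => psi (Y1 (phi F))) (fun F => psi (Y2 (phi F))))
    = metric m n Y1 Y2.
Arguments preserves_metric : clear implicits.

Definition fixes_origin (m n : nat) (phi : sfun n -> sfun n) : Prop :=
  forall F, sO m n F -> delta0 (phi F) = delta0 F.
Arguments fixes_origin : clear implicits.

(* Matrices as nat -> nat -> R, entries used only below the size. *)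
Definition rsum (k : nat) (f : nat -> R) : R := \big[Rplus/0%R]_(0 <= l < k) f l.

Definition kdelta (i j : nat) : R := if i == j then 1%R else 0%R.

Definition mx_inverse (k : nat) (P Q : nat -> nat -> R) : Prop :=
  forall i j, i < k -> j < k ->
    rsum k (fun l => P i l * Q l j)%R = kdelta i j /\
    rsum k (fun l => Q i l * P l j)%R = kdelta i j.

Definition inOm (m : nat) (A : nat -> nat -> R) : Prop :=
  forall i j, i < m -> j < m -> rsum m (fun l => A l i * A l j)%R = kdelta i j.

Definition Jmx (i j : nat) : R :=
  if (i./2 == j./2) then
    (if ~~ odd i && odd j then (- / 2)%R
     else if odd i && ~~ odd j then (/ 2)%R else 0%R)
  else 0%R.

Definition inSp (n : nat) (B : nat -> nat -> R) : Prop :=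
  forall i j, i < 2 * n -> j < 2 * n ->
    rsum (2 * n) (fun k => rsum (2 * n) (fun l => B k i * Jmx k l * B l j))%R
    = Jmx i j.

(* pullback f(x) |-> f(P x, Q xi), i.e. x_i |-> sum_k P_ik x_k,
   xi_a |-> sum_b Q_ab xi_b.  With (P,Q) = S^{-1} this is f(S^{-1} x). *)
Definition lin_pt (m : nat) (P : nat -> nat -> R) (x : pt) : pt :=
  fun i => if i < m then rsum m (fun k => P i k * x k)%R else 0%R.

Definition lin_gen (n : nat) (Q : nat -> nat -> R) (a : nat) : sfun n :=
  \big[@sadd n/szero n]_(0 <= b < 2 * n) sscale (Q a b) (@gen n b).
Arguments lin_gen : clear implicits.

Definition pull (m n : nat) (P Q : nat -> nat -> R) (F : sfun n) : sfun n :=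
  \big[@sadd n/szero n]_(S : {set 'I_(2 * n)})
     smul (@semb n (fun x => F S (lin_pt m P x)))
          (foldr (@smul n) (sone n) [seq lin_gen n Q (nat_of_ord a) | a <- enum S]).
Arguments pull : clear implicits.

(* Main.v *)
From HB Require Import structures.
From Stdlib Require Import Reals Lra ClassicalEpsilon FunctionalExtensionality.
From Coquelicot Require Import Coquelicot.
From mathcomp Require Import all_boot.
Require Import Defs.
Set Implicit Arguments. Unset Strict Implicit. Unset Printing Implicit Defensive.

(** Write [d_a] for the coordinate derivations, [s_ab] for the sign of exchanging [X_a] and
    [X_b], and [< | >] for the form defining the metric, extended to families of superfunctions.

    (ii) For constant fields the Killing equation of [F] says that the lowered and suitably
    signed components [G_b] of [F] satisfy [d_a G_b = - s_ab d_b G_a].  Hence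
    [T_cab = d_c d_a G_b] is graded symmetric in its first two and graded antisymmetric in its
    last two indices, which forces [T = 0].  So the components of [F] are linear, and their
    antisymmetric coefficients express [F] through the [L_ij].

    (i) Let [Phi_k] be the pullback of [X_k] under an isometry.  Differentiating
    [<d_a Phi | d_b Phi> = g_ab] gives the same symmetries for [<d_c d_a Phi | d_b Phi>], which
    therefore vanishes.  The Jacobian of [Phi] is inverted by the components of the fields
    conjugate to the [d_b], so [d_c d_a Phi = 0] and [Phi] is linear.

    In both cases a derivation, or an algebra morphism with linear values on the even
    coordinates, is determined by its values on coordinates: at a point [a] one expands a
    smooth function as [f = f a + sum_i (x_i - a_i) g_i] with smooth [g_i] (Hadamard). *)

(** The argument behind [T = 0] is the one that makes the Levi-Civita connection unique: alternating
    the two symmetries six times restores the index order, every graded sign occurs twice, and three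
    minus signs are left, so [T = - T]. An even Killing field has the required plain graded
    antisymmetry only after the weight (-1)^[b] is put on the lowered component [G_b].

    Second derivatives are shown to vanish before any uniqueness of morphisms is used, and this
    order matters: a first-order expansion determines a morphism once the images of the even
    coordinates have no nilpotent part. Linear images are of that kind, because constants are even
    and so an even coordinate goes to a combination of even ones; the same parity argument makes the
    matrix of an isometry block diagonal.

    The form is defined on arbitrary families because second derivatives of [Phi] and families
    [Y (F X_j)] must be inserted into it. Its odd block is [- J], and preserving [- J] is preserving
    [J]. The matrix [S] is that of the inverse [psi], since [phi] acts through its inverse. *)

HB.instance Definition _ := Monoid.isComLaw.Build R 0%R Rplus
  (fun x y z => esym (Rplus_assoc x y z)) Rplus_comm Rplus_0_l.
HB.instance Definition _ := Monoid.isMulLaw.Build R 0%R Rmult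
  Rmult_0_l Rmult_0_r.
HB.instance Definition _ := Monoid.isAddLaw.Build R Rmult Rplus
  Rmult_plus_distr_r Rmult_plus_distr_l.

Local Open Scope R_scope.

(** * Smooth functions *)

Lemma upd_same (x : pt) (i : nat) (t : R) : upd x i t i = t.
Proof. by rewrite /upd PeanoNat.Nat.eqb_refl. Qed.

Lemma upd_neq (x : pt) (i j : nat) (t : R) : j <> i -> upd x i t j = x j.
Proof. by rewrite /upd => /PeanoNat.Nat.eqb_neq ->. Qed.

Lemma upd_id (x : pt) (i : nat) : upd x i (x i) = x.
Proof.
apply: functional_extensionality => k; rewrite /upd.
by case E: (Nat.eqb k i) => //; rewrite (PeanoNat.Nat.eqb_eq k i).1.
Qed.

Lemma upd_upd (x : pt) (i : nat) (s t : R) : upd (upd x i s) i t = upd x i t.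
Proof.
by apply: functional_extensionality => k; rewrite /upd; case: (Nat.eqb k i).
Qed.

Lemma upd_comm (x : pt) (i j : nat) (s t : R) : i <> j ->
  upd (upd x i s) j t = upd (upd x j t) i s.
Proof.
move=> ij; apply: functional_extensionality => k; rewrite /upd.
case Ej: (Nat.eqb k j); case Ei: (Nat.eqb k i) => //.
by case: ij; rewrite -((PeanoNat.Nat.eqb_eq k i).1 Ei) ((PeanoNat.Nat.eqb_eq k j).1 Ej).
Qed.

Definition derivable_in (i : nat) (f : pt -> R) : Prop :=
  forall x : pt, exists l, derivable_pt_lim (fun t => f (upd x i t)) (x i) l.

(** The derivative is provided at every [t], not only at [x i], as the mean value theorem and
    differentiation under the integral require. *)
Lemma pd_spec (i : nat) (f : pt -> R) (x : pt) (t : R) : derivable_in i f ->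
  is_derive (fun s => f (upd x i s)) t (pd i f (upd x i t)).
Proof.
move=> /(_ (upd x i t)) /(epsilon_spec (inhabits 0%R)).
rewrite -/(pd i f (upd x i t)) upd_same => H; apply/is_derive_Reals.
suff <- : (fun s => f (upd (upd x i t) i s)) = (fun s => f (upd x i s)) by [].
by apply: functional_extensionality => s; rewrite upd_upd.
Qed.

Lemma pd_spec_id (i : nat) (f : pt -> R) (x : pt) : derivable_in i f ->
  is_derive (fun s => f (upd x i s)) (x i) (pd i f x).
Proof. by move=> /(pd_spec x (x i)); rewrite upd_id. Qed.

Lemma pd_is_derive (i : nat) (f : pt -> R) (x : pt) (l : R) :
  is_derive (fun s => f (upd x i s)) (x i) l -> pd i f x = l.
Proof.
move=> /is_derive_Reals H; apply: (uniqueness_limite _ _ _ _ _ H).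
by apply: (epsilon_spec (inhabits 0%R)); exists l.
Qed.

Lemma derivable_inI (i : nat) (f df : pt -> R) :
  (forall x, is_derive (fun s => f (upd x i s)) (x i) (df x)) ->
  derivable_in i f /\ pd i f = df.
Proof.
move=> H; split; first by move=> x; exists (df x); apply/is_derive_Reals.
by apply: functional_extensionality => x; apply: pd_is_derive.
Qed.

(** [smooth] quantifies over words of partial derivatives, whereas closure under products, sums and
    substitutions is proved by induction on the order. [smoothP] translates between the two. *)
Fixpoint Ck (m k : nat) (f : pt -> R) : Prop :=
  local m f /\ contm m f /\
  match k with
  | 0 => True
  | k.+1 => forall i, (i < m)%N -> derivable_in i f /\ Ck m k (pd i f)
  end.

Lemma Ck_local m k f : Ck m k f -> local m f. Proof. by case: k => [|k] []. Qed.
Lemma Ck_contm m k f : Ck m k f -> contm m f. Proof. by case: k => [|k] [] _ []. Qed.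
Lemma Ck_pd m k f i : (i < m)%N -> Ck m k.+1 f -> Ck m k (pd i f).
Proof. by move=> im [_ [_ /(_ i im) []]]. Qed.
Lemma Ck_derivable m k f i : (i < m)%N -> Ck m k.+1 f -> derivable_in i f.
Proof. by move=> im [_ [_ /(_ i im) []]]. Qed.

Lemma Ck_prev m k f : Ck m k.+1 f -> Ck m k f.
Proof.
elim: k f => [|k IH] f [lf [cf H]]; first by split.
by split=> //; split=> // i im; case: (H i im) => d C; split=> //; apply: IH.
Qed.

(** For [i >= m] a local function is constant in the direction [i], so the chosen derivative is 0
    everywhere. *)
Lemma local_pd m i f : local m f -> local m (pd i f).
Proof.
move=> lf x y xy; case: (ltnP i m) => im.
  rewrite /pd.
  suff -> : (fun t => f (upd x i t)) = (fun t => f (upd y i t)) by rewrite xy.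
  apply: functional_extensionality => t; apply: lf => k km.
  by rewrite /upd; case: (Nat.eqb k i) => //; apply: xy.
have E z : pd i f z = 0.
  apply: pd_is_derive; apply: (is_derive_ext (fun=> f z)); last first.
    exact: (@is_derive_const R_AbsRing R_NormedModule).
  move=> t; apply: lf => k km; rewrite upd_neq // => ki.
  by move: km; rewrite ki ltnNge im.
by rewrite !E.
Qed.

Lemma smoothP m f : smooth m f <-> forall k, Ck m k f.
Proof.
split=> [[lf H]|H].
  move=> k; elim: k f lf H => [|k IH] f lf H; first by split=> //; case: (H [::]).
  split=> //; split; first by case: (H [::]).
  move=> i im; split; first by case: (H [::]) => // _ /(_ i im).
  apply: IH; first exact: local_pd.
  (* A word applied to [pd i f] is the word with [i] added at its innermost, that is last, place. *)
  move=> ls als; have := H (rcons ls i).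
  by rewrite all_rcons im als /pds foldr_rcons; apply.
split; first exact: Ck_local (H 0%N).
move=> ls als; suff Hl : forall k, Ck m k (pds ls f).
  by split=> [|i im]; [apply: Ck_contm (Hl 0%N)|apply: Ck_derivable (Hl 1%N)].
elim: ls als => [//|i ls IH] /= /andP[im /IH{}IH] k.
exact: Ck_pd (IH k.+1).
Qed.

Lemma smooth_pd m i f : (i < m)%N -> smooth m f -> smooth m (pd i f).
Proof. by move=> im /smoothP H; apply/smoothP => k; apply: Ck_pd (H k.+1). Qed.

Lemma smooth_derivable m i f : (i < m)%N -> smooth m f -> derivable_in i f.
Proof. by move=> im /smoothP H; apply: Ck_derivable (H 1%N). Qed.

Lemma smooth_contm m f : smooth m f -> contm m f.
Proof. by move=> /smoothP H; apply: Ck_contm (H 0%N). Qed.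

Lemma Ck_const m k (c : R) : Ck m k (fun=> c).
Proof.
elim: k c => [|k IH] c.
  split=> //; split=> // x eps e0; exists 1; split; first lra.
  by move=> y _; rewrite Rminus_diag Rabs_R0.
split=> //; split; first exact: Ck_contm (IH c).
move=> i im; have [|d ->] := @derivable_inI i (fun=> c) (fun=> 0); last by split.
by move=> x; apply: (@is_derive_const R_AbsRing R_NormedModule).
Qed.

Lemma contm_add m f g : contm m f -> contm m g -> contm m (fun x => f x + g x).
Proof.
move=> cf cg x eps e0.
have [|df [df0 Hf]] := cf x (eps / 2); first lra.
have [|dg [dg0 Hg]] := cg x (eps / 2); first lra.
exists (Rmin df dg); split; first exact: Rmin_glb_lt.
move=> y Hy.
have {}Hf : Rabs (f y - f x) < eps / 2.
  by apply: Hf => i /Hy H; apply: Rlt_le_trans H (Rmin_l _ _).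
have {}Hg : Rabs (g y - g x) < eps / 2.
  by apply: Hg => i /Hy H; apply: Rlt_le_trans H (Rmin_r _ _).
rewrite (_ : _ - _ = (f y - f x) + (g y - g x)); last by ring.
by apply: Rle_lt_trans (Rabs_triang _ _) _; lra.
Qed.

Lemma contm_mul m f g : contm m f -> contm m g -> contm m (fun x => f x * g x).
Proof.
move=> cf cg x eps e0.
pose M := Rabs (f x) + Rabs (g x) + 1.
have M1 : 1 <= M by rewrite /M; have := Rabs_pos (f x); have := Rabs_pos (g x); lra.
(* If both increments are below [e <= 1], the error is at most
   [e + e |f x| + e |g x| = e M <= eps / 2]; the bound 1 handles the product of the two
   increments. *)
pose e := Rmin 1 (eps / (2 * M)).
have ep : 0 < e by apply: Rmin_glb_lt; [lra|apply: Rdiv_lt_0_compat; lra].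
have e1 : e <= 1 := Rmin_l _ _.
have eM : e * (2 * M) <= eps.
  have -> : eps = eps / (2 * M) * (2 * M) by field; lra.
  by apply: Rmult_le_compat_r; [lra|exact: Rmin_r].
have [|df [df0 Hf]] := cf x e; first lra.
have [|dg [dg0 Hg]] := cg x e; first lra.
exists (Rmin df dg); split; first exact: Rmin_glb_lt.
move=> y Hy.
have {}Hf : Rabs (f y - f x) < e.
  by apply: Hf => i /Hy H; apply: Rlt_le_trans H (Rmin_l _ _).
have {}Hg : Rabs (g y - g x) < e.
  by apply: Hg => i /Hy H; apply: Rlt_le_trans H (Rmin_r _ _).
rewrite (_ : _ - _ = (f y - f x) * (g y - g x) + ((f y - f x) * g x + f x * (g y - g x))); last by ring.
apply: Rle_lt_trans (Rabs_triang _ _) _; rewrite Rabs_mult.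
have := Rabs_triang ((f y - f x) * g x) (f x * (g y - g x)).
rewrite !Rabs_mult.
have := Rabs_pos (f x); have := Rabs_pos (g x).
have := Rabs_pos (f y - f x); have := Rabs_pos (g y - g x).
rewrite /M in eM M1.
move: Hf Hg; set a := Rabs (f y - _); set b := Rabs (g y - _).
set c := Rabs (f x); set d := Rabs (g x) => *.
have h1 : a * b <= e by nra.
have h2 : a * d <= e * d by nra.
have h3 : c * b <= e * c by nra.
have : e * (c + d + 1) < eps by rewrite /c /d in eM *; nra.
by nra.
Qed.

Lemma Ck_add m k f g : Ck m k f -> Ck m k g -> Ck m k (fun x => f x + g x).
Proof.
elim: k f g => [|k IH] f g Hf Hg.
all: split; first by move=> x y xy; rewrite (Ck_local Hf xy) (Ck_local Hg xy).
all: split; first by apply: contm_add; [apply: Ck_contm Hf|apply: Ck_contm Hg].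
  by [].
move=> i im; have [|d ->] := @derivable_inI i (fun x => f x + g x) (fun x => pd i f x + pd i g x).
  move=> x; apply: (@is_derive_plus R_AbsRing R_NormedModule).
    by apply: pd_spec_id (Ck_derivable im Hf).
  by apply: pd_spec_id (Ck_derivable im Hg).
by split=> //; apply: IH; apply: Ck_pd.
Qed.

Lemma pd_mul i f g : derivable_in i f -> derivable_in i g ->
  derivable_in i (fun x => f x * g x) /\
  pd i (fun x => f x * g x) = (fun x => pd i f x * g x + f x * pd i g x).
Proof.
move=> Hf Hg; apply: derivable_inI => x.
have -> : pd i f x * g x + f x * pd i g x =
  pd i f x * g (upd x i (x i)) + f (upd x i (x i)) * pd i g x by rewrite !upd_id.
apply: (@is_derive_mult R_AbsRing); last by move=> a b; apply: Rmult_comm.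
  exact: pd_spec_id.
exact: pd_spec_id.
Qed.

Lemma Ck_mul m k f g : Ck m k f -> Ck m k g -> Ck m k (fun x => f x * g x).
Proof.
elim: k f g => [|k IH] f g Hf Hg.
all: split; first by move=> x y xy; rewrite (Ck_local Hf xy) (Ck_local Hg xy).
all: split; first by apply: contm_mul; [apply: Ck_contm Hf|apply: Ck_contm Hg].
  by [].
move=> i im.
have [d ->] := pd_mul (Ck_derivable im Hf) (Ck_derivable im Hg).
split=> //; apply: Ck_add; apply: IH; try exact: Ck_pd.
all: exact: Ck_prev.
Qed.

Lemma smooth_const m (c : R) : smooth m (fun=> c).
Proof. by apply/smoothP => k; apply: Ck_const. Qed.

Lemma smooth_add m f g : smooth m f -> smooth m g -> smooth m (fun x => f x + g x).
Proof. by move=> /smoothP Hf /smoothP Hg; apply/smoothP => k; apply: Ck_add. Qed.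

Lemma smooth_mul m f g : smooth m f -> smooth m g -> smooth m (fun x => f x * g x).
Proof. by move=> /smoothP Hf /smoothP Hg; apply/smoothP => k; apply: Ck_mul. Qed.

Lemma smooth_scale m (c : R) f : smooth m f -> smooth m (fun x => c * f x).
Proof. by move=> Hf; apply: smooth_mul => //; apply: smooth_const. Qed.

Lemma Ck_sum m k (I : Type) (r : seq I) (P : pred I) (F : I -> pt -> R) :
  (forall i, P i -> Ck m k (F i)) ->
  Ck m k (fun x => \big[Rplus/0]_(i <- r | P i) F i x).
Proof.
move=> H; elim: r => [|i r IH].
  have -> : (fun x => \big[Rplus/0]_(i <- [::] | P i) F i x) = fun=> 0.
    by apply: functional_extensionality => x; rewrite big_nil.
  exact: Ck_const.
case Pi: (P i).
  have -> : (fun x => \big[Rplus/0]_(j <- i :: r | P j) F j x) =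
      (fun x => F i x + \big[Rplus/0]_(j <- r | P j) F j x).
    by apply: functional_extensionality => x; rewrite big_cons Pi.
  by apply: Ck_add => //; apply: H.
have -> : (fun x => \big[Rplus/0]_(j <- i :: r | P j) F j x) =
    (fun x => \big[Rplus/0]_(j <- r | P j) F j x) => //.
by apply: functional_extensionality => x; rewrite big_cons Pi.
Qed.

Lemma smooth_sum m (I : Type) (r : seq I) (P : pred I) (F : I -> pt -> R) :
  (forall i, P i -> smooth m (F i)) ->
  smooth m (fun x => \big[Rplus/0]_(i <- r | P i) F i x).
Proof.
move=> H; apply/smoothP => k; apply: Ck_sum => i Pi.
by have /smoothP := H i Pi.
Qed.

Lemma pd_const i (c : R) : pd i (fun=> c) = fun=> 0.
Proof.
have [|_ //] := @derivable_inI i (fun=> c) (fun=> 0).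
by move=> x; apply: (@is_derive_const R_AbsRing R_NormedModule).
Qed.

Lemma pd_coord i k : derivable_in i (fun x => x k) /\
  pd i (fun x => x k) = fun=> kdelta i k.
Proof.
apply: derivable_inI => x; rewrite /kdelta; case: eqP => [<-|ik].
  apply: (is_derive_ext (fun s => s)); first by move=> t; rewrite upd_same.
  exact: (@is_derive_id R_AbsRing).
apply: (is_derive_ext (fun=> x k)); first by move=> t; rewrite upd_neq //; apply: nesym.
exact: (@is_derive_const R_AbsRing R_NormedModule).
Qed.

Lemma smooth_coord m k : (k < m)%N -> smooth m (fun x => x k).
Proof.
move=> km; apply/smoothP; case=> [|l].
all: split; first by move=> x y; apply.
all: split; first by move=> x eps e0; exists eps; split=> // y; apply.
  by [].
by move=> i im; have [d ->] := pd_coord i k; split=> //; apply: Ck_const.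
Qed.

Lemma pd_add i f g : derivable_in i f -> derivable_in i g ->
  pd i (fun x => f x + g x) = (fun x => pd i f x + pd i g x).
Proof.
move=> Hf Hg; have [|_ //] := @derivable_inI i (fun x => f x + g x) (fun x => pd i f x + pd i g x).
move=> x; apply: (@is_derive_plus R_AbsRing R_NormedModule).
  exact: pd_spec_id.
exact: pd_spec_id.
Qed.

Lemma pd_scale i (c : R) f : derivable_in i f ->
  pd i (fun x => c * f x) = (fun x => c * pd i f x).
Proof.
move=> Hf; have [|_ ->] := @pd_mul i (fun=> c) f _ Hf.
  by move=> x; exists 0; apply: derivable_pt_lim_const.
by apply: functional_extensionality => x; rewrite pd_const; ring.
Qed.

(** * Directional derivatives along lines *)

Definition line (a v : pt) (t : R) : pt := fun i => a i + t * v i.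

Lemma coords_bounded (m : nat) (v : pt) :
  exists M, 0 < M /\ forall i, (i < m)%N -> Rabs (v i) <= M.
Proof.
elim: m => [|m [M [M0 HM]]]; first by exists 1; split; [lra|].
exists (M + Rabs (v m)); split; first by have := Rabs_pos (v m); lra.
move=> i; rewrite ltnS leq_eqVlt => /orP[/eqP->|/HM]; first by lra.
by have := Rabs_pos (v m); lra.
Qed.

Lemma derive_line0 m f (a v : pt) : Ck m 1 f ->
  derivable_pt_lim (fun s => f (line a v s)) 0 (rsum m (fun i => v i * pd i f a)).
Proof.
move=> Cf; have [lf _] := Cf.
(* Move the coordinates one at a time; [z k s] has moved the first [k] ones. *)
pose z k s : pt := fun i => if (i < k)%N then a i + s * v i else a i.
suff H k : (k <= m)%N -> derivable_pt_lim (fun s => f (z k s)) 0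
    (rsum k (fun i => v i * pd i f a)).
  have -> : (fun s => f (line a v s)) = (fun s => f (z m s)).
    by apply: functional_extensionality => s; apply: lf => i im; rewrite /z im.
  exact: H.
elim: k => [|k IH] km.
  have -> : (fun s => f (z 0%N s)) = fun=> f a.
    by apply: functional_extensionality => s; congr f.
  by rewrite /rsum big_geq //; apply: derivable_pt_lim_const.
have -> : (fun s => f (z k.+1 s)) =
    plus_fct (fun s => f (z k s)) (fun s => f (z k.+1 s) - f (z k s)).
  by apply: functional_extensionality => s; rewrite /plus_fct; ring.
rewrite /rsum big_nat_recr //=; apply: derivable_pt_lim_plus; first exact: IH (ltnW km).
have dk := Ck_derivable km Cf.
have [M [M0 HM]] := coords_bounded m v.
move=> eps e0.
have [|d [d0 Hd]] := Ck_contm (Ck_pd km Cf) a (eps := eps / M); first exact: Rdiv_lt_0_compat.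
have dM : 0 < d / M by apply: Rdiv_lt_0_compat.
exists (mkposreal _ dM) => s s0 /= sd.
have z0 j : z j 0 = a.
  by apply: functional_extensionality => i; rewrite /z; case: ifP => _ //; ring.
rewrite Rplus_0_l !z0 Rminus_diag Rminus_0_r.
have zk : upd (z k s) k (a k) = z k s.
  by rewrite -{2}(upd_id (z k s) k); congr upd; rewrite /z ltnn.
have zk1 : upd (z k s) k (a k + s * v k) = z k.+1 s.
  apply: functional_extensionality => i; have [->|/eqP ik] := eqVneq i k.
    by rewrite upd_same /z leqnn.
  by rewrite upd_neq // /z ltnS [(i <= k)%N]leq_eqVlt (introF eqP ik).
(* The increment in coordinate [k] is [s * v k] times a partial derivative at an intermediate point.
   Each coordinate of that point differs from [a] by at most [s * v] in absolute value, so
   continuity of [pd k f] at [a] applies. *)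
have [||c [Hc]] := MVT_gen (fun u => f (upd (z k s) k u)) (a k) (a k + s * v k)
   (fun u => pd k f (upd (z k s) k u)).
- by move=> u _; apply: pd_spec.
- move=> u _; apply: derivable_continuous_pt; exists (pd k f (upd (z k s) k u)).
  by apply/is_derive_Reals/pd_spec.
rewrite zk zk1 => ->.
set w := pd k f _.
have -> : w * (a k + s * v k - a k) / s - v k * pd k f a = v k * (w - pd k f a) by field.
have sv i : (i < m)%N -> Rabs (s * v i) < d.
  move=> im; rewrite Rabs_mult.
  have -> : d = d / M * M by field; lra.
  apply: Rle_lt_trans (Rmult_le_compat_l _ _ _ (Rabs_pos s) (HM i im)) _.
  exact: Rmult_lt_compat_r.
have Hw : Rabs (w - pd k f a) < eps / M.
  apply: Hd => i im; have [->|/eqP ik] := eqVneq i k.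
    rewrite upd_same; apply: (Rle_lt_trans _ _ _ _ (sv k km)).
    by move: Hc; rewrite /Rmin /Rmax; case: Rle_dec => h [h1 h2]; split_Rabs; lra.
  rewrite upd_neq // /z; case: ifP => _.
    by rewrite (_ : _ - _ = s * v i); [exact: sv|ring].
  by rewrite Rminus_diag Rabs_R0.
rewrite Rabs_mult; have -> : eps = M * (eps / M) by field; lra.
apply: Rle_lt_trans (Rmult_le_compat_r _ _ _ (Rabs_pos _) (HM k km)) _.
exact: Rmult_lt_compat_l.
Qed.

Lemma derive_line m f (a v : pt) (t : R) : Ck m 1 f ->
  is_derive (fun s => f (line a v s)) t (rsum m (fun i => v i * pd i f (line a v t))).
Proof.
move=> Cf; apply: (is_derive_ext (fun s => f (line (line a v t) v (s - t)))).
  move=> s; congr f; apply: functional_extensionality => i; rewrite /line; ring.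
rewrite -[X in is_derive _ _ X]Rmult_1_l.
apply: (is_derive_comp (fun s => f (line (line a v t) v s)) (fun s => s - t)).
  by rewrite Rminus_diag; apply/is_derive_Reals; apply: derive_line0.
by auto_derive => //; ring.
Qed.

Lemma rsum_ext k (F G : nat -> R) : (forall i, (i < k)%N -> F i = G i) -> rsum k F = rsum k G.
Proof.
by move=> H; apply: eq_big_nat => i /= ik; apply: H.
Qed.

Lemma constant_of_pd0 m f : smooth m f ->
  (forall i, (i < m)%N -> pd i f = fun=> 0) -> forall x y, f x = f y.
Proof.
move=> /smoothP Cf H x y; pose v i := y i - x i.
have D t := derive_line x v t (Cf 1%N).
have [||c [_ E]] := MVT_gen (fun s => f (line x v s)) 0 1
  (fun t => rsum m (fun i => v i * pd i f (line x v t))).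
- by move=> t _.
- by move=> t _; apply: derivable_continuous_pt; eexists; apply/is_derive_Reals/D.
have lx : line x v 0 = x by apply: functional_extensionality => i; rewrite /line; ring.
have ly : line x v 1 = y by apply: functional_extensionality => i; rewrite /line /v; ring.
suff E0 : rsum m (fun i => v i * pd i f (line x v c)) = 0.
  by move: E; rewrite lx ly E0; lra.
by rewrite /rsum big_nat big1 // => i im; rewrite H //; ring.
Qed.

(** * Linear substitutions *)

Lemma lin_pt_upd m P x j t i : (j < m)%N -> (i < m)%N ->
  lin_pt m P (upd x j t) i = line (lin_pt m P x) (fun i => P i j) (t - x j) i.
Proof.
move=> jm im; rewrite /line /lin_pt im /rsum.
rewrite (bigD1_seq j) ?mem_index_iota ?iota_uniq //= upd_same.
rewrite [in RHS](bigD1_seq j) ?mem_index_iota ?iota_uniq //=.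
have -> : \big[Rplus/0]_(0 <= i0 < m | i0 != j) (P i i0 * upd x j t i0) =
          \big[Rplus/0]_(0 <= i0 < m | i0 != j) (P i i0 * x i0).
  by apply: eq_bigr => k kj; rewrite upd_neq //; apply/eqP.
ring.
Qed.

Lemma contm_lin m P f : contm m f -> contm m (fun x => f (lin_pt m P x)).
Proof.
move=> cf x eps e0; have [d [d0 Hd]] := cf (lin_pt m P x) eps e0.
have [M [M0 HM]] : exists M, 0 < M /\ forall i, (i < m)%N ->
    rsum m (fun k => Rabs (P i k)) <= M.
  have [M [M0 HM]] := coords_bounded m (fun i => rsum m (fun k => Rabs (P i k))).
  by exists M; split=> // i im; apply: Rle_trans (HM i im); apply: Rle_abs.
exists (d / (2 * M)); split; first by apply: Rdiv_lt_0_compat; lra.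
move=> y Hy; apply: Hd => i im; rewrite /lin_pt im.
have dM : 0 < d / (2 * M) by apply: Rdiv_lt_0_compat; lra.
suff /Rle_lt_trans : Rabs (rsum m (fun k => P i k * y k) - rsum m (fun k => P i k * x k)) <=
   rsum m (fun k => Rabs (P i k)) * (d / (2 * M)).
  apply; apply: Rle_lt_trans (Rmult_le_compat_r _ _ _ (Rlt_le _ _ dM) (HM i im)) _.
  by rewrite (_ : M * _ = d / 2); [lra|field; lra].
have : forall k, (k <= m)%N -> Rabs (rsum k (fun k => P i k * y k) - rsum k (fun k => P i k * x k)) <=
   rsum k (fun k => Rabs (P i k)) * (d / (2 * M)).
  elim=> [|k IH] km; rewrite /rsum; first by rewrite !big_geq // Rminus_diag Rabs_R0; lra.
  have := IH (ltnW km); rewrite /rsum !big_nat_recr //=.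
  set A := \big[_/_]_(_ <= _ < _) _; set B := \big[_/_]_(_ <= _ < _) _.
  set C := \big[_/_]_(_ <= _ < _) _ => {}IH.
  rewrite (_ : _ - _ = (A - B) + P i k * (y k - x k)); last by ring.
  apply: Rle_trans (Rabs_triang _ _) _; rewrite Rabs_mult.
  have := Rmult_le_compat_l _ _ _ (Rabs_pos (P i k)) (Rlt_le _ _ (Hy k km)).
  by rewrite Rmult_plus_distr_r; lra.
exact.
Qed.

Lemma local_lin m P f : local m (fun x => f (lin_pt m P x)).
Proof.
move=> x y xy; congr f; apply: functional_extensionality => i; rewrite /lin_pt.
by case: ifP => // im; apply: rsum_ext => k km; rewrite xy.
Qed.

(** By the chain rule the derivative in direction [j] is the sum of [P i j] times the substituted
    [pd i f]; these are again linear substitutions, of one order less. *)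
Lemma Ck_lin m k P f : Ck m k f -> Ck m k (fun x => f (lin_pt m P x)).
Proof.
elim: k f => [|k IH] f Cf.
all: split; first exact: local_lin.
all: split; first by apply: contm_lin; apply: Ck_contm Cf.
  by [].
move=> j jm.
have [|d ->] := @derivable_inI j (fun x => f (lin_pt m P x))
  (fun x => rsum m (fun i => P i j * pd i f (lin_pt m P x))).
  move=> x; set a := lin_pt m P x.
  apply: (is_derive_ext (fun t => f (line a (fun i => P i j) (t - x j)))).
    by move=> t; apply: (Ck_local Cf) => i im; rewrite lin_pt_upd.
  have {2}-> : a = line a (fun i => P i j) (x j - x j).
    by apply: functional_extensionality => i; rewrite /line; ring.
  rewrite -[X in is_derive _ _ X]Rmult_1_l.
  apply: (is_derive_comp (fun s => f (line a (fun i => P i j) s)) (fun s => s - x j)).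
    apply: derive_line; move: Cf; clear; elim: k f => [//|k IH] f Cf.
    by apply: IH; apply: Ck_prev.
  by auto_derive => //; ring.
split=> //.
have -> : (fun x => rsum m (fun i => P i j * pd i f (lin_pt m P x))) =
  (fun x => \big[Rplus/0]_(0 <= i < m | (i < m)%N) (P i j * pd i f (lin_pt m P x))).
  by apply: functional_extensionality => x; rewrite /rsum big_nat.
apply: Ck_sum => i im; apply: Ck_mul; first exact: Ck_const.
by apply: IH; apply: Ck_pd Cf.
Qed.

Lemma smooth_lin m P f : smooth m f -> smooth m (fun x => f (lin_pt m P x)).
Proof. by move=> /smoothP Cf; apply/smoothP => k; apply: Ck_lin. Qed.

(** This is the two-variable Schwarz theorem for the restriction of [f] to the plane through [x] in
    the directions [i] and [j]; [contm] supplies the joint continuity of the mixed derivatives. *)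
Lemma pd_comm m i j f : (i < m)%N -> (j < m)%N -> smooth m f ->
  pd i (pd j f) = pd j (pd i f).
Proof.
move=> im jm Sf; have [<- //|/eqP ij] := eqVneq i j.
apply: functional_extensionality => x.
pose g u v := f (upd (upd x i u) j v).
have ji : j <> i by apply: nesym.
have Sdi := smooth_pd im Sf; have Sdj := smooth_pd jm Sf.
have g1 u v : is_derive (fun z => g z v) u (pd i f (upd (upd x i u) j v)).
  rewrite upd_comm //.
  apply: (is_derive_ext (fun z => f (upd (upd x j v) i z))).
    by move=> t; rewrite /g upd_comm.
  by apply: pd_spec; apply: smooth_derivable Sf.
have g2 u v : is_derive (fun z => g u z) v (pd j f (upd (upd x i u) j v)).
  by apply: pd_spec; apply: smooth_derivable Sf.
have g12 u v : is_derive (fun z => Derive (fun w => g z w) v) u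
    (pd i (pd j f) (upd (upd x i u) j v)).
  rewrite upd_comm //.
  apply: (is_derive_ext (fun z => pd j f (upd (upd x j v) i z))).
    by move=> t; rewrite (is_derive_unique _ _ _ (g2 _ _)) upd_comm.
  by apply: pd_spec; apply: smooth_derivable Sdj.
have g21 u v : is_derive (fun z => Derive (fun w => g w z) u) v
    (pd j (pd i f) (upd (upd x i u) j v)).
  apply: (is_derive_ext (fun z => pd i f (upd (upd x i u) j z))).
    by move=> t; rewrite (is_derive_unique _ _ _ (g1 _ _)).
  by apply: pd_spec; apply: smooth_derivable Sdi.
have c2 h : contm m h -> continuity_2d_pt (fun u v => h (upd (upd x i u) j v)) (x i) (x j).
  move=> ch eps; have [d [d0 Hd]] := ch (upd (upd x i (x i)) j (x j)) eps (cond_pos eps).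
  exists (mkposreal d d0) => u v /= Hu Hv; apply: Hd => k km; rewrite /upd.
  by case: (Nat.eqb k j) => //; case: (Nat.eqb k i) => //; rewrite Rminus_diag Rabs_R0.
have := @Schwarz g (x i) (x j); rewrite (is_derive_unique _ _ _ (g12 _ _)) (is_derive_unique _ _ _ (g21 _ _)).
have -> : upd (upd x i (x i)) j (x j) = x by rewrite upd_id upd_id.
apply.
- exists (mkposreal 1 Rlt_0_1) => u v _ _; split; [|split; [|split]].
  + by eexists; apply: g1.
  + by eexists; apply: g2.
  + by eexists; apply: g12.
  + by eexists; apply: g21.
- move=> eps; have [d Hd] := c2 _ (smooth_contm (smooth_pd im Sdj)) eps.
  by exists d => u v hu hv; rewrite !(is_derive_unique _ _ _ (g12 _ _)); apply: Hd.
- move=> eps; have [d Hd] := c2 _ (smooth_contm (smooth_pd jm Sdi)) eps.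
  by exists d => u v hu hv; rewrite !(is_derive_unique _ _ _ (g21 _ _)); apply: Hd.
Qed.

(** * Integrals along segments and Hadamard's formula *)

Definition seg (a x : pt) (t : R) : pt := line a (fun i => x i - a i) t.

Lemma contm_seg m f (a x : pt) (t eps : R) : contm m f -> 0 < eps ->
  exists d, 0 < d /\ forall y s, (forall i, (i < m)%N -> Rabs (y i - x i) < d) ->
    Rabs (s - t) < d -> Rabs (f (seg a y s) - f (seg a x t)) < eps.
Proof.
move=> cf e0; have [e [ep He]] := cf (seg a x t) eps e0.
have [M [M0 HM]] := coords_bounded m (fun i => x i - a i).
have t0 := Rabs_pos t.
pose K := Rabs t + 1 + M.
have K0 : 0 < K by rewrite /K; lra.
have eK : 0 < e / (2 * K) by apply: Rdiv_lt_0_compat; lra.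
exists (Rmin 1 (e / (2 * K))); split; first by apply: Rmin_glb_lt; lra.
move=> y s Hy Hs; apply: He => i im; rewrite /seg /line.
have {Hy}y2 : Rabs (y i - x i) <= e / (2 * K).
  by apply: Rlt_le; apply: Rlt_le_trans (Hy i im) (Rmin_r _ _).
have s1 : Rabs (s - t) <= 1 by apply: Rlt_le; apply: Rlt_le_trans Hs (Rmin_l _ _).
have s2 : Rabs (s - t) <= e / (2 * K) by apply: Rlt_le; apply: Rlt_le_trans Hs (Rmin_r _ _).
rewrite (_ : _ - _ = s * (y i - x i) + (s - t) * (x i - a i)); last by ring.
apply: Rle_lt_trans (Rabs_triang _ _) _; rewrite !Rabs_mult.
have h1 : Rabs s <= Rabs t + 1.
  have -> : s = t + (s - t) by ring.
  by apply: Rle_trans (Rabs_triang _ _) _; lra.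
have h2 := HM i im; rewrite /= in h2.
have E : e / 2 = (Rabs t + 1) * (e / (2 * K)) + (e / (2 * K)) * M.
  by rewrite /K; field; rewrite -/K; move: K0; rewrite /K; lra.
have p1 := Rmult_le_compat _ _ _ _ (Rabs_pos s) (Rabs_pos (y i - x i)) h1 y2.
have p2 := Rmult_le_compat _ _ _ _ (Rabs_pos (s - t)) (Rabs_pos (x i - a i)) s2 h2.
lra.
Qed.

(** Compactness of [0, 1] makes the radius independent of [t]; this is what makes an integral over
    the segment continuous in its endpoint. *)
Lemma contm_seg_uniform m f (a x : pt) (eps : R) : contm m f -> 0 < eps ->
  exists d, 0 < d /\ forall y t, (forall i, (i < m)%N -> Rabs (y i - x i) < d) ->
    0 <= t <= 1 -> Rabs (f (seg a y t) - f (seg a x t)) < eps.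
Proof.
move=> cf e0; have e2 : 0 < eps / 2 by lra.
have H t : exists d : posreal, forall y s,
    (forall i, (i < m)%N -> Rabs (y i - x i) < d) ->
    Rabs (s - t) < d -> Rabs (f (seg a y s) - f (seg a x t)) < eps / 2.
  by have [d [d0 Hd]] := contm_seg a x t cf e2; exists (mkposreal d d0).
pose delta t : posreal := proj1_sig (constructive_indefinite_description _ (H t)).
have Hdelta t := proj2_sig (constructive_indefinite_description _ (H t)).
have [d Hd] := compactness_value_1d 0 1 delta.
exists d; split; first exact: cond_pos.
(* The covering property from [compactness_value_1d] comes under a double negation, hence the proof
   by contradiction. *)
move=> y t Hy t01; apply: NNPP => N; apply: (Hd t t01) => -[s [s01 [ts ds]]]; apply: N.
have h1 : Rabs (f (seg a y t) - f (seg a x s)) < eps / 2.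
  by apply: Hdelta ts => i im; apply: Rlt_le_trans (Hy i im) ds.
have h2 : Rabs (f (seg a x t) - f (seg a x s)) < eps / 2.
  by apply: Hdelta ts => i im; rewrite Rminus_diag Rabs_R0; apply: cond_pos.
rewrite (_ : _ - _ = (f (seg a y t) - f (seg a x s)) - (f (seg a x t) - f (seg a x s))); last by ring.
by apply: Rle_lt_trans (Rabs_triang _ _) _; rewrite Rabs_Ropp; lra.
Qed.

Lemma continuous_seg m f (a x : pt) (t : R) : contm m f -> continuous (fun t => f (seg a x t)) t.
Proof.
move=> cf; apply/continuity_pt_filterlim => eps e0.
have [d [d0 Hd]] := contm_seg a x t cf e0; exists d; split=> // s [_ sd].
by apply: Hd => // i im; rewrite Rminus_diag Rabs_R0.
Qed.

(** Hadamard's quotient is the case [j = 0] applied to a partial derivative. Differentiating under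
    the integral releases one factor [t], so the family over all powers is closed under
    differentiation, which allows induction on the order. *)
Definition segint (a : pt) (j : nat) (f : pt -> R) (x : pt) : R :=
  RInt (fun t => t ^ j * f (seg a x t)) 0 1.

Lemma continuous_pow_seg m f (a x : pt) j (t : R) : contm m f ->
  continuous (fun t => t ^ j * f (seg a x t)) t.
Proof.
move=> cf; apply: (@continuous_mult R_UniformSpace R_AbsRing).
  by apply: ex_derive_continuous; auto_derive.
exact: continuous_seg cf.
Qed.

Lemma ex_RInt_seg m f (a x : pt) j : contm m f ->
  ex_RInt (fun t => t ^ j * f (seg a x t)) 0 1.
Proof.
by move=> cf; apply: ex_RInt_continuous => t _; apply: continuous_pow_seg cf.
Qed.

Lemma contm_segint m a j f : contm m f -> contm m (segint a j f).
Proof.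
move=> cf x eps e0; have e2 : 0 < eps / 2 by lra.
have [d [d0 Hd]] := contm_seg_uniform a x cf e2; exists d; split=> // y Hy.
rewrite /segint -[_ - _](RInt_minus (V := R_CompleteNormedModule)); last 2 first.
- exact: ex_RInt_seg cf.
- exact: ex_RInt_seg cf.
apply: Rle_lt_trans (_ : (1 - 0) * (eps / 2) < eps); last lra.
apply: abs_RInt_le_const; first lra.
  by apply: (@ex_RInt_minus R_NormedModule); apply: ex_RInt_seg cf.
move=> t t01; rewrite /minus /plus /opp /=.
rewrite (_ : _ + - _ = t ^ j * (f (seg a y t) - f (seg a x t))); last by ring.
rewrite Rabs_mult -[X in _ <= X]Rmult_1_l.
apply: Rmult_le_compat; try exact: Rabs_pos.
  rewrite -RPow_abs Rabs_pos_eq; last lra.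
  by rewrite -(pow1 j); apply: pow_incr; lra.
by apply: Rlt_le; apply: Hd.
Qed.

Lemma seg_upd a x i s t : seg a (upd x i s) t = upd (seg a x t) i (a i + t * (s - a i)).
Proof.
apply: functional_extensionality => k; rewrite /seg /line.
have [->|/eqP ki] := eqVneq k i; first by rewrite !upd_same.
by rewrite !upd_neq.
Qed.

Lemma is_derive_seg i f a x (j : nat) s t : derivable_in i f ->
  is_derive (fun s => t ^ j * f (seg a (upd x i s) t)) s
    (t ^ j.+1 * pd i f (seg a (upd x i s) t)).
Proof.
move=> df.
have -> : t ^ j.+1 * pd i f (seg a (upd x i s) t) =
    t ^ j * (t * pd i f (seg a (upd x i s) t)) by rewrite /=; ring.
apply: is_derive_scal; rewrite seg_upd.
apply: (is_derive_ext (fun s => f (upd (seg a x t) i (a i + t * (s - a i))))).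
  by move=> u; rewrite seg_upd.
apply: (is_derive_comp (fun u => f (upd (seg a x t) i u)) (fun s => a i + t * (s - a i))).
  exact: pd_spec.
by auto_derive => //; ring.
Qed.

Lemma pd_segint m i a j f : (i < m)%N -> Ck m 1 f ->
  derivable_in i (segint a j f) /\ pd i (segint a j f) = segint a j.+1 (pd i f).
Proof.
move=> im Cf; have df := Ck_derivable im Cf; have cf := Ck_contm Cf.
have cdf := Ck_contm (Ck_pd im Cf).
apply: derivable_inI => x.
have D s t := is_derive_seg a x j s t df.
have -> : segint a j.+1 (pd i f) x =
  RInt (fun t => Derive (fun s => t ^ j * f (seg a (upd x i s) t)) (x i)) 0 1.
  by apply: RInt_ext => t _; rewrite (is_derive_unique _ _ _ (D _ _)) upd_id.
apply: (is_derive_RInt_param (fun s t => t ^ j * f (seg a (upd x i s) t))).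
- by apply: filter_forall => s t _; eexists; apply: D.
- move=> t _; apply: (@continuity_2d_pt_ext (fun s t => t ^ j.+1 * pd i f (seg a (upd x i s) t))).
    by move=> u v; rewrite (is_derive_unique _ _ _ (D _ _)).
  apply: continuity_2d_pt_mult.
    apply: (continuity_1d_2d_pt_comp (fun v => v ^ j.+1) (fun u v => v)).
      by apply: derivable_continuous_pt; apply: derivable_pt_pow.
    exact: continuity_2d_pt_id2.
  move=> eps; have [d [d0 Hd]] := contm_seg a (upd x i (x i)) t cdf (cond_pos eps).
  exists (mkposreal d d0) => u v /= Hu Hv; apply: Hd => // k km.
  by rewrite /upd; case: (Nat.eqb k i) => //; rewrite Rminus_diag Rabs_R0.
- by apply: filter_forall => s; apply: ex_RInt_seg cf.
Qed.

Lemma Ck_segint m k a j f : Ck m k f -> Ck m k (segint a j f).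
Proof.
elim: k j f => [|k IH] j f Cf.
all: split; first by move=> x y xy; apply: RInt_ext => t _; congr (_ * _);
   apply: (Ck_local Cf) => i im; rewrite /seg /line xy.
all: split; first by apply: contm_segint; apply: Ck_contm Cf.
  by [].
move=> i im; have [|d ->] := @pd_segint m i a j f im.
  move: Cf; clear; elim: k f => [//|k IH] f Cf.
  by apply: IH; apply: Ck_prev.
by split=> //; apply: IH; apply: Ck_pd.
Qed.

(** The function is integrated back from its derivative along the segment from [a] to [x]; [g i] is
    the integral of [pd i f] over that segment. *)
Theorem hadamard m f (a : pt) : smooth m f ->
  exists g : nat -> pt -> R, (forall i, (i < m)%N -> smooth m (g i)) /\
    forall x, f x = f a + rsum m (fun i => (x i - a i) * g i x).
Proof.
move=> /smoothP Cf; exists (fun i => segint a 0 (pd i f)); split.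
  by move=> i im; apply/smoothP => k; apply: Ck_segint; apply: Ck_pd (Cf k.+1).
move=> x; pose v i := x i - a i.
have ci i (im : (i < m)%N) : contm m (pd i f) := Ck_contm (Ck_pd im (Cf 1%N)).
have := @is_RInt_derive R_CompleteNormedModule (fun s => f (line a v s))
   (fun t => rsum m (fun i => v i * pd i f (line a v t))) 0 1.
have C k : (k <= m)%N -> forall t, continuous (fun t => rsum k (fun i => v i * pd i f (line a v t))) t.
  elim: k => [|k IH] km t.
    apply: (continuous_ext (fun=> 0)); first by move=> s; rewrite /rsum big_geq.
    exact: continuous_const.
  apply: (continuous_ext (fun t => rsum k (fun i => v i * pd i f (line a v t)) + v k * pd k f (line a v t))).
    by move=> s; rewrite /rsum big_nat_recr.
  apply: (@continuous_plus R_UniformSpace R_AbsRing R_NormedModule); first exact: IH (ltnW km) t.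
  apply: (@continuous_mult R_UniformSpace R_AbsRing); first exact: continuous_const.
  exact: (@continuous_seg m _ a x t (ci k km)).
move=> /(_ (fun t _ => derive_line a v t (Cf 1%N)) (fun t _ => C m (leqnn m) t)).
have I k : (k <= m)%N -> is_RInt (fun t => rsum k (fun i => v i * pd i f (line a v t))) 0 1
    (rsum k (fun i => v i * segint a 0 (pd i f) x)).
  elim: k => [|k IH] km.
    rewrite /rsum big_geq //; apply: (is_RInt_ext (fun=> 0)).
      by move=> t _; rewrite big_geq.
    by have := @is_RInt_const R_NormedModule 0 1 0; rewrite /scal /= /mult /= Rmult_0_r.
  rewrite {2}/rsum big_nat_recr //=.
  apply: (is_RInt_ext (fun t => rsum k (fun i => v i * pd i f (line a v t)) + v k * pd k f (line a v t))).
    by move=> t _; rewrite /rsum big_nat_recr.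
  apply: (@is_RInt_plus R_NormedModule); first exact: IH (ltnW km).
  apply: (@is_RInt_scal R_NormedModule).
  apply: (is_RInt_ext (fun t => t ^ 0 * pd k f (seg a x t))).
    by move=> t _; rewrite /= Rmult_1_l.
  apply: (@RInt_correct R_CompleteNormedModule).
  exact: ex_RInt_seg (ci k km).
move=> /is_RInt_unique; rewrite (is_RInt_unique _ _ _ _ (I m (leqnn m))) /minus /plus /opp /=.
have -> : line a v 0 = a by apply: functional_extensionality => i; rewrite /line; ring.
have -> : line a v 1 = x by apply: functional_extensionality => i; rewrite /line /v; ring.
by rewrite /v; lra.
Qed.

(** * Superfunctions *)

Lemma sgnb_addb b c : sgnb (b (+) c) = sgnb b * sgnb c.
Proof. by case: b; case: c; rewrite /sgnb /=; lra. Qed.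

Lemma sgnb_sq b : sgnb b * sgnb b = 1.
Proof. by case: b; rewrite /sgnb; lra. Qed.

Lemma sgnABE k (A B : {set 'I_k}) : sgnAB A B =
  sgnb (odd #|[set p : 'I_k * 'I_k | (p.1 \in A) && (p.2 \in B) && (p.2 < p.1)%N]|).
Proof. by []. Qed.

Lemma sgnAB_sq k (A B : {set 'I_k}) : sgnAB A B * sgnAB A B = 1.
Proof. by rewrite sgnABE sgnb_sq. Qed.

(** The exponent of [sgnAB] counts inversions, and inversions add over a disjoint union. *)
Lemma sgnAB_Ul k (A A' B : {set 'I_k}) : [disjoint A & A'] ->
  sgnAB (A :|: A') B = sgnAB A B * sgnAB A' B.
Proof.
move=> dA; rewrite !sgnABE -sgnb_addb; congr sgnb.
rewrite -oddD -cardsUI [X in (_ + X)%N](_ : _ = 0%N).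
  rewrite addn0; congr odd; apply: eq_card => p; rewrite !inE.
  by case: (p.1 \in A); case: (p.1 \in A'); case: (p.2 \in B); case: (p.2 < p.1)%N.
apply/eqP; rewrite cards_eq0; apply/eqP/setP => p; rewrite !inE.
case pA: (p.1 \in A) => //; rewrite (disjointFr dA pA) /=.
by rewrite andbF.
Qed.

Lemma sgnAB_Ur k (A B B' : {set 'I_k}) : [disjoint B & B'] ->
  sgnAB A (B :|: B') = sgnAB A B * sgnAB A B'.
Proof.
move=> dB; rewrite !sgnABE -sgnb_addb; congr sgnb.
rewrite -oddD -cardsUI [X in (_ + X)%N](_ : _ = 0%N).
  rewrite addn0; congr odd; apply: eq_card => p; rewrite !inE.
  by case: (p.1 \in A); case: (p.2 \in B); case: (p.2 \in B'); case: (p.2 < p.1)%N.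
apply/eqP; rewrite cards_eq0; apply/eqP/setP => p; rewrite !inE.
case pB: (p.2 \in B); last by rewrite !andbF.
by rewrite (disjointFr dB pB) /= andbF andbF.
Qed.

Lemma sgnAB0l k (B : {set 'I_k}) : sgnAB set0 B = 1.
Proof.
rewrite sgnABE (_ : [set p | _] = set0) ?cards0 //.
by apply/setP => p; rewrite !inE.
Qed.

Lemma sgnAB0r k (A : {set 'I_k}) : sgnAB A set0 = 1.
Proof.
rewrite sgnABE (_ : [set p | _] = set0) ?cards0 //.
by apply/setP => p; rewrite !inE andbF.
Qed.

Lemma sgnAB_lt k (i : 'I_k) (S : {set 'I_k}) :
  (forall j, j \in S -> (i < j)%N) -> sgnAB [set i] S = 1.
Proof.
move=> H; rewrite sgnABE (_ : [set p | _] = set0) ?cards0 //.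
apply/setP => -[a b]; rewrite !inE /=; apply/negP => /andP[/andP[/eqP-> /H ib]].
by rewrite ltnNge ltnW.
Qed.

Lemma sgnAB_gt k (i j : 'I_k) : (j < i)%N -> sgnAB [set i] [set j] = -1.
Proof.
move=> ji; rewrite sgnABE (_ : [set p | _] = [set (i, j)]) ?cards1 //.
apply/setP => -[a b]; rewrite !inE /= xpair_eqE.
by case: eqP => //= ->; case: eqP => //= ->.
Qed.

(** Every pair in the product of the disjoint sets [A] and [B] is an inversion in exactly one of the
    two orders, so the two inversion numbers add up to the product of the cardinalities. *)
Lemma sgnAB_swap k (A B : {set 'I_k}) : [disjoint A & B] ->
  sgnAB B A = sgnb (odd #|A| && odd #|B|) * sgnAB A B.
Proof.
move=> dAB; rewrite !sgnABE -sgnb_addb; congr sgnb.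
rewrite -oddM -cardsX -oddD.
set I1 := [set p | _]; set I2 := [set p | _].
have E : #|setX A B| = (#|I1| + #|I2|)%N.
  pose sw (p : 'I_k * 'I_k) := (p.2, p.1).
  have swI : injective sw by move=> [a b] [c d] [-> ->].
  rewrite -(card_imset (mem I1) swI) -cardsUI [X in (_ + X)%N](_ : _ = 0%N).
    rewrite addn0; apply: eq_card => -[a b]; rewrite !inE /=.
    have -> : ((a, b) \in sw @: I1) = ((b, a) \in I1).
      by apply/imsetP/idP => [[[c d] cd [-> ->]]//|ab]; exists (b, a).
    rewrite inE /=; case aA: (a \in A) => //=; case bB: (b \in B) => //=.
    have /negP ab : a != b by apply: contraTneq bB => <-; rewrite (disjointFr dAB aA).
    by case: ltngtP => // /val_inj /eqP.
  apply/eqP; rewrite cards_eq0; apply/eqP/setP => -[a b]; rewrite !inE /=.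
  have -> : ((a, b) \in sw @: I1) = ((b, a) \in I1).
    by apply/imsetP/idP => [[[c d] cd [-> ->]]//|ab]; exists (b, a).
  by rewrite inE /=; case: (ltngtP a b); rewrite ?andbF.
by rewrite E -addnA addnn oddD odd_double addbF.
Qed.

(** * The superalgebra of superfunctions *)

Lemma sfunP n (F G : sfun n) : (forall S x, F S x = G S x) -> F = G.
Proof.
by move=> H; do 2!apply: functional_extensionality => ?.
Qed.

Lemma sumE n (I : Type) (r : seq I) (P : pred I) (F : I -> sfun n) S x :
  (\big[@sadd n/szero n]_(i <- r | P i) F i) S x = \big[Rplus/0]_(i <- r | P i) F i S x.
Proof. exact: (big_morph (fun F : sfun n => F S x)). Qed.

Lemma smulDl n (F G H : sfun n) : smul (sadd F G) H = sadd (smul F H) (smul G H).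
Proof.
apply: sfunP => S x; rewrite /smul /sadd -big_split /=.
by apply: eq_bigr => A _; ring.
Qed.

Lemma smulDr n (F G H : sfun n) : smul H (sadd F G) = sadd (smul H F) (smul H G).
Proof.
apply: sfunP => S x; rewrite /smul /sadd -big_split /=.
by apply: eq_bigr => A _; ring.
Qed.

Lemma smulZl n c (F H : sfun n) : smul (sscale c F) H = sscale c (smul F H).
Proof.
apply: sfunP => S x; rewrite /smul /sscale big_distrr /=.
by apply: eq_bigr => A _; ring.
Qed.

Lemma smulZr n c (F H : sfun n) : smul F (sscale c H) = sscale c (smul F H).
Proof.
apply: sfunP => S x; rewrite /smul /sscale big_distrr /=.
by apply: eq_bigr => A _; ring.
Qed.

Lemma smul0l n (F : sfun n) : smul (szero n) F = szero n.
Proof.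
by apply: sfunP => S x; rewrite /smul /szero big1 // => A _; ring.
Qed.

Lemma smul0r n (F : sfun n) : smul F (szero n) = szero n.
Proof.
by apply: sfunP => S x; rewrite /smul /szero big1 // => A _; ring.
Qed.

Lemma smul_suml n (I : Type) (r : seq I) (P : pred I) (F : I -> sfun n) H :
  smul (\big[@sadd n/szero n]_(i <- r | P i) F i) H =
  \big[@sadd n/szero n]_(i <- r | P i) smul (F i) H.
Proof.
apply: (big_morph (fun F => smul F H)); last exact: smul0l.
by move=> *; apply: smulDl.
Qed.

Lemma smul_sumr n (I : Type) (r : seq I) (P : pred I) (F : I -> sfun n) H :
  smul H (\big[@sadd n/szero n]_(i <- r | P i) F i) =
  \big[@sadd n/szero n]_(i <- r | P i) smul H (F i).
Proof.
apply: (big_morph (fun F => smul H F)); last exact: smul0r.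
by move=> *; apply: smulDr.
Qed.

(** Both sides are sums over ordered partitions of [S] into three parts; the right side is reindexed
    by the union [A :|: B] of the first two. The signs agree because [sgnAB] is multiplicative in
    each argument on disjoint unions. *)
Lemma smulA n (F G H : sfun n) : smul F (smul G H) = smul (smul F G) H.
Proof.
apply: sfunP => S x; rewrite /smul.
under eq_bigr => A _ do rewrite big_distrr /=.
under [RHS]eq_bigr => A _ do rewrite big_distrr big_distrl /=.
rewrite [RHS](exchange_big_dep (mem (powerset S))) /=; last first.
  by move=> A B; rewrite !inE => AS BA; apply: subset_trans AS.
apply: eq_bigr => A; rewrite inE => AS.
rewrite [RHS](reindex_onto (fun B => A :|: B) (fun C => C :\: A)) /=; last first.
  move=> C; rewrite !inE => /andP[CS AC].
  by rewrite setDE setUIr setUCr setIT; apply/setUidPr.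
apply: eq_big => [B|B].
  rewrite !inE subsetUl andbT subUset AS /= setDUl setDv set0U subsetD.
  rewrite disjoint_sym; case: (B \subset S) => //=.
  rewrite -setI_eq0 setIC; apply/eqP/eqP => [BA|<-].
    by apply/setDidPl; rewrite -setI_eq0 BA.
  by apply/setP => i; rewrite !inE; case: (i \in A); rewrite ?andbF.
rewrite inE subsetD => /andP[BS dBA].
have dAB : [disjoint A & B] by rewrite disjoint_sym.
have -> : (A :|: B) :\: A = B.
  by rewrite setDUl setDv set0U; apply/setDidPl.
have E : S :\: (A :|: B) = S :\: A :\: B by rewrite setDDl.
rewrite E.
have {1}-> : S :\: A = B :|: (S :\: A :\: B).
  by rewrite -{1}(setID (S :\: A) B); congr (_ :|: _); apply/setIidPr; rewrite subsetD BS.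
rewrite sgnAB_Ur; last by rewrite -setI_eq0 setIDA setIC setDIl setDv setI0.
rewrite sgnAB_Ul //; ring.
Qed.

Lemma smul_semb n f (F : sfun n) S x : smul (@semb n f) F S x = f x * F S x.
Proof.
rewrite /smul (bigD1 set0) ?inE ?sub0set //= big1 ?Rplus_0_r.
  by rewrite sgnAB0l setD0 /semb eqxx; ring.
by move=> A /andP[_ A0]; rewrite /semb (negbTE A0); ring.
Qed.

Lemma smul_sembr n f (F : sfun n) S x : smul F (@semb n f) S x = f x * F S x.
Proof.
rewrite /smul (bigD1 S) ?inE //= big1 ?Rplus_0_r.
  by rewrite setDv sgnAB0r /semb eqxx; ring.
move=> A; rewrite inE => /andP[AS AnS]; rewrite /semb setD_eq0.
case: ifP => [SA|_]; last by ring.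
by move: AnS; rewrite eqEsubset AS SA.
Qed.

Lemma soneE n : sone n = @semb n (fun=> 1).
Proof. by []. Qed.

Lemma smul1l n (F : sfun n) : smul (sone n) F = F.
Proof. by apply: sfunP => S x; rewrite soneE smul_semb Rmult_1_l. Qed.

Lemma smul1r n (F : sfun n) : smul F (sone n) = F.
Proof. by apply: sfunP => S x; rewrite soneE smul_sembr Rmult_1_l. Qed.

Lemma hom_eq0 n q (F : sfun n) (S : {set _}) x : hom q F -> odd #|S| != q -> F S x = 0.
Proof. by move=> /(_ S) H /H ->. Qed.

Lemma homI n q (F : sfun n) : (forall (S : {set _}) x, odd #|S| != q -> F S x = 0) -> hom q F.
Proof. by move=> H S hS; apply: functional_extensionality => x; apply: H. Qed.

Lemma hom_smul n q r (F G : sfun n) : hom q F -> hom r G -> hom (xorb q r) (smul F G).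
Proof.
move=> hF hG; apply: homI => S x oS; rewrite /smul big1 // => A; rewrite inE => AS.
have [oA|oA] := eqVneq (odd #|A|) q; last by rewrite (hom_eq0 x hF oA); ring.
rewrite (hom_eq0 (S := S :\: A) x hG); first by ring.
apply: contra oS => /eqP <-; rewrite -oA cardsD (setIidPr AS) oddB ?subset_leq_card //.
by case: (odd #|A|); case: (odd #|S|).
Qed.

Lemma hom_add n q (F G : sfun n) : hom q F -> hom q G -> hom q (sadd F G).
Proof.
move=> hF hG; apply: homI => S x oS; rewrite /sadd (hom_eq0 x hF oS) (hom_eq0 x hG oS); ring.
Qed.

Lemma hom_scale n q c (F : sfun n) : hom q F -> hom q (sscale c F).
Proof. by move=> hF; apply: homI => S x oS; rewrite /sscale (hom_eq0 x hF oS); ring. Qed.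

Lemma hom_zero n q : hom q (szero n).
Proof. by []. Qed.

Lemma hom_sum n q (I : Type) (r : seq I) (P : pred I) (F : I -> sfun n) :
  (forall i, P i -> hom q (F i)) -> hom q (\big[@sadd n/szero n]_(i <- r | P i) F i).
Proof.
by move=> H; apply: big_ind => //; apply: hom_add.
Qed.

Lemma hom_semb n f : hom false (@semb n f).
Proof. by apply: homI => S x; rewrite /semb; case: (S =P set0) => // ->; rewrite cards0. Qed.

(** Complementing the index set inside [S] exchanges the factors, and [sgnAB_swap] gives the sign;
    terms of the wrong parity vanish. *)
Lemma smulC n q r (F G : sfun n) : hom q F -> hom r G ->
  smul G F = sscale (sgnb (q && r)) (smul F G).
Proof.
move=> hF hG; apply: sfunP => S x; rewrite /sscale /smul big_distrr /=.
rewrite (reindex_onto (fun A => S :\: A) (fun A => S :\: A)) /=; last first.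
  by move=> A; rewrite inE => AS; rewrite setDDr setDv set0U; apply/setIidPr.
apply: eq_big => [A|A].
  rewrite !inE subsetDl /= setDDr setDv set0U.
  by apply/eqP/setIidPr.
rewrite inE => /andP[_ /eqP E]; rewrite E.
have dA : [disjoint A & S :\: A] by rewrite -setI_eq0 setIDA setIC setDIl setDv setI0.
have [oA|oA] := eqVneq (odd #|A|) q; last by rewrite (hom_eq0 x hF oA); ring.
have [oB|oB] := eqVneq (odd #|S :\: A|) r; last by rewrite (hom_eq0 x hG oB); ring.
by rewrite (sgnAB_swap dA) oA oB; ring.
Qed.

Lemma sinv_hom n q (F : sfun n) : hom q F -> sinv F = sscale (sgnb q) F.
Proof.
move=> hF; apply: sfunP => S x; rewrite /sinv /sscale.
have [<-|oS] := eqVneq (odd #|S|) q; first by case: odd; rewrite /sgnb; ring.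
by rewrite (hom_eq0 x hF oS); case: odd; ring.
Qed.

(* [ring] compares atoms syntactically, and sets over ['I_k] may carry different
   but convertible structures on ['I_k]. *)
Ltac sring := rewrite ?/reverse_coercion /=; ring.

(** * Odd partial derivatives *)

Lemma doddE n (i : 'I_(2 * n)) (F : sfun n) S x :
  dodd i F S x = if i \in S then 0 else sgnAB [set i] S * F (i |: S) x.
Proof.
rewrite /dodd; case: ifP => iS.
  by rewrite big1 // => j /andP[/eqP/val_inj->]; rewrite iS.
rewrite (big_pred1 i) // => j /=.
have [->|/negbTE ji] := eqVneq j i; first by rewrite eqxx iS.
by rewrite (inj_eq val_inj) ji.
Qed.

Lemma hom_dodd n (i : 'I_(2 * n)) q (F : sfun n) : hom q F -> hom (~~ q) (dodd i F).
Proof.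
move=> hF; apply: homI => S x oS; rewrite doddE; case: ifP => // iS.
rewrite (hom_eq0 x hF); first ring.
by rewrite cardsU1 iS /=; move: oS; case: (odd _); case: q {hF}.
Qed.

Lemma big_powersetU1 k (i : 'I_k) (T : {set 'I_k}) (f : {set 'I_k} -> R) : i \notin T ->
  \big[Rplus/0]_(A in powerset (i |: T)) f A =
  \big[Rplus/0]_(A in powerset T) (f A + f (i |: A)).
Proof.
move=> iT; rewrite big_split (bigID (fun A : {set 'I_k} => i \in A)) /= Rplus_comm.
congr (_ + _).
  by apply: eq_bigl => A; rewrite !inE -subsetD1 setU1K.
rewrite (reindex_onto (fun A => i |: A) (fun A => A :\ i)) /=; last first.
  by move=> A /andP[_ iA]; rewrite setD1K.
apply: eq_bigl => A; rewrite !inE eqxx andbT /=.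
apply/andP/idP => [[H /eqP E]|AT].
  rewrite -(setU1K iT) subsetD1 (subset_trans (subsetU1 i A)) //=.
  by rewrite -E setD11.
have iA : i \notin A by apply: contra iT => /(subsetP AT).
by rewrite setUS // setU1K.
Qed.

Lemma sgnAB1_swap k (i : 'I_k) (A : {set 'I_k}) : i \notin A ->
  sgnAB A [set i] = sgnb (odd #|A|) * sgnAB [set i] A.
Proof. by move=> iA; rewrite (@sgnAB_swap _ [set i]) ?disjoints1 // cards1. Qed.

(** Subsets are grouped in pairs [A], [i |: A]. If [i] is not in [S], the two members of a pair
    yield the two terms of the Leibniz rule. If [i] is in [S], the left side is 0, and the term of
    [A] in the first product cancels that of [i |: A] in the second. *)
Lemma dodd_smul n (i : 'I_(2 * n)) q (F G : sfun n) : hom q F ->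
  dodd i (smul F G) =
  sadd (smul (dodd i F) G) (sscale (sgnb q) (smul F (dodd i G))).
Proof.
move=> hF; apply: sfunP => S x; rewrite doddE /sadd /sscale /smul.
have dSA (A : {set _}) : [disjoint A & S :\: A] by rewrite -setI_eq0 setIDA setIC setDIl setDv setI0.
case: ifPn => iS.
  rewrite -(setD1K iS); set T := S :\ i.
  have iT : i \notin T by rewrite setD11.
  clearbody T.
  rewrite !big_powersetU1 // big_distrr -big_split /= big1 // => A; rewrite inE => AT.
  have iA : i \notin A by apply: contra iT => /(subsetP AT).
  have -> : (i |: T) :\: (i |: A) = T :\: A.
    apply/setP => j; rewrite !inE; have [->|_] //= := eqVneq j i.
    by rewrite (negbTE iT) andbF.
  have -> : (i |: T) :\: A = i |: (T :\: A).
    apply/setP => j; rewrite !inE; have [->|_] //= := eqVneq j i.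
    by rewrite iA.
  have iTA : i \notin T :\: A by rewrite inE (negbTE iT) andbF.
  have dA : [disjoint A & T :\: A] by rewrite -setI_eq0 setIDA setIC setDIl setDv setI0.
  rewrite !doddE !setU11 (negbTE iA) (negbTE iTA).
  have [oA|oA] := eqVneq (odd #|i |: A|) q; last by rewrite (hom_eq0 x hF oA); ring.
  rewrite sgnAB_Ur ?disjoints1 // sgnAB_Ul ?disjoints1 // (sgnAB1_swap iA).
  move: oA; rewrite cardsU1 iA add1n /= => <-.
  have E1 := sgnAB_sq [set i] A; have E2 := sgnAB_sq [set i] (T :\: A).
  move: E1 E2; set a := sgnAB [set i] A; set b := sgnAB [set i] (T :\: A) => E1 E2.
  (* The reordering signs are collected into squares, which are 1; what remains is a pair of terms
     with opposite signs. *)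
  transitivity (sgnb (odd #|A|) * sgnAB A (T :\: A) * F (i |: A) x * G (i |: (T :\: A)) x *
     (a * a) + sgnb (~~ odd #|A|) * sgnAB A (T :\: A) * F (i |: A) x * G (i |: (T :\: A)) x *
     (b * b)); first by sring.
  by rewrite E1 E2; case: (odd #|A|); rewrite /sgnb /=; ring.
rewrite big_powersetU1 // !big_distrr -big_split /=; apply: eq_bigr => A; rewrite inE => AS.
have iA : i \notin A by apply: contra iS => /(subsetP AS).
have -> : (i |: S) :\: (i |: A) = S :\: A.
  apply/setP => j; rewrite !inE; have [->|_] //= := eqVneq j i.
  by rewrite (negbTE iS) andbF.
have -> : (i |: S) :\: A = i |: (S :\: A).
  apply/setP => j; rewrite !inE; have [->|_] //= := eqVneq j i.
  by rewrite iA.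
have iSA : i \notin S :\: A by rewrite inE (negbTE iS) andbF.
rewrite !doddE (negbTE iA) (negbTE iSA).
have {1}-> : S = A :|: (S :\: A) by rewrite -{1}(setID S A) (setIidPr AS).
rewrite !sgnAB_Ur ?disjoints1 // sgnAB_Ul ?disjoints1 // (sgnAB1_swap iA).
have E1 := sgnAB_sq [set i] A; have E2 := sgnAB_sq [set i] (S :\: A).
move: E1 E2; set a := sgnAB [set i] A; set b := sgnAB [set i] (S :\: A) => E1 E2.
transitivity (sgnb (odd #|A|) * sgnAB A (S :\: A) * F A x * G (i |: (S :\: A)) x *
     (a * a) * b + a * sgnAB A (S :\: A) * F (i |: A) x * G (S :\: A) x *
     (b * b)); first by sring.
rewrite E1 E2; have [oA|oA] := eqVneq (odd #|A|) q; last by rewrite (hom_eq0 x hF oA); ring.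
by rewrite oA; ring.
Qed.

Lemma dodd_anti n (i j : 'I_(2 * n)) (F : sfun n) :
  dodd i (dodd j F) = sscale (-1) (dodd j (dodd i F)).
Proof.
apply: sfunP => S x; rewrite /sscale !doddE !in_setU1.
have [->|ij] := eqVneq i j; first by rewrite ?eqxx /=; case: ifP => _; ring.
rewrite /=; case: ifPn => iS; case: ifPn => jS; try by ring.
have ji : j != i by rewrite eq_sym.
rewrite !sgnAB_Ur ?disjoints1 // setUCA.
suff -> : sgnAB [set j] [set i] = - sgnAB [set i] [set j] by ring.
have [ltij|ltji|/val_inj E] := ltngtP (i : nat) j.
- rewrite (sgnAB_gt ltij) sgnAB_lt // => a; rewrite inE => /eqP -> //.
- by rewrite (sgnAB_gt ltji) sgnAB_lt; [ring|move=> a; rewrite inE => /eqP ->].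
by rewrite E eqxx in ij.
Qed.

(** * Monomials in the odd generators and in anticommuting elements *)

Definition ebase n (A : {set 'I_(2 * n)}) : sfun n :=
  fun S _ => if S == A then 1 else 0.

Lemma gen_ebase n (i : 'I_(2 * n)) : @gen n i = ebase [set i].
Proof.
apply: sfunP => S x; rewrite /gen /ebase; congr (if _ then _ else _).
apply/existsP/eqP => [[j /andP[/eqP-> /eqP/val_inj->]]//|->].
by exists i; rewrite !eqxx.
Qed.

Lemma ebase0 n : ebase set0 = sone n.
Proof. by []. Qed.

Lemma smul_ebase_lt n (b : 'I_(2 * n)) (S : {set 'I_(2 * n)}) : (forall j, j \in S -> (b < j)%N) ->
  smul (ebase [set b]) (ebase S) = ebase (b |: S).
Proof.
move=> H; apply: sfunP => T x; rewrite /smul /ebase.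
have bS : b \notin S by apply/negP => /H; rewrite ltnn.
have [->|TS] := eqVneq T (b |: S).
  rewrite (bigD1 [set b]) ?inE ?sub1set ?setU11 //= big1 ?Rplus_0_r.
    have -> : (b |: S) :\: [set b] = S := setU1K bS.
    by rewrite !eqxx sgnAB_lt //; ring.
  by move=> A /andP[_ /negbTE ->]; ring.
rewrite big1 // => A; rewrite inE => AT.
case: eqP => [E|_]; last by ring.
case: eqP => [E'|_]; last by ring.
move: TS; rewrite -E' E setD1K ?eqxx //.
by apply: (subsetP AT); rewrite E inE.
Qed.

Lemma enum_setU1_lt k (b : 'I_k) (S : {set 'I_k}) : (forall j, j \in S -> (b < j)%N) ->
  enum (b |: S) = b :: enum S.
Proof.
move=> H; have bS : b \notin S by apply/negP => /H; rewrite ltnn.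
pose r := relpre (@nat_of_ord k) ltn.
have rt : transitive r by move=> x y z; apply: ltn_trans.
have ri : irreflexive r by move=> x; rewrite /r /= ltnn.
have se (A : {set 'I_k}) : sorted r (enum A).
  rewrite /enum_mem; apply: sorted_filter => //.
  by rewrite -sorted_map -enumT val_enum_ord iota_ltn_sorted.
apply: (irr_sorted_eq rt ri) => //.
  rewrite /= path_sortedE // se andbT; apply/allP => j; rewrite mem_enum; exact: H.
by move=> j; rewrite inE !mem_enum !inE.
Qed.

(** Adding a new smallest element matches the increasing order of the factors: it puts one factor in
    front of a monomial without a sign. *)
Lemma set_min_ind k (P : {set 'I_k} -> Prop) : P set0 ->
  (forall (b : 'I_k) (S : {set 'I_k}), (forall j, j \in S -> (b < j)%N) -> P S -> P (b |: S)) ->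
  forall S, P S.
Proof.
move=> P0 PU S; elim: {S}_.+1 {-2}S (ltnSn #|S|) => // c IH S; rewrite ltnS => cS.
have [->//|/set0Pn[i iS]] := eqVneq S set0.
have [b bS0 bmin] := arg_minnP (@nat_of_ord k) iS.
have bS : b \in S := bS0.
rewrite -(setD1K bS); apply: PU.
  move=> j; rewrite !inE => /andP[jb jS]; rewrite ltn_neqAle bmin // andbT.
  by rewrite eq_sym (inj_eq val_inj).
apply: IH; apply: leq_trans cS; by rewrite (cardsD1 b S) bS.
Qed.

(** The image of the monomial with index set [S] when each odd generator [a] is replaced by
    [eta a]. *)
Definition etaP n (eta : 'I_(2 * n) -> sfun n) (S : {set 'I_(2 * n)}) : sfun n :=
  foldr (@smul n) (sone n) [seq eta a | a <- enum S].

Lemma etaP0 n (eta : 'I_(2 * n) -> sfun n) : etaP eta set0 = sone n.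
Proof. by rewrite /etaP enum_set0. Qed.

Lemma etaPU n (eta : 'I_(2 * n) -> sfun n) (b : 'I_(2 * n)) (S : {set 'I_(2 * n)}) :
  (forall j, j \in S -> (b < j)%N) -> etaP eta (b |: S) = smul (eta b) (etaP eta S).
Proof. by move=> H; rewrite /etaP enum_setU1_lt. Qed.

Lemma etaP_mul1 n (eta : 'I_(2 * n) -> sfun n) a (S : {set 'I_(2 * n)}) :
  (forall a b : 'I_(2 * n), smul (eta a) (eta b) = sscale (-1) (smul (eta b) (eta a))) ->
  smul (eta a) (etaP eta S) =
  if a \in S then szero n else sscale (sgnAB [set a] S) (etaP eta (a |: S)).
Proof.
move=> anti.
(* Anticommutation of an element with itself reads [x = - x], so squares vanish over the reals. *)
have sq b : smul (eta b) (eta b) = szero n.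
  apply: sfunP => T x; have := f_equal (fun F : sfun n => F T x) (anti b b).
  by rewrite /sscale /szero; lra.
elim/set_min_ind: S => [|b S H IH].
  rewrite inE sgnAB0r.
  rewrite etaPU; last by move=> j; rewrite inE.
  by apply: sfunP => T x; rewrite /sscale; ring.
have bS : b \notin S by apply/negP => /H; rewrite ltnn.
have [ab|ba|/val_inj ab] := ltngtP (a : nat) b.
- have aS j : j \in b |: S -> (a < j)%N.
    by rewrite in_setU1 => /orP[/eqP->//|/H]; apply: ltn_trans.
  have -> : a \in b |: S = false by apply/negP => /aS; rewrite ltnn.
  rewrite (sgnAB_lt aS) (etaPU _ aS).
  by apply: sfunP => T x; rewrite /sscale; ring.
(* Moving [eta a] past the smaller factor [eta b] costs -1, which is [sgnAB [set a] [set b]]; the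
   induction hypothesis treats the rest. *)
- have anb : a != b by rewrite -(inj_eq val_inj) neq_ltn ba orbT.
  rewrite etaPU // smulA anti smulZl -smulA IH in_setU1 (negbTE anb) /=.
  case: ifPn => aS; first by rewrite smul0r; apply: sfunP => T x; rewrite /sscale /szero; ring.
  have Hb j : j \in a |: S -> (b < j)%N by rewrite in_setU1 => /orP[/eqP->//|/H].
  rewrite setUCA (etaPU _ Hb) sgnAB_Ur ?disjoints1 // (sgnAB_gt ba) smulZr.
  by apply: sfunP => T x; rewrite /sscale; ring.
- by rewrite ab setU11 etaPU // smulA sq smul0l.
Qed.

(** The elements [eta a] obey the same multiplication table as the odd generators. This is what
    makes substitution into superfunctions multiplicative. *)
Lemma etaP_mul n (eta : 'I_(2 * n) -> sfun n) (A B : {set 'I_(2 * n)}) :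
  (forall a b : 'I_(2 * n), smul (eta a) (eta b) = sscale (-1) (smul (eta b) (eta a))) ->
  smul (etaP eta A) (etaP eta B) =
  if [disjoint A & B] then sscale (sgnAB A B) (etaP eta (A :|: B)) else szero n.
Proof.
move=> anti; elim/set_min_ind: A => [|b A H IH].
  rewrite etaP0 smul1l set0U sgnAB0l -setI_eq0 set0I eqxx.
  by apply: sfunP => T x; rewrite /sscale; ring.
have bA : b \notin A by apply/negP => /H; rewrite ltnn.
rewrite etaPU // -smulA IH -[in RHS]setI_eq0 setIUl setU_eq0 !setI_eq0 disjoints1.
case: ifPn => dAB; last by rewrite andbF smul0r.
rewrite andbT smulZr etaP_mul1 // in_setU (negbTE bA) /=.
case: ifPn => bB /=; first by apply: sfunP => T x; rewrite /sscale /szero; ring.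
rewrite sgnAB_Ul ?disjoints1 // sgnAB_Ur // (sgnAB_lt H) setUA.
by apply: sfunP => T x; rewrite /sscale; sring.
Qed.

(** * Smooth superfunctions and their generators *)

Lemma sO_zero m n : sO m n (szero n).
Proof. by move=> S; apply: smooth_const. Qed.

Lemma sO_add m n (F G : sfun n) : sO m n F -> sO m n G -> sO m n (sadd F G).
Proof. by move=> sF sG S; apply: smooth_add. Qed.

Lemma sO_scale m n c (F : sfun n) : sO m n F -> sO m n (sscale c F).
Proof. by move=> sF S; apply: smooth_scale. Qed.

Lemma sO_mul m n (F G : sfun n) : sO m n F -> sO m n G -> sO m n (smul F G).
Proof.
move=> sF sG S; apply: smooth_sum => A _; apply: smooth_mul => //.
exact: smooth_scale.
Qed.

Lemma sO_sum m n (I : Type) (r : seq I) (P : pred I) (F : I -> sfun n) :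
  (forall i, P i -> sO m n (F i)) -> sO m n (\big[@sadd n/szero n]_(i <- r | P i) F i).
Proof.
by move=> H; apply: big_ind => //; [apply: sO_zero|apply: sO_add].
Qed.

Lemma sO_semb m n f : smooth m f -> sO m n (@semb n f).
Proof.
move=> sf S; rewrite /semb; case: eqP => _ //; exact: smooth_const.
Qed.

Lemma sO_one m n : sO m n (sone n).
Proof. by rewrite soneE; apply: sO_semb; apply: smooth_const. Qed.

Lemma sO_gen m n a : sO m n (@gen n a).
Proof. by move=> S; rewrite /gen; apply: smooth_const. Qed.

Lemma sO_ebase m n (A : {set 'I_(2 * n)}) : sO m n (ebase A).
Proof. by move=> S; apply: smooth_const. Qed.

Lemma sO_coord m n k : sO m n (coord m n k).
Proof.
rewrite /coord; case: ifP => km; last exact: sO_gen.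
by apply: sO_semb; apply: smooth_coord.
Qed.

Lemma sO_sinv m n (F : sfun n) : sO m n F -> sO m n (sinv F).
Proof.
move=> sF S; rewrite /sinv; case: odd => //.
suff -> : (fun x => - F S x) = (fun x => -1 * F S x) by apply: smooth_scale.
by apply: functional_extensionality => x; ring.
Qed.

Lemma hom_gen n a : hom true (@gen n a).
Proof.
apply: homI => S x oS; rewrite /gen; case: existsP => // -[i /andP[/eqP Si _]].
by move: oS; rewrite Si cards1.
Qed.

Lemma hom_coord m n k : hom (par m k) (coord m n k).
Proof.
rewrite /coord /par leqNgt; case: ifP => _; first exact: hom_semb.
exact: hom_gen.
Qed.

Lemma hom_one n : hom false (sone n).
Proof. by rewrite soneE; apply: hom_semb. Qed.

(** Every superfunction is the finite sum of its coefficients times monomials, and monomials are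
    built one generator at a time. The left factor of a product may be taken homogeneous, as the
    graded Leibniz rule demands. *)
Lemma sO_span m n (K : sfun n -> Prop) :
  K (szero n) -> K (sone n) ->
  (forall F G, sO m n F -> sO m n G -> K F -> K G -> K (sadd F G)) ->
  (forall q F G, sO m n F -> sO m n G -> hom q F -> K F -> K G -> K (smul F G)) ->
  (forall i, (i < 2 * n)%N -> K (@gen n i)) -> (forall f, smooth m f -> K (@semb n f)) ->
  forall F, sO m n F -> K F.
Proof.
move=> K0 K1 KD KM Kg Ks F sF.
have -> : F = \big[@sadd n/szero n]_S smul (@semb n (F S)) (ebase S).
  apply: sfunP => T x; rewrite sumE (bigD1 T) //= big1 ?Rplus_0_r.
    by rewrite smul_semb /ebase eqxx Rmult_1_r.
  by move=> S ST; rewrite smul_semb /ebase eq_sym (negbTE ST) Rmult_0_r.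
(* Membership in [sO] is carried along, since the additivity hypothesis asks for it on partial
   sums. *)
suff [] : K (\big[@sadd n/szero n]_S smul (@semb n (F S)) (ebase S)) /\
          sO m n (\big[@sadd n/szero n]_S smul (@semb n (F S)) (ebase S)) by [].
apply: (big_ind (fun G => K G /\ sO m n G)).
- by split=> //; apply: sO_zero.
- by move=> G H [KG sG] [KH sH]; split; [apply: KD|apply: sO_add].
move=> S _; have ss := sO_semb (n := n) (sF S); have se := sO_ebase m S.
split; last exact: sO_mul.
apply: (KM false) => //; [exact: hom_semb|exact: Ks|].
elim/set_min_ind: S {ss se} => // b S H IH.
rewrite -(smul_ebase_lt H) -gen_ebase; apply: (KM true) => //.
- exact: sO_gen.
- exact: sO_ebase.
- exact: hom_gen.
- exact: Kg.
Qed.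

Lemma semb_hadamard m n f (a : pt) : smooth m f -> exists g : nat -> pt -> R,
  (forall i, (i < m)%N -> smooth m (g i)) /\
  @semb n f = sadd (sscale (f a) (sone n))
    (\big[@sadd n/szero n]_(0 <= i < m)
       smul (sadd (coord m n i) (sscale (- a i) (sone n))) (@semb n (g i))).
Proof.
move=> /(hadamard a)[g [sg Hf]]; exists g; split=> //.
apply: sfunP => S x; rewrite /sadd sumE {1}/semb Hf /sscale.
case: (S =P set0) => [->|S0].
  rewrite /sone eqxx Rmult_1_r; congr (_ + _); apply: eq_big_nat => i /= im.
  by rewrite smul_sembr /coord im /semb eqxx; ring.
rewrite big_nat big1 => [|i /= im].
  by rewrite /sone; case: eqP => // _; ring.
by rewrite smul_sembr /coord im /semb /sone; case: eqP => // _; ring.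
Qed.

(** * Derivations *)

Lemma hder_sO m n p D F : hder m n p D -> sO m n F -> sO m n (D F).
Proof. by case=> H _; apply: H. Qed.

Lemma hder_add m n p D F G : hder m n p D -> sO m n F -> sO m n G ->
  D (sadd F G) = sadd (D F) (D G).
Proof. by case=> _ [H _]; apply: H. Qed.

Lemma hder_scale m n p D c F : hder m n p D -> sO m n F ->
  D (sscale c F) = sscale c (D F).
Proof. by case=> _ [_ [H _]]; apply: H. Qed.

Lemma hder_hom m n p D q F : hder m n p D -> sO m n F -> hom q F -> hom (xorb p q) (D F).
Proof. by case=> _ [_ [_ [H _]]]; apply: H. Qed.

Lemma hder_mul m n p D q F G : hder m n p D -> sO m n F -> sO m n G -> hom q F ->
  D (smul F G) = sadd (smul (D F) G) (sscale (sgnb (p && q)) (smul F (D G))).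
Proof. by case=> _ [_ [_ [_ H]]]; apply: H. Qed.

Lemma sscale0 n (F : sfun n) : sscale 0 F = szero n.
Proof. by apply: sfunP => S x; rewrite /sscale /szero; ring. Qed.

Lemma sscale1 n (F : sfun n) : sscale 1 F = F.
Proof. by apply: sfunP => S x; rewrite /sscale; ring. Qed.

Lemma sscale_sscale n c d (F : sfun n) : sscale c (sscale d F) = sscale (c * d) F.
Proof. by apply: sfunP => S x; rewrite /sscale; ring. Qed.

Lemma hder_zero m n p D : hder m n p D -> D (szero n) = szero n.
Proof.
by move=> hD; rewrite -(sscale0 (szero n)) (hder_scale _ hD) ?sscale0 //; apply: sO_zero.
Qed.

Lemma hder_one m n p D : hder m n p D -> D (sone n) = szero n.
Proof.
move=> hD; have := hder_mul hD (@sO_one m n) (@sO_one m n) (@hom_one n).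
rewrite smul1l smul1r smul1l andbF sscale1 => E; apply: sfunP => S x.
by have := f_equal (fun F : sfun n => F S x) E; rewrite /sadd /szero; lra.
Qed.

Lemma hder_sum m n p D (I : Type) (r : seq I) (P : pred I) (F : I -> sfun n) :
  hder m n p D -> (forall i, P i -> sO m n (F i)) ->
  D (\big[@sadd n/szero n]_(i <- r | P i) F i) = \big[@sadd n/szero n]_(i <- r | P i) D (F i).
Proof.
move=> hD sF; elim: r => [|i r IH]; first by rewrite !big_nil (hder_zero hD).
rewrite !big_cons; case: ifP => // Pi.
rewrite (hder_add hD); first by rewrite IH.
  exact: sF.
exact: sO_sum.
Qed.

(* Hadamard's formula at the point where the two values are compared. *)
Lemma hder_uniq m n p D D' : hder m n p D -> hder m n p D' ->
  (forall k, (k < m + 2 * n)%N -> D (coord m n k) = D' (coord m n k)) ->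
  forall F, sO m n F -> D F = D' F.
Proof.
move=> hD hD' H; apply: sO_span.
- by rewrite (hder_zero hD) (hder_zero hD').
- by rewrite (hder_one hD) (hder_one hD').
- by move=> F G sF sG EF EG; rewrite (hder_add hD) // (hder_add hD') // EF EG.
- move=> q F G sF sG hF EF EG.
  by rewrite (hder_mul hD sF sG hF) (hder_mul hD' sF sG hF) EF EG.
- move=> i i2n; have := H (m + i)%N; rewrite ltn_add2l => /(_ i2n).
  by rewrite /coord ltnNge leq_addr /= addKn.
move=> f sf; apply: sfunP => S a.
have [g [sg ->]] := semb_hadamard n a sf.
have sc i : sO m n (sadd (coord m n i) (sscale (- a i) (sone n))).
  by apply: sO_add; [apply: sO_coord|apply: sO_scale; apply: sO_one].
(* At the point [a] the terms in which [x_i - a_i] stays undifferentiated vanish, so the value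
   depends only on the images of the even coordinates. *)
have E D0 : hder m n p D0 -> D0 (sadd (sscale (f a) (sone n)) (\big[@sadd n/szero n]_(0 <= i < m)
       smul (sadd (coord m n i) (sscale (- a i) (sone n))) (@semb n (g i)))) S a =
    \big[Rplus/0]_(0 <= i < m) (g i a * D0 (coord m n i) S a).
  move=> h0; rewrite big_nat (hder_add h0); last 2 first.
  - by apply: sO_scale; apply: sO_one.
  - by apply: sO_sum => i /= im; apply: sO_mul; [exact: sc|apply: sO_semb; apply: sg].
  rewrite (hder_scale _ h0) ?(hder_one h0); last exact: sO_one.
  rewrite (hder_sum _ h0); last first.
    by move=> i /= im; apply: sO_mul; [exact: sc|apply: sO_semb; apply: sg].
  rewrite /sadd {1}/sscale {1}/szero Rmult_0_r Rplus_0_l sumE -big_nat.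
  apply: eq_big_nat => i /= im.
  have hc : hom false (sadd (coord m n i) (sscale (- a i) (sone n))).
    by apply: hom_add; [rewrite /coord im; apply: hom_semb|apply: hom_scale; apply: hom_one].
  rewrite (hder_mul h0 (sc i) (sO_semb (n := n) (sg i im)) hc) andbF sscale1 /sadd smul_sembr.
  have -> : (fun S x => coord m n i S x + sscale (- a i) (sone n) S x) =
            @semb n (fun x => x i - a i).
    by apply: sfunP => T y; rewrite /coord im /semb /sscale /sone; case: eqP => _; ring.
  rewrite smul_semb Rminus_diag Rmult_0_l Rplus_0_r; congr (_ * _).
  have -> : @semb n (fun x => x i - a i) = sadd (coord m n i) (sscale (- a i) (sone n)).
    by apply: sfunP => T y; rewrite /sadd /coord im /semb /sscale /sone; case: eqP => _; ring.
  rewrite (hder_add h0); [|exact: sO_coord|by apply: sO_scale; apply: sO_one].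
  rewrite (hder_scale _ h0) ?(hder_one h0); last exact: sO_one.
  by rewrite /sadd /sscale /szero; ring.
rewrite (E D hD) (E D' hD'); apply: eq_big_nat => i /= im.
by rewrite H // ltn_addr.
Qed.

(** * Algebra morphisms and linear pullbacks *)

Lemma smorph_sum m n phi (I : Type) (r : seq I) (P : pred I) (F : I -> sfun n) :
  smorph m n phi -> (forall i, P i -> sO m n (F i)) ->
  phi (\big[@sadd n/szero n]_(i <- r | P i) F i) = \big[@sadd n/szero n]_(i <- r | P i) phi (F i).
Proof.
move=> [_ [pD [pZ _]]] sF; elim: r => [|i r IH].
  by rewrite !big_nil -(sscale0 (szero n)) pZ ?sscale0 //; apply: sO_zero.
rewrite !big_cons; case: ifP => // Pi.
rewrite pD; first by rewrite IH.
  exact: sF.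
exact: sO_sum.
Qed.

(** To compare values at [x], Hadamard's formula is taken at the point [a] with coordinates [l i x].
    The image of [x_i - a_i] then vanishes at [x] in all components, because [l i] has no nilpotent
    part, and both morphisms send [f] to [f a] there. *)
Lemma smorph_uniq m n phi phi' (l : nat -> pt -> R) : smorph m n phi -> smorph m n phi' ->
  (forall k, (k < m + 2 * n)%N -> phi (coord m n k) = phi' (coord m n k)) ->
  (forall i, (i < m)%N -> phi (coord m n i) = @semb n (l i)) ->
  forall F, sO m n F -> phi F = phi' F.
Proof.
move=> hD hD' H Hl.
have [_ [pD [pZ [pM [p1 _]]]]] := hD; have [_ [pD' [pZ' [pM' [p1' _]]]]] := hD'.
apply: sO_span.
- by rewrite -(sscale0 (szero n)) pZ ?pZ' ?sscale0 //; apply: sO_zero.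
- by rewrite p1 p1'.
- by move=> F G sF sG EF EG; rewrite pD // pD' // EF EG.
- by move=> q F G sF sG hF EF EG; rewrite pM // pM' // EF EG.
- move=> i i2n; have := H (m + i)%N; rewrite ltn_add2l => /(_ i2n).
  by rewrite /coord ltnNge leq_addr /= addKn.
move=> f sf; apply: sfunP => S x.
pose a : pt := fun i => l i x.
have [g [sg ->]] := semb_hadamard n a sf.
have sc i : sO m n (sadd (coord m n i) (sscale (- a i) (sone n))).
  by apply: sO_add; [apply: sO_coord|apply: sO_scale; apply: sO_one].
have E phi0 : smorph m n phi0 -> (forall i, (i < m)%N -> phi0 (coord m n i) = @semb n (l i)) ->
  phi0 (sadd (sscale (f a) (sone n)) (\big[@sadd n/szero n]_(0 <= i < m)
       smul (sadd (coord m n i) (sscale (- a i) (sone n))) (@semb n (g i)))) S x =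
    f a * sone n S x.
  move=> h0 H0; have [_ [qD [qZ [qM [q1 _]]]]] := h0.
  rewrite big_nat qD; last 2 first.
  - by apply: sO_scale; apply: sO_one.
  - by apply: sO_sum => i /= im; apply: sO_mul; [exact: sc|apply: sO_semb; apply: sg].
  rewrite qZ ?q1; last exact: sO_one.
  rewrite (smorph_sum _ h0); last first.
    by move=> i /= im; apply: sO_mul; [exact: sc|apply: sO_semb; apply: sg].
  rewrite {1}/sadd {1}/sscale sumE big1 ?Rplus_0_r // => i /= im.
  rewrite qM; [|exact: sc|by apply: sO_semb; apply: sg].
  rewrite qD; [|exact: sO_coord|by apply: sO_scale; apply: sO_one].
  rewrite qZ ?q1; last exact: sO_one.
  have -> : sadd (phi0 (coord m n i)) (sscale (- a i) (sone n)) =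
            @semb n (fun y => l i y - a i).
    by rewrite H0 //; apply: sfunP => T y; rewrite /sadd /semb /sscale /sone; case: eqP => _; ring.
  by rewrite smul_semb /a Rminus_diag Rmult_0_l.
rewrite E // E // => i im; rewrite -H ?Hl //; exact: ltn_addr.
Qed.

Lemma sO_etaP m n (eta : 'I_(2 * n) -> sfun n) (S : {set 'I_(2 * n)}) :
  (forall i, sO m n (eta i)) -> sO m n (etaP eta S).
Proof.
move=> H; elim/set_min_ind: S => [|b S bS IH]; first by rewrite etaP0; apply: sO_one.
by rewrite etaPU //; apply: sO_mul.
Qed.

Lemma hom_etaP n (eta : 'I_(2 * n) -> sfun n) (S : {set 'I_(2 * n)}) :
  (forall i, hom true (eta i)) -> hom (odd #|S|) (etaP eta S).
Proof.
move=> H; elim/set_min_ind: S => [|b S bS IH].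
  by rewrite etaP0 cards0; apply: hom_one.
rewrite etaPU //; have -> : odd #|b |: S| = xorb true (odd #|S|).
  rewrite cardsU1; have -> : b \notin S by apply/negP => /bS; rewrite ltnn.
  by rewrite add1n /=; case: odd.
exact: hom_smul.
Qed.

Lemma lin_genE n Q (a : nat) S x :
  lin_gen n Q a S x = \big[Rplus/0]_(0 <= b < 2 * n) (Q a b * @gen n b S x).
Proof. by rewrite /lin_gen sumE. Qed.

Lemma hom_lin_gen n Q a : hom true (lin_gen n Q a).
Proof. by apply: hom_sum => b _; apply: hom_scale; apply: hom_gen. Qed.

Lemma sO_lin_gen m n Q a : sO m n (lin_gen n Q a).
Proof. by apply: sO_sum => b _; apply: sO_scale; apply: sO_gen. Qed.

Lemma lin_gen_anti n Q a b :
  smul (lin_gen n Q a) (lin_gen n Q b) = sscale (-1) (smul (lin_gen n Q b) (lin_gen n Q a)).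
Proof. exact: smulC (hom_lin_gen Q b) (hom_lin_gen Q a). Qed.

Lemma pullE m n P Q (F : sfun n) T x : pull m n P Q F T x =
  \big[Rplus/0]_S (F S (lin_pt m P x) * etaP (fun i : 'I_(2 * n) => lin_gen n Q i) S T x).
Proof. by rewrite /pull sumE; apply: eq_bigr => S _; rewrite smul_semb. Qed.

Lemma pull_ebase m n P Q (A : {set 'I_(2 * n)}) :
  pull m n P Q (ebase A) = etaP (fun i : 'I_(2 * n) => lin_gen n Q i) A.
Proof.
apply: sfunP => T x; rewrite pullE (bigD1 A) //= big1 ?Rplus_0_r.
  by rewrite /ebase eqxx Rmult_1_l.
by move=> S SA; rewrite /ebase (negbTE SA) Rmult_0_l.
Qed.

Lemma pull_gen m n P Q (i : 'I_(2 * n)) : pull m n P Q (@gen n i) = lin_gen n Q i.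
Proof.
rewrite gen_ebase pull_ebase.
have -> : [set i] = i |: set0 :> {set 'I_(2 * n)} by rewrite setU0.
by rewrite etaPU ?etaP0 ?smul1r // => j; rewrite inE.
Qed.

Lemma pull_semb m n P Q f : pull m n P Q (@semb n f) = @semb n (fun x => f (lin_pt m P x)).
Proof.
apply: sfunP => T x; rewrite pullE (bigD1 set0) //= big1 ?Rplus_0_r.
  by rewrite etaP0 /semb eqxx /sone; case: eqP => _; ring.
by move=> S S0; rewrite /semb (negbTE S0) Rmult_0_l.
Qed.

Lemma sO_pull m n P Q (F : sfun n) : sO m n F -> sO m n (pull m n P Q F).
Proof.
move=> sF; apply: sO_sum => S _; apply: sO_mul.
  by apply: sO_semb; apply: smooth_lin.
by apply: sO_etaP => i; apply: sO_lin_gen.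
Qed.

(** Both sides are sums over pairs of index sets. A disjoint pair corresponds to its union together
    with a subset of it, and an overlapping pair contributes 0 by [etaP_mul]. *)
Lemma pull_smul m n P Q (F G : sfun n) :
  pull m n P Q (smul F G) = smul (pull m n P Q F) (pull m n P Q G).
Proof.
set eta := fun i : 'I_(2 * n) => lin_gen n Q i.
apply: sfunP => T x; rewrite pullE.
transitivity (\big[Rplus/0]_A \big[Rplus/0]_B
  (F A (lin_pt m P x) * G B (lin_pt m P x) * smul (etaP eta A) (etaP eta B) T x)).
  rewrite /smul; under eq_bigr => S _ do rewrite big_distrl /=.
  rewrite (exchange_big_dep xpredT) //=; apply: eq_bigr => A _.
  rewrite [RHS](bigID (fun B : {set 'I_(2 * n)} => [disjoint A & B])) /= [X in _ = _ + X]big1; last first.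
    move=> B dAB; have := etaP_mul A B (fun a b => @lin_gen_anti n Q a b).
    rewrite (negbTE dAB) => /(f_equal (fun F : sfun n => F T x)).
    by rewrite {1}/smul -/eta => ->; rewrite /szero Rmult_0_r.
  rewrite Rplus_0_r (reindex_onto (fun B => A :|: B) (fun S => S :\: A)) /=; last first.
    by move=> S; rewrite inE => AS; rewrite setDE setUIr setUCr setIT; apply/setUidPr.
  apply: eq_big => [B|B].
    rewrite inE subsetUl /= setDUl setDv set0U; apply/eqP/idP => [<-|dAB].
      by rewrite -setI_eq0 setIDA setIC setDIl setDv setI0.
    by apply/setDidPl; rewrite disjoint_sym.
  rewrite inE subsetUl /= setDUl setDv set0U => /eqP E; rewrite E.
  have dAB : [disjoint A & B] by rewrite -E -setI_eq0 setIDA setIC setDIl setDv setI0.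
  have := etaP_mul A B (fun a b => @lin_gen_anti n Q a b).
  rewrite dAB => /(f_equal (fun F : sfun n => F T x)).
  by rewrite {1}/smul -/eta => ->; rewrite /sscale; ring.
rewrite {2}/smul; under [RHS]eq_bigr => C _ do rewrite !pullE.
rewrite exchange_big /=.
under [LHS]eq_bigr => B _ do under eq_bigr => A _ do rewrite /smul big_distrr /=.
under [LHS]eq_bigr => B _ do rewrite exchange_big /=.
rewrite exchange_big /=; apply: eq_bigr => C _.
rewrite Rmult_assoc big_distrlr big_distrr exchange_big /=.
apply: eq_bigr => A _; rewrite big_distrr /=; apply: eq_bigr => B _.
by rewrite -/eta; ring.
Qed.

Lemma smorph_pull m n P Q : smorph m n (pull m n P Q).
Proof.
split; first by move=> F; apply: sO_pull.
split.
  move=> F G _ _; apply: sfunP => T x; rewrite /sadd !pullE -big_split /=.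
  by apply: eq_bigr => S _; ring.
split.
  move=> c F _; apply: sfunP => T x; rewrite /sscale !pullE big_distrr /=.
  by apply: eq_bigr => S _; ring.
split; first by move=> F G _ _; apply: pull_smul.
split; first by rewrite -ebase0 pull_ebase etaP0.
move=> q F _ hF; apply: homI => T x oT; rewrite pullE big1 // => S _.
have [oS|oS] := eqVneq (odd #|S|) q; last by rewrite (hom_eq0 _ hF oS); ring.
rewrite (hom_eq0 x (hom_etaP (S := S) (fun i : 'I_(2 * n) => hom_lin_gen Q i))); first ring.
by rewrite oS.
Qed.

Lemma smorph_comp m n phi psi : smorph m n phi -> smorph m n psi ->
  smorph m n (fun F => phi (psi F)).
Proof.
move=> [a1 [a2 [a3 [a4 [a5 a6]]]]] [b1 [b2 [b3 [b4 [b5 b6]]]]].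
split; first by move=> F sF; apply/a1/b1.
split; first by move=> F G sF sG; rewrite b2 // a2 //; apply: b1.
split; first by move=> c F sF; rewrite b3 // a3 //; apply: b1.
split; first by move=> F G sF sG; rewrite b4 // a4 //; apply: b1.
split; first by rewrite b5.
by move=> q F sF hF; apply: a6; [apply: b1|apply: b6].
Qed.

Lemma smorph_id m n : smorph m n id.
Proof. by []. Qed.

(** * Coordinate derivations *)

Lemma pd_sum m i (I : Type) (r : seq I) (P : pred I) (F : I -> pt -> R) : (i < m)%N ->
  (forall j, P j -> smooth m (F j)) ->
  pd i (fun x => \big[Rplus/0]_(j <- r | P j) F j x) =
  fun x => \big[Rplus/0]_(j <- r | P j) pd i (F j) x.
Proof.
move=> im H; elim: r => [|j r IH].
  have -> : (fun x => \big[Rplus/0]_(j <- [::] | P j) F j x) = fun=> 0.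
    by apply: functional_extensionality => x; rewrite big_nil.
  by rewrite pd_const; apply: functional_extensionality => x; rewrite big_nil.
case Pj: (P j).
  have -> : (fun x => \big[Rplus/0]_(j <- j :: r | P j) F j x) =
      (fun x => F j x + \big[Rplus/0]_(j <- r | P j) F j x).
    by apply: functional_extensionality => x; rewrite big_cons Pj.
  rewrite pd_add ?IH; first by apply: functional_extensionality => x; rewrite big_cons Pj.
    exact: smooth_derivable im (H j Pj).
  by apply: (smooth_derivable im); apply: smooth_sum.
have -> : (fun x => \big[Rplus/0]_(j <- j :: r | P j) F j x) =
    (fun x => \big[Rplus/0]_(j <- r | P j) F j x).
  by apply: functional_extensionality => x; rewrite big_cons Pj.
by rewrite IH; apply: functional_extensionality => x; rewrite big_cons Pj.
Qed.

Lemma hder_deven m n i : (i < m)%N -> hder m n false (@deven n i).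
Proof.
move=> im; have dv (F : sfun n) S : sO m n F -> derivable_in i (F S).
  by move=> sF; apply: smooth_derivable im (sF S).
split; first by move=> F sF S; apply: smooth_pd.
split.
  by move=> F G sF sG; apply: functional_extensionality => S; apply: pd_add; apply: dv.
split; first by move=> c F sF; apply: functional_extensionality => S; apply: pd_scale; apply: dv.
split; first by move=> q F sF hF S oS; rewrite /deven hF ?pd_const //; case: q hF oS.
move=> q F G sF sG hF; apply: functional_extensionality => S.
rewrite /deven /sadd sscale1 /smul (pd_sum _ im); last first.
  by move=> A _; apply: smooth_mul => //; apply: smooth_scale.
apply: functional_extensionality => x; rewrite -big_split /=; apply: eq_bigr => A _.
have [|_ ->] := @pd_mul i (fun x => sgnAB A (S :\: A) * F A x) (G (S :\: A)) _ (dv _ _ sG).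
  by apply: smooth_derivable im _; apply: smooth_scale.
rewrite pd_scale; first by ring.
exact: dv.
Qed.

Lemma hder_dodd m n (i : 'I_(2 * n)) : hder m n true (@dodd n i).
Proof.
split.
  move=> F sF S.
  have -> : dodd i F S = if i \in S then fun=> 0 else fun x => sgnAB [set i] S * F (i |: S) x.
    by apply: functional_extensionality => x; rewrite doddE; case: ifP.
  by case: ifP => _; [apply: smooth_const|apply: smooth_scale].
split; first by move=> F G _ _; apply: sfunP => S x; rewrite /sadd !doddE; case: ifP => _; ring.
split; first by move=> c F _; apply: sfunP => S x; rewrite /sscale !doddE; case: ifP => _; ring.
split; first by move=> q F _ /(hom_dodd i); case: q.
by move=> q F G _ _ hF; rewrite (dodd_smul _ _ hF).
Qed.

Lemma dlow_odd m n (i : 'I_(2 * n)) : dlow m n (m + i) = dodd i.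
Proof. by rewrite /dlow ltnNge leq_addr /= addKn. Qed.

Lemma coord_odd m n (i : 'I_(2 * n)) : coord m n (m + i) = @gen n i.
Proof. by rewrite /coord ltnNge leq_addr /= addKn. Qed.

Lemma par_odd m i : par m (m + i) = true.
Proof. by rewrite /par leq_addr. Qed.

(** An odd index is presented as [m + i] with [i] an ordinal, the form in which [dodd] and [gen] can
    be evaluated by their ordinal lemmas. *)
Variant idx_spec m n : nat -> Prop :=
  | IdxEven i of (i < m)%N : idx_spec m n i
  | IdxOdd (i : 'I_(2 * n)) : idx_spec m n (m + i).

Lemma idxP m n k : (k < m + 2 * n)%N -> idx_spec m n k.
Proof.
move=> kN; have [km|mk] := ltnP k m; first exact: IdxEven.
have kn : (k - m < 2 * n)%N by rewrite ltn_subLR.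
by rewrite -(subnKC mk) -[(k - m)%N]/(nat_of_ord (Ordinal kn)); apply: IdxOdd.
Qed.

Lemma hder_dlow m n k : (k < m + 2 * n)%N -> hder m n (par m k) (dlow m n k).
Proof.
case/idxP => [i im|i].
  by rewrite /par leqNgt im /dlow im; apply: hder_deven.
by rewrite par_odd dlow_odd; apply: hder_dodd.
Qed.

Lemma dlow_coord m n k l : (k < m + 2 * n)%N -> (l < m + 2 * n)%N ->
  dlow m n k (coord m n l) = sscale (kdelta k l) (sone n).
Proof.
case/idxP => [i im|i]; case/idxP => [j jm|j].
- rewrite /dlow im /coord jm; apply: sfunP => S x; rewrite /deven /sscale /sone /semb.
  case: eqP => _; last by rewrite pd_const; ring.
  by have [_ ->] := pd_coord i j; ring.
- rewrite /dlow im coord_odd; apply: sfunP => S x.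
  rewrite /deven /gen pd_const /sscale /kdelta; case: eqP => [E|_]; last by ring.
  by move: im; rewrite E ltnNge leq_addr.
- rewrite dlow_odd /coord jm; apply: sfunP => S x.
  have -> : kdelta (m + i) j = 0.
    by rewrite /kdelta; case: eqP => // E; move: jm; rewrite -E ltnNge leq_addr.
  rewrite doddE /semb /sscale; case: ifP => _; first by ring.
  case: eqP => [/setP/(_ i)|_]; last by ring.
  by rewrite !inE eqxx.
- rewrite dlow_odd coord_odd gen_ebase; apply: sfunP => S x.
  rewrite doddE /ebase /sscale /kdelta /sone eqn_add2l (inj_eq val_inj).
  have [->|ij] := eqVneq i j.
    case: ifPn => jS.
      by case: eqP => [E|_]; [rewrite E inE in jS|ring].
    case: (S =P set0) => [->|S0]; first by rewrite setU0 eqxx sgnAB0r; ring.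
    case: eqP => [E|_]; last by ring.
    case: S0; apply/setP => z; have := jS; have /setP/(_ z) := E.
    by rewrite !inE; case: eqP => [->|_ //] _ /negbTE.
  case: ifPn => iS; first by ring.
  case: eqP => [/setP/(_ i)|_]; last by ring.
  by rewrite !inE eqxx (negbTE ij).
Qed.

Lemma deven_dodd m n i (j : 'I_(2 * n)) (F : sfun n) : (i < m)%N -> sO m n F ->
  deven i (dodd j F) = dodd j (deven i F).
Proof.
move=> im sF; apply: functional_extensionality => S; rewrite /deven.
have -> : dodd j F S = if j \in S then fun=> 0 else fun x => sgnAB [set j] S * F (j |: S) x.
  by apply: functional_extensionality => x; rewrite doddE; case: ifP.
apply: functional_extensionality => x; rewrite doddE; case: ifP => _; first by rewrite pd_const.
by rewrite pd_scale //; apply: smooth_derivable im _.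
Qed.

Lemma dlow_comm m n a b (F : sfun n) : (a < m + 2 * n)%N -> (b < m + 2 * n)%N -> sO m n F ->
  dlow m n a (dlow m n b F) = sscale (sgnb (par m a && par m b)) (dlow m n b (dlow m n a F)).
Proof.
case/idxP => [i im|i]; case/idxP => [j jm|j] sF.
- rewrite /par leqNgt im /= sscale1 /dlow im jm; apply: functional_extensionality => S.
  exact: pd_comm im jm (sF S).
- by rewrite /par leqNgt im /= sscale1 dlow_odd /dlow im (deven_dodd j im).
- by rewrite /par [(m <= j)%N]leqNgt jm andbF sscale1 dlow_odd /dlow jm (deven_dodd i jm).
- by rewrite !par_odd !dlow_odd dodd_anti.
Qed.

(** The odd derivative in a direction [i] of [S] carries the coefficient of [S], up to sign, to
    [S :\ i]; hence all coefficients of nonempty sets vanish, and the remaining one has zero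
    gradient. *)
Lemma dlow0_const m n (F : sfun n) : sO m n F ->
  (forall a, (a < m + 2 * n)%N -> dlow m n a F = szero n) ->
  F = sscale (delta0 F) (sone n).
Proof.
move=> sF H; apply: sfunP => S x; rewrite /sscale /sone /delta0.
case: eqP => [->|/eqP/set0Pn[i iS]].
  rewrite Rmult_1_r; apply: (constant_of_pd0 (sF set0)) => i im.
  have := H i (ltn_addr _ im); rewrite /dlow im => /(f_equal (fun F : sfun n => F set0)).
  by [].
have := H (m + i)%N; rewrite ltn_add2l => /(_ (ltn_ord i)).
rewrite dlow_odd => /(f_equal (fun F : sfun n => F (S :\ i) x)).
rewrite doddE setD11 setD1K // /szero => E.
have := sgnAB_sq [set i] (S :\ i); move: E; set s := sgnAB _ _.
by rewrite Rmult_0_r => E1 E2; nra.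
Qed.

(** The first derivatives are constants by [dlow0_const]. Subtracting the linear part that has these
    derivatives leaves a superfunction with zero first derivatives. *)
Lemma dlow_dlow0_affine m n (F : sfun n) : sO m n F ->
  (forall a b, (a < m + 2 * n)%N -> (b < m + 2 * n)%N -> dlow m n a (dlow m n b F) = szero n) ->
  F = sadd (sscale (delta0 F) (sone n))
    (\big[@sadd n/szero n]_(0 <= a < m + 2 * n) sscale (delta0 (dlow m n a F)) (coord m n a)).
Proof.
move=> sF H; set L := \big[_/_]_(_ <= _ < _) _.
have sL : sO m n L by apply: sO_sum => a _; apply: sO_scale; apply: sO_coord.
have L0 : delta0 L = 0.
  rewrite /delta0 /L sumE big_nat big1 // => a /= aN; rewrite /sscale.
  case: (idxP aN) => [i im|i]; first by rewrite /coord im /semb eqxx Rmult_0_r.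
  rewrite coord_odd gen_ebase /ebase; case: eqP => [/setP/(_ i)|_]; last by ring.
  by rewrite !inE eqxx.
pose G := sadd F (sscale (-1) L).
have sG : sO m n G by apply: sO_add => //; apply: sO_scale.
have := @dlow0_const m n G sG.
have -> : delta0 G = delta0 F.
  by rewrite {1}/delta0 /G /sadd /sscale -/(delta0 F) -/(delta0 L) L0; ring.
move=> E; apply: sfunP => S x; rewrite /sadd -E; first by rewrite /G /sadd /sscale; ring.
move=> a aN; have hd := hder_dlow aN.
rewrite /G (hder_add hd) //; last exact: sO_scale.
rewrite (hder_scale _ hd) // /L (hder_sum _ hd); last first.
  by move=> b _; apply: sO_scale; apply: sO_coord.
have -> : dlow m n a F = sscale (delta0 (dlow m n a F)) (sone n).
  apply: dlow0_const; first exact: hder_sO hd sF.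
  by move=> b bN; apply: H.
apply: sfunP => T y; rewrite /sadd {2}/sscale sumE big_nat.
rewrite (eq_bigr (fun b => kdelta a b * (delta0 (dlow m n b F) * sone n T y))); last first.
  move=> b /= bN; rewrite (hder_scale _ hd); last exact: sO_coord.
  by rewrite dlow_coord // /sscale; ring.
rewrite -big_nat (bigD1_seq a) ?mem_index_iota ?iota_uniq //= big1.
  by rewrite /kdelta eqxx /sscale /szero /delta0 /=; ring.
by move=> b ba; rewrite /kdelta eq_sym (negbTE ba); ring.
Qed.

(** * The metric in terms of the partner index *)

(* [prt m j] is the only index [k] with [gmet m j k <> 0], and [geps m j] that coefficient. *)
Definition prt (m j : nat) : nat :=
  if (j < m)%N then j else if odd (j - m) then j.-1 else j.+1.
Definition geps (m j : nat) : R :=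
  if (j < m)%N then 1 else if odd (j - m) then - / 2 else / 2.

Lemma geps_neq0 m j : geps m j <> 0.
Proof. by rewrite /geps; case: ifP => _; [lra|case: ifP => _; lra]. Qed.

Lemma prt_even m i : (i < m)%N -> prt m i = i.
Proof. by rewrite /prt => ->. Qed.

Lemma prt_odd m i : prt m (m + i) = (m + (if odd i then i.-1 else i.+1))%N.
Proof.
rewrite /prt ltnNge leq_addr /= addKn; case: ifP => oi; last by rewrite addnS.
by case: i oi => // i _; rewrite addnS.
Qed.

Lemma geps_odd m i : geps m (m + i) = if odd i then - / 2 else / 2.
Proof. by rewrite /geps ltnNge leq_addr /= addKn. Qed.

Lemma prtK m : involutive (prt m).
Proof.
move=> j; have [jm|mj] := ltnP j m; first by rewrite !prt_even.
rewrite -(subnKC mj); move: (j - m)%N => i; rewrite !prt_odd; congr (_ + _)%N.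
case oi: (odd i); last by rewrite /= oi.
by case: i oi => // i /= /negbTE ->.
Qed.

Lemma par_prt m j : par m (prt m j) = par m j.
Proof.
have [jm|mj] := ltnP j m; first by rewrite prt_even.
by rewrite -(subnKC mj) prt_odd !par_odd.
Qed.

Lemma prt_lt m n j : (j < m + 2 * n)%N -> (prt m j < m + 2 * n)%N.
Proof.
move=> jN; have [jm|mj] := ltnP j m; first by rewrite prt_even.
move: jN; rewrite -(subnKC mj); move: (j - m)%N => i; rewrite prt_odd !ltn_add2l.
case oi: (odd i) => iN; first by apply: leq_ltn_trans iN; apply: leq_pred.
rewrite ltn_neqAle iN andbT; apply/eqP => E; move/(f_equal odd): E.
by rewrite /= oi oddM.
Qed.

Lemma geps_prt m j : geps m (prt m j) = sgnb (par m j) * geps m j.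
Proof.
have [jm|mj] := ltnP j m.
  by rewrite prt_even // /par leqNgt jm /sgnb /=; ring.
rewrite -(subnKC mj); move: (j - m)%N => i; rewrite prt_odd par_odd !geps_odd /sgnb.
case oi: (odd i); last by rewrite /= oi /=; lra.
by case: i oi => // i /= /negbTE ->; lra.
Qed.

Lemma gmetE m j k : gmet m j k = geps m j * kdelta (prt m j) k.
Proof.
rewrite /gmet; have [jm|mj] := ltnP j m.
  rewrite /= prt_even // /geps jm /kdelta.
  have [km|mk] := ltnP k m; first by ring.
  by case: eqP => [E|_]; [move: jm; rewrite E ltnNge mk|ring].
rewrite /= -(subnKC mj); move: (j - m)%N => i; rewrite addKn prt_odd geps_odd /kdelta.
have [km|mk] := ltnP k m.
  by case: eqP => [E|_]; [move: km; rewrite -E ltnNge leq_addr|ring].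
rewrite /= -(subnKC mk); move: (k - m)%N => l; rewrite addKn eqn_add2l eq_sym.
case oi: (odd i) => /=; first by rewrite eq_sym; case: eqP => _; ring.
by rewrite eq_sym; case: eqP => _; ring.
Qed.

(** The upper derivation arises by raising the index with the inverse metric; the factors 2 and -2
    invert the coefficients 1/2 and -1/2. *)
Lemma dupE m n k : dup m n k = fun F => sscale (/ geps m k) (dlow m n (prt m k) F).
Proof.
rewrite /dup; have [km|mk] := ltnP k m.
  rewrite prt_even // /geps km /dlow km; apply: functional_extensionality => F.
  by rewrite Rinv_1 sscale1.
rewrite -(subnKC mk); move: (k - m)%N => i; rewrite addKn prt_odd geps_odd.
rewrite /dlow ltnNge leq_addr /= addKn.
case: ifP => oi; apply: functional_extensionality => F; congr (sscale _ _).
  by rewrite Rinv_opp Rinv_inv.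
by rewrite Rinv_inv.
Qed.

Lemma reindex_prt m n (f : nat -> R) :
  \big[Rplus/0]_(0 <= j < m + 2 * n) f (prt m j) = \big[Rplus/0]_(0 <= j < m + 2 * n) f j.
Proof.
rewrite -(big_map (prt m) xpredT f); apply: perm_big; apply: uniq_perm.
- by rewrite map_inj_uniq ?iota_uniq //; apply: inv_inj (prtK m).
- exact: iota_uniq.
move=> j; rewrite mem_index_iota /=; apply/mapP/idP => [[i]|jN].
  by rewrite mem_index_iota /= => iN ->; apply: prt_lt.
by exists (prt m j); rewrite ?prtK // mem_index_iota prt_lt.
Qed.

Lemma sum_kdelta (N a : nat) (f : nat -> R) : (a < N)%N ->
  \big[Rplus/0]_(0 <= j < N) (kdelta a j * f j) = f a.
Proof.
move=> aN; rewrite (bigD1_seq a) ?mem_index_iota ?iota_uniq //= big1.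
  by rewrite /kdelta eqxx; ring.
by move=> b ba; rewrite /kdelta eq_sym (negbTE ba); ring.
Qed.

Lemma kdeltaC i j : kdelta i j = kdelta j i.
Proof. by rewrite /kdelta eq_sym. Qed.

Definition sig n (b : bool) (F : sfun n) : sfun n := if b then sinv F else F.

Lemma sigD n b (F G : sfun n) : sig b (sadd F G) = sadd (sig b F) (sig b G).
Proof.
case: b => //; apply: sfunP => S x; rewrite /sig /sinv /sadd; case: odd; ring.
Qed.

Lemma sigZ n b c (F : sfun n) : sig b (sscale c F) = sscale c (sig b F).
Proof.
case: b => //; apply: sfunP => S x; rewrite /sig /sinv /sscale; case: odd; ring.
Qed.

Lemma sig_hom n b q (F : sfun n) : hom q F -> sig b F = sscale (sgnb (b && q)) F.
Proof. by rewrite /sig; case: b => [/sinv_hom->//|_]; rewrite sscale1. Qed.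

Lemma sO_sig m n b (F : sfun n) : sO m n F -> sO m n (sig b F).
Proof. by case: b => // /sO_sinv. Qed.

Lemma sig_inv0 n b (F : sfun n) : sig b F = szero n -> F = szero n.
Proof.
case: b => // E; apply: sfunP => S x.
have := f_equal (fun F : sfun n => F S x) E; rewrite /sig /sinv /szero.
by case: odd; lra.
Qed.

(** The form of the metric on arbitrary families in place of the components of two fields; second
    derivatives will be inserted as well. [sig] is the sign (-1)^{|h|[j]} of the metric, extended
    linearly to inhomogeneous [h]. *)
Definition Bf (m n : nat) (N M : nat -> sfun n) : sfun n :=
  \big[@sadd n/szero n]_(0 <= j < m + 2 * n)
    sscale (geps m j) (smul (N j) (sig (par m j) (M (prt m j)))).
Arguments Bf : clear implicits.

Lemma BfE m n N M S x : Bf m n N M S x = \big[Rplus/0]_(0 <= j < m + 2 * n)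
  (geps m j * smul (N j) (sig (par m j) (M (prt m j))) S x).
Proof. by rewrite /Bf sumE. Qed.

Lemma metricE m n (Y Z : sfun n -> sfun n) :
  metric m n Y Z = Bf m n (fun j => Y (coord m n j)) (fun j => Z (coord m n j)).
Proof.
apply: sfunP => S x; rewrite BfE /metric sumE; apply: eq_big_nat => j /= jN.
rewrite sumE.
rewrite (eq_bigr (fun k => kdelta (prt m j) k * (geps m j *
  smul (Y (coord m n j)) (sig (par m j) (Z (coord m n k))) S x))).
  by rewrite sum_kdelta //; apply: prt_lt.
by move=> k _; rewrite /sscale gmetE /sig; ring.
Qed.

Lemma Bf_ext m n (N N' M M' : nat -> sfun n) :
  (forall j, (j < m + 2 * n)%N -> N j = N' j) ->
  (forall j, (j < m + 2 * n)%N -> M j = M' j) -> Bf m n N M = Bf m n N' M'.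
Proof.
move=> EN EM; apply: sfunP => S x; rewrite !BfE; apply: eq_big_nat => j /= jN.
by rewrite EN // EM //; apply: prt_lt.
Qed.

Lemma BfDl m n (N N' M : nat -> sfun n) :
  Bf m n (fun j => sadd (N j) (N' j)) M = sadd (Bf m n N M) (Bf m n N' M).
Proof.
apply: sfunP => S x; rewrite {2}/sadd !BfE -big_split /=; apply: eq_bigr => j _.
by rewrite smulDl /sadd; ring.
Qed.

Lemma BfDr m n (N M M' : nat -> sfun n) :
  Bf m n N (fun j => sadd (M j) (M' j)) = sadd (Bf m n N M) (Bf m n N M').
Proof.
apply: sfunP => S x; rewrite {2}/sadd !BfE -big_split /=; apply: eq_bigr => j _.
by rewrite sigD smulDr /sadd; ring.
Qed.

Lemma BfZl m n c (N M : nat -> sfun n) :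
  Bf m n (fun j => sscale c (N j)) M = sscale c (Bf m n N M).
Proof.
apply: sfunP => S x; rewrite {2}/sscale !BfE big_distrr /=; apply: eq_bigr => j _.
by rewrite smulZl /sscale; ring.
Qed.

Lemma BfZr m n c (N M : nat -> sfun n) :
  Bf m n N (fun j => sscale c (M j)) = sscale c (Bf m n N M).
Proof.
apply: sfunP => S x; rewrite {2}/sscale !BfE big_distrr /=; apply: eq_bigr => j _.
by rewrite sigZ smulZr /sscale; ring.
Qed.

Lemma Bf0l m n (M : nat -> sfun n) : Bf m n (fun=> szero n) M = szero n.
Proof.
by apply: sfunP => S x; rewrite BfE big1 // => j _; rewrite smul0l /szero; ring.
Qed.

Lemma Bf_suml m n (r : seq nat) (N : nat -> nat -> sfun n) (M : nat -> sfun n) :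
  Bf m n (fun j => \big[@sadd n/szero n]_(a <- r) N a j) M =
  \big[@sadd n/szero n]_(a <- r) Bf m n (N a) M.
Proof.
elim: r => [|a r IH].
  rewrite big_nil -[RHS](Bf0l m M); apply: Bf_ext => // j _; by rewrite big_nil.
rewrite big_cons -IH -BfDl; apply: Bf_ext => // j _; by rewrite big_cons.
Qed.

Lemma Bf_mull m n w (N M : nat -> sfun n) :
  smul w (Bf m n N M) = Bf m n (fun j => smul w (N j)) M.
Proof.
rewrite /Bf smul_sumr; apply: eq_bigr => j _; by rewrite smulZr smulA.
Qed.

Lemma Bf_deltal m n b (M : nat -> sfun n) : (b < m + 2 * n)%N ->
  Bf m n (fun j => sscale (kdelta b j) (sone n)) M =
  sscale (geps m b) (sig (par m b) (M (prt m b))).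
Proof.
move=> bN; apply: sfunP => S x; rewrite BfE /sscale.
rewrite -(sum_kdelta (fun j => geps m j * sig (par m j) (M (prt m j)) S x) bN).
by apply: eq_bigr => j _; rewrite -/(sscale _ _) smulZl smul1l /sscale; ring.
Qed.

(** The parities that the components of a vector field of parity [u] have. *)
Definition homv (m n : nat) (u : bool) (N : nat -> sfun n) : Prop :=
  forall j, (j < m + 2 * n)%N -> hom (xorb u (par m j)) (N j).
Arguments homv : clear implicits.

(** The sum is reindexed by the partner involution. The sign in [geps_prt] cancels those of
    exchanging components, apart from the one of the total parities. *)
Lemma Bf_sym m n u v (N M : nat -> sfun n) : homv m n u N -> homv m n v M ->
  Bf m n N M = sscale (sgnb (u && v)) (Bf m n M N).
Proof.
move=> hN hM; apply: sfunP => S x; rewrite /sscale !BfE big_distrr /= -reindex_prt.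
apply: eq_big_nat => j /= jN; rewrite prtK geps_prt par_prt.
have hj := hN _ (prt_lt jN); rewrite par_prt in hj.
rewrite (sig_hom _ (hM j jN)) (sig_hom _ hj) !smulZr.
rewrite (smulC (hM j jN) hj) /sscale.
by case: u {hN} hj; case: v {hM}; case: (par m j) => _; rewrite /sgnb /=; ring.
Qed.

Lemma sO_Bf m n (N M : nat -> sfun n) :
  (forall j, (j < m + 2 * n)%N -> sO m n (N j)) ->
  (forall j, (j < m + 2 * n)%N -> sO m n (M j)) -> sO m n (Bf m n N M).
Proof.
move=> sN sM; rewrite /Bf big_nat; apply: sO_sum => j /= jN; apply: sO_scale.
by apply: sO_mul; [apply: sN|apply: sO_sig; apply: sM; apply: prt_lt].
Qed.

(** Passing [D] over [N j] costs the parity [p (u + [j])], and commuting [D] with [sig] costs [p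
    [j]]. The dependence on [j] cancels and the common sign of [p u] remains. *)
Lemma Bf_leibniz m n p D u v (N M : nat -> sfun n) : hder m n p D ->
  (forall j, (j < m + 2 * n)%N -> sO m n (N j)) ->
  (forall j, (j < m + 2 * n)%N -> sO m n (M j)) ->
  homv m n u N -> homv m n v M ->
  D (Bf m n N M) = sadd (Bf m n (fun j => D (N j)) M)
    (sscale (sgnb (p && u)) (Bf m n N (fun j => D (M j)))).
Proof.
move=> hD sN sM hN hM; rewrite /Bf big_nat (hder_sum _ hD); last first.
  move=> j /= jN; apply: sO_scale; apply: sO_mul; first exact: sN.
  by apply: sO_sig; apply: sM; apply: prt_lt.
rewrite -big_nat; apply: sfunP => S x; rewrite /sadd /sscale !sumE big_distrr -big_split /=.
apply: eq_big_nat => j /= jN.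
have sMj := sM _ (prt_lt jN); have hMj := hM _ (prt_lt jN); rewrite par_prt in hMj.
have sg := sO_sig (par m j) sMj.
rewrite -/(sscale _ _) (hder_scale _ hD); last by apply: sO_mul => //; apply: sN.
rewrite (hder_mul hD (sN j jN) sg (hN j jN)) (sig_hom _ hMj) (hder_scale _ hD) //.
rewrite (sig_hom _ (hder_hom hD sMj hMj)) !smulZr /sscale /sadd.
case: p {hD}; case: u {hN}; case: v {hM hMj}; case: (par m j) {sg}; rewrite /sgnb /=; ring.
Qed.

(** Six swaps, alternately of the first two and of the last two indices, run once around the
    orderings of [a], [b], [c]. Each pair is exchanged twice, so its sign cancels, and the three
    antisymmetries give [T = - T]. *)
Lemma ricci (N : nat) (par : nat -> bool) (T : nat -> nat -> nat -> R) :
  (forall a b c, (a < N)%N -> (b < N)%N -> (c < N)%N ->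
     T a b c = sgnb (par a && par b) * T b a c) ->
  (forall a b c, (a < N)%N -> (b < N)%N -> (c < N)%N ->
     T a b c = - sgnb (par b && par c) * T a c b) ->
  forall a b c, (a < N)%N -> (b < N)%N -> (c < N)%N -> T a b c = 0.
Proof.
move=> H1 H2 a b c aN bN cN.
have := H1 a b c aN bN cN; have := H2 b a c bN aN cN; have := H1 b c a bN cN aN.
have := H2 c b a cN bN aN; have := H1 c a b cN aN bN; have := H2 a c b aN cN bN.
by case: (par a); case: (par b); case: (par c); rewrite /sgnb /=; lra.
Qed.

(** * Derivations in coordinates *)

Lemma hder_comb m n p (w : nat -> sfun n) :
  (forall a, (a < m + 2 * n)%N -> sO m n (w a)) -> homv m n p w ->
  hder m n p (fun G => \big[@sadd n/szero n]_(0 <= a < m + 2 * n) smul (w a) (dlow m n a G)).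
Proof.
move=> sw hw.
split.
  move=> F sF; rewrite big_nat; apply: sO_sum => a /= aN; apply: sO_mul; first exact: sw.
  exact: hder_sO (hder_dlow aN) sF.
split.
  move=> F G sF sG; apply: sfunP => S x; rewrite /sadd !sumE -big_split /=.
  apply: eq_big_nat => a /= aN.
  by rewrite -/(sadd F G) (hder_add (hder_dlow aN)) // smulDr.
split.
  move=> c F sF; apply: sfunP => S x; rewrite /sscale !sumE big_distrr /=.
  apply: eq_big_nat => a /= aN.
  by rewrite -/(sscale c F) (hder_scale _ (hder_dlow aN)) // smulZr.
split.
  move=> q F sF hF; rewrite big_nat; apply: hom_sum => a /= aN.
  have := hom_smul (hw a aN) (hder_hom (hder_dlow aN) sF hF).
  by case: p {hw}; case: q {hF}; case: (par m a).
move=> q F G sF sG hF; rewrite smul_suml smul_sumr.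
apply: sfunP => S x; rewrite /sadd /sscale !sumE big_distrr -big_split /=.
apply: eq_big_nat => a /= aN.
rewrite (hder_mul (hder_dlow aN) sF sG hF) smulDr smulZr !smulA.
rewrite (smulC hF (hw a aN)) smulZl /sadd /sscale.
by case: p {hw}; case: q {hF}; case: (par m a); rewrite /sgnb /=; ring.
Qed.

(** The right side is a derivation by [hder_comb] and has the same values on coordinates. *)
Lemma hder_expand m n p D G : hder m n p D -> sO m n G ->
  D G = \big[@sadd n/szero n]_(0 <= a < m + 2 * n) smul (D (coord m n a)) (dlow m n a G).
Proof.
move=> hD; have hw : homv m n p (fun a => D (coord m n a)).
  by move=> a aN; apply: hder_hom hD _ _; [apply: sO_coord|apply: hom_coord].
have sw a : (a < m + 2 * n)%N -> sO m n (D (coord m n a)).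
  by move=> aN; apply: hder_sO hD _; apply: sO_coord.
apply: (hder_uniq hD (hder_comb sw hw)) => k kN.
apply: sfunP => S x; rewrite sumE -(sum_kdelta (fun a => D (coord m n a) S x) kN).
apply: eq_big_nat => a /= aN; rewrite dlow_coord // smulZr smul1r /sscale.
by rewrite kdeltaC; ring.
Qed.

Lemma hder0 m n p : hder m n p (fun=> szero n).
Proof.
split; first by move=> *; apply: sO_zero.
split; first by move=> *; apply: sfunP => S x; rewrite /sadd /szero; ring.
split; first by move=> *; apply: sfunP => S x; rewrite /sscale /szero; ring.
split; first by move=> *; apply: hom_zero.
by move=> *; rewrite smul0l smul0r; apply: sfunP => S x; rewrite /sadd /sscale /szero; ring.
Qed.

Lemma vfield_hder m n p Y : hder m n p Y -> vfield m n Y.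
Proof.
case: p => hY; [exists (fun=> szero n), Y|exists Y, (fun=> szero n)].
all: split=> //; try exact: hder0.
all: split=> //; try exact: hder0.
all: by move=> F _; apply: sfunP => S x; rewrite /sadd /szero; ring.
Qed.

Lemma vfield_sO m n Y F : vfield m n Y -> sO m n F -> sO m n (Y F).
Proof.
move=> [Y0 [Y1 [h0 [h1 E]]]] sF; rewrite E //.
by apply: sO_add; [apply: hder_sO h0 sF|apply: hder_sO h1 sF].
Qed.

Lemma vfield_add m n Y F G : vfield m n Y -> sO m n F -> sO m n G ->
  Y (sadd F G) = sadd (Y F) (Y G).
Proof.
move=> [Y0 [Y1 [h0 [h1 E]]]] sF sG; rewrite !E //; last exact: sO_add.
rewrite (hder_add h0) // (hder_add h1) //; apply: sfunP => S x; rewrite /sadd; ring.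
Qed.

Lemma vfield_scale m n Y c F : vfield m n Y -> sO m n F -> Y (sscale c F) = sscale c (Y F).
Proof.
move=> [Y0 [Y1 [h0 [h1 E]]]] sF; rewrite !E //; last exact: sO_scale.
by rewrite (hder_scale _ h0) // (hder_scale _ h1) //; apply: sfunP => S x; rewrite /sadd /sscale; ring.
Qed.

Lemma vfield_sum m n Y (r : seq nat) (F : nat -> sfun n) :
  vfield m n Y -> (forall i, sO m n (F i)) ->
  Y (\big[@sadd n/szero n]_(i <- r) F i) = \big[@sadd n/szero n]_(i <- r) Y (F i).
Proof.
move=> hY sF; elim: r => [|i r IH].
  rewrite !big_nil -(sscale0 (szero n)) (vfield_scale _ hY) ?sscale0 //; exact: sO_zero.
by rewrite !big_cons (vfield_add hY) ?IH //; apply: sO_sum.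
Qed.

(** * Killing fields *)

Lemma sadd0l n (F : sfun n) : sadd (szero n) F = F.
Proof. by apply: sfunP => S x; rewrite /sadd /szero; ring. Qed.

Lemma sgnb_neq0 b : sgnb b <> 0.
Proof. by case: b; rewrite /sgnb; lra. Qed.

Lemma homv_coord m n q Y : hder m n q Y -> homv m n q (fun j => Y (coord m n j)).
Proof.
by move=> hY j jN; apply: hder_hom hY _ _; [apply: sO_coord|apply: hom_coord].
Qed.

Lemma sO_hder_coord m n q Y j : hder m n q Y -> sO m n (Y (coord m n j)).
Proof. by move=> hY; apply: hder_sO hY _; apply: sO_coord. Qed.

(** Applying [F] to the form by [Bf_leibniz] produces [F (Y X_j)] and [F (Z X_j)], which cancel
    against the same terms of the brackets. Only the compositions with [F] applied first survive. *)
Lemma killingP m n p F : hder m n p F ->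
  killing m n p F <-> forall q r Y Z, hder m n q Y -> hder m n r Z ->
    sadd (Bf m n (fun j => Y (F (coord m n j))) (fun j => Z (coord m n j)))
      (sscale (sgnb (p && r)) (Bf m n (fun j => Y (coord m n j)) (fun j => Z (F (coord m n j)))))
    = szero n.
Proof.
move=> hF.
have H q r Y Z : hder m n q Y -> hder m n r Z ->
  F (metric m n Y Z) = sadd (metric m n (sbr p q F Y) Z)
         (sscale (sgnb (p && q)) (metric m n Y (sbr p r F Z))) <->
    sadd (Bf m n (fun j => Y (F (coord m n j))) (fun j => Z (coord m n j)))
      (sscale (sgnb (p && r)) (Bf m n (fun j => Y (coord m n j)) (fun j => Z (F (coord m n j)))))
    = szero n; last first.
  by split=> K q r Y Z hY hZ; apply/(H q r Y Z hY hZ); exact: (K q r Y Z hY hZ).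
move=> hY hZ; rewrite !metricE.
rewrite (Bf_leibniz hF (fun j _ => sO_hder_coord j hY) (fun j _ => sO_hder_coord j hZ)
  (homv_coord hY) (homv_coord hZ)).
rewrite /sbr BfDl BfDr BfZl BfZr; split=> E; apply: sfunP => S x.
all: have := f_equal (fun F : sfun n => F S x) E; rewrite /sadd /sscale /szero.
all: have := @sgnb_neq0 (p && q); have := sgnb_sq (p && q).
all: set e := sgnb (p && q); set A := Bf _ _ _ _ S x; set B := Bf _ _ _ _ S x.
all: set C := Bf _ _ _ _ S x; set D := Bf _ _ _ _ S x => e2 e0 EE.
  have {}EE : e * (C + sgnb (p && r) * D) = 0 by lra.
  by case: (Rmult_integral _ _ EE).
have -> : A = - (sgnb (p && r) * B) by lra.
ring.
Qed.

Lemma homv_dlow_hder m n p F a : hder m n p F -> (a < m + 2 * n)%N ->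
  homv m n (xorb (par m a) p) (fun j => dlow m n a (F (coord m n j))).
Proof.
move=> hF aN j jN; have := hder_hom (hder_dlow aN) (sO_hder_coord j hF) (homv_coord hF jN).
by case: (par m a); case: p {hF}; case: (par m j).
Qed.

(** For coordinate fields the components are Kronecker deltas, so each form reduces to one lowered
    component of [F]. Even [F] brings an additional sign of parity [[a] + [b]]. *)
Lemma killing_dlow m n p F a b : hder m n p F -> killing m n p F ->
  (a < m + 2 * n)%N -> (b < m + 2 * n)%N ->
  sscale (geps m b) (dlow m n a (F (coord m n (prt m b)))) =
  sscale (- sgnb (xorb (par m a && par m b) (~~ p && xorb (par m a) (par m b))))
    (sscale (geps m a) (dlow m n b (F (coord m n (prt m a))))).
Proof.
move=> hF /(killingP hF) /(_ _ _ _ _ (hder_dlow _) (hder_dlow _)) K aN bN.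
have := K a b aN bN.
have hb := homv_coord (hder_dlow bN); have ha := homv_coord (hder_dlow aN).
have hFa := homv_dlow_hder hF aN; have hFb := homv_dlow_hder hF bN.
(* The constant family is brought to the left slot, where [Bf_deltal] evaluates the form. *)
rewrite (Bf_sym hFa hb).
have Ed c M : (c < m + 2 * n)%N -> Bf m n (fun j => dlow m n c (coord m n j)) M =
    sscale (geps m c) (sig (par m c) (M (prt m c))).
  by move=> cN; rewrite -Bf_deltal //; apply: Bf_ext => // j jN; apply: dlow_coord.
rewrite !Ed // => E; apply: sfunP => S x.
have := f_equal (fun F : sfun n => F S x) E.
have h1 := hFa _ (prt_lt bN); have h2 := hFb _ (prt_lt aN); rewrite !par_prt in h1 h2.
rewrite (sig_hom _ h1) (sig_hom _ h2) /sadd /sscale /szero.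
set A := dlow m n a _ S x; set B := dlow m n b _ S x.
by clear; case: (par m a); case: (par m b); case: p; rewrite /sgnb /=; lra.
Qed.

Lemma sscale_inj n c (F G : sfun n) : c <> 0 -> sscale c F = sscale c G -> F = G.
Proof.
move=> c0 E; apply: sfunP => S x; have := f_equal (fun F : sfun n => F S x) E.
by rewrite /sscale => /Rmult_eq_reg_l; apply.
Qed.

Lemma killing_dlow_dlow m n p F a b l : hder m n p F -> killing m n p F ->
  (a < m + 2 * n)%N -> (b < m + 2 * n)%N -> (l < m + 2 * n)%N ->
  dlow m n a (dlow m n b (F (coord m n l))) = szero n.
Proof.
move=> hF kF aN bN lN.
suff E : sscale (geps m (prt m l)) (dlow m n a (dlow m n b (F (coord m n l)))) = szero n.
  by apply: (sscale_inj (geps_neq0 (m := m) (j := prt m l))); rewrite E; apply: sfunP => S x; rewrite /sscale /szero; ring.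
apply: sfunP => S x; rewrite /sscale /szero.
(* The additional sign of [killing_dlow] for even [F] is a product of one factor per index. This
   weight absorbs it, and plain graded antisymmetry in the last two indices remains. *)
pose T a b c := sgnb (~~ p && par m c) *
  (geps m c * dlow m n a (dlow m n b (F (coord m n (prt m c)))) S x).
suff : T a b (prt m l) = 0 by rewrite /T prtK => /Rmult_integral[/sgnb_neq0|].
apply: (@ricci (m + 2 * n) (par m) T) => //; last exact: prt_lt.
- move=> a' b' c aN' bN' cN; rewrite /T.
  rewrite (dlow_comm aN' bN' (sO_hder_coord _ hF)) /sscale; ring.
- move=> a' b' c aN' bN' cN; rewrite /T.
  have := f_equal (fun G => dlow m n a' G S x) (killing_dlow hF kF bN' cN).
  have sF d l' : (d < m + 2 * n)%N -> sO m n (dlow m n d (F (coord m n l'))).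
    by move=> dN; apply: hder_sO (hder_dlow dN) _; apply: sO_hder_coord hF.
  rewrite /= sscale_sscale !(hder_scale _ (hder_dlow aN')); try exact: sF.
  rewrite /sscale => ->.
  by clear; case: (par m b'); case: (par m c); case: p; rewrite /sgnb /=; ring.
Qed.

Lemma delta0_coord m n k : (k < m + 2 * n)%N -> delta0 (coord m n k) = 0.
Proof.
case/idxP => [i im|i]; rewrite /delta0; first by rewrite /coord im /semb eqxx.
rewrite coord_odd gen_ebase /ebase; case: eqP => [/setP/(_ i)|//].
by rewrite !inE eqxx.
Qed.

Lemma delta0_smul n (F G : sfun n) : delta0 (smul F G) = delta0 F * delta0 G.
Proof.
rewrite /delta0 /smul (big_pred1 set0).
  by rewrite setD0 sgnAB0l; ring.
by move=> A /=; rewrite inE subset0.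
Qed.

Lemma delta0_hom n q (F : sfun n) : hom q F -> q -> delta0 F = 0.
Proof. by move=> hF Hq; rewrite /delta0 (hom_eq0 _ hF) // cards0 Hq. Qed.

Lemma LopE m n i j G S x : Lop m n i j G S x =
  smul (coord m n i) (dup m n j G) S x -
  sgnb (par m i && par m j) * smul (coord m n j) (dup m n i G) S x.
Proof. by rewrite /Lop /sadd /sscale; ring. Qed.

Lemma killing_Lop_sum m n p F : hder m n p F -> killing m n p F ->
  (forall G, sO m n G -> delta0 (F G) = 0) ->
  exists d : nat -> nat -> R, forall G, sO m n G ->
    F G = \big[@sadd n/szero n]_(0 <= a < m + 2 * n)
          \big[@sadd n/szero n]_(0 <= j < m + 2 * n) sscale (d a j) (Lop m n a j G).
Proof.
move=> hF kF F0.
pose c l a := delta0 (dlow m n a (F (coord m n l))).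
have lin l : (l < m + 2 * n)%N -> F (coord m n l) =
    \big[@sadd n/szero n]_(0 <= a < m + 2 * n) sscale (c l a) (coord m n a).
  move=> lN; rewrite {1}(dlow_dlow0_affine (sO_hder_coord l hF)).
    by rewrite F0 ?sscale0 ?sadd0l //; apply: sO_coord.
  by move=> a b aN bN; apply: (killing_dlow_dlow hF kF).
(* Lowering the index of the component turns the Killing relation into graded antisymmetry of the
   coefficient matrix. *)
pose d a j := geps m j * c (prt m j) a.
have dsym a b : (a < m + 2 * n)%N -> (b < m + 2 * n)%N ->
    d b a = - sgnb (par m a && par m b) * d a b.
  move=> aN bN.
  have := f_equal (@delta0 n) (killing_dlow hF kF bN aN).
  have d0 c' G : delta0 (@sscale n c' G) = c' * delta0 G by [].
  rewrite !d0 -/(c _ _) -/(c _ _) -/(d _ _) -/(d _ _) => ->.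
  (* A constant is even, so a coefficient of the wrong parity is 0. For even [F] only [[a] = [b]]
     survives, and there the additional sign of [killing_dlow] is 1. *)
  have c0 a' b' : (a' < m + 2 * n)%N -> (b' < m + 2 * n)%N ->
      xorb (xorb (par m a') p) (par m b') -> d a' b' = 0.
    move=> aN' bN' Hq; have := homv_dlow_hder hF aN' (prt_lt bN').
    by rewrite par_prt => /delta0_hom/(_ Hq); rewrite /d /c => ->; ring.
  move: (c0 a b aN bN); clear.
  case: (par m a); case: (par m b); case: p; rewrite /sgnb /= => d0';
    try (by ring); by rewrite d0' //; ring.
(* Over all ordered pairs each [L_aj] occurs twice, both [d] and [L] being graded antisymmetric;
   hence the factor 1/2. *)
exists (fun a j => / 2 * d a j) => G sG.
apply: sfunP => S x; rewrite (hder_expand hF sG) !sumE -reindex_prt.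
pose f a j := smul (coord m n a) (dup m n j G) S x.
(* In terms of upper derivations [F] is the sum of [d a j X_a d_{X^j}]. Averaging this sum with its
   copy under exchange of [a] and [j] produces the operators [L]. *)
transitivity (\big[Rplus/0]_(0 <= j < m + 2 * n) \big[Rplus/0]_(0 <= a < m + 2 * n) (d a j * f a j)).
  apply: eq_big_nat => j /= jN; rewrite lin ?smul_suml ?sumE; last exact: prt_lt.
  apply: eq_big_nat => a /= aN; rewrite smulZl /f dupE smulZr /sscale /d.
  field; exact: geps_neq0.
set X := LHS.
have E1 : X = \big[Rplus/0]_(0 <= a < m + 2 * n) \big[Rplus/0]_(0 <= j < m + 2 * n) (d a j * f a j).
  by rewrite /X exchange_big.
have E2 : X = \big[Rplus/0]_(0 <= a < m + 2 * n) \big[Rplus/0]_(0 <= j < m + 2 * n)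
    (- sgnb (par m a && par m j) * d a j * f j a).
  rewrite /X; apply: eq_big_nat => a /= aN; apply: eq_big_nat => j /= jN.
  by rewrite (dsym a j aN jN).
have -> : X = / 2 * X + / 2 * X by field.
rewrite {1}E1 E2 !big_distrr -big_split /=; apply: eq_big_nat => a _.
rewrite sumE !big_distrr -big_split /=; apply: eq_big_nat => j _.
by rewrite /sscale LopE /f; ring.
Qed.

Lemma hder_ext m n p D D' : hder m n p D -> (forall F, sO m n F -> D' F = D F) ->
  hder m n p D'.
Proof.
move=> hD E.
split; first by move=> F sF; rewrite E //; apply: hder_sO hD sF.
split; first by move=> F G sF sG; rewrite !E //; [apply: hder_add hD sF sG|apply: sO_add].
split; first by move=> c F sF; rewrite !E //; [apply: hder_scale hD sF|apply: sO_scale].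
split; first by move=> q F sF hF; rewrite E //; apply: hder_hom hD sF hF.
by move=> q F G sF sG hF; rewrite !E //; [apply: hder_mul hD sF sG hF|apply: sO_mul].
Qed.

(* The coefficients of [dup m n j] on the [dlow m n l]. *)
Definition hinv (m j l : nat) : R := / geps m j * kdelta (prt m j) l.

(** Written with coefficients in front of coordinate derivations, [L_ij] is a derivation by
    [hder_comb]. *)
Lemma Lop_expand m n i j G : (i < m + 2 * n)%N -> (j < m + 2 * n)%N ->
  Lop m n i j G = \big[@sadd n/szero n]_(0 <= a < m + 2 * n)
    smul (sadd (sscale (hinv m j a) (coord m n i))
      (sscale (- sgnb (par m i && par m j) * hinv m i a) (coord m n j))) (dlow m n a G).
Proof.
move=> iN jN; apply: sfunP => S x; rewrite LopE !dupE !smulZr sumE /sscale.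
set s := sgnb _.
rewrite -(sum_kdelta (fun a => smul (coord m n i) (dlow m n a G) S x) (prt_lt jN)).
rewrite -(sum_kdelta (fun a => smul (coord m n j) (dlow m n a G) S x) (prt_lt iN)).
rewrite /Rminus -Ropp_mult_distr_l_reverse !big_distrr -big_split /=.
apply: eq_bigr => a _; rewrite smulDl -/(sscale _ _) -/(sscale _ _) !smulZl.
by rewrite /sadd /sscale /hinv; ring.
Qed.

Lemma hom_hinv m n j a q c (F : sfun n) : (a = prt m j -> hom q F) ->
  hom q (sscale (c * hinv m j a) F).
Proof.
rewrite /hinv /kdelta; case: eqP => [->/(_ erefl)|_ _]; first exact: hom_scale.
by rewrite !Rmult_0_r sscale0; apply: hom_zero.
Qed.

Lemma hder_Lop m n i j : (i < m + 2 * n)%N -> (j < m + 2 * n)%N ->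
  hder m n (xorb (par m i) (par m j)) (Lop m n i j).
Proof.
move=> iN jN; apply: (hder_ext (hder_comb (w := fun a => sadd (sscale (hinv m j a) (coord m n i))
      (sscale (- sgnb (par m i && par m j) * hinv m i a) (coord m n j))) _ _)).
- by move=> a _; apply: sO_add; apply: sO_scale; apply: sO_coord.
- move=> a _; apply: hom_add.
    rewrite -[hinv m j a]Rmult_1_l; apply: hom_hinv => ->; rewrite par_prt.
    by have := @hom_coord m n i; case: (par m i); case: (par m j).
  apply: hom_hinv => ->; rewrite par_prt.
  by have := @hom_coord m n j; case: (par m i); case: (par m j).
- by move=> F _; apply: Lop_expand.
Qed.

Lemma Lop_coord m n i j l : (i < m + 2 * n)%N -> (j < m + 2 * n)%N -> (l < m + 2 * n)%N ->
  Lop m n i j (coord m n l) = sadd (sscale (hinv m j l) (coord m n i))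
      (sscale (- sgnb (par m i && par m j)) (sscale (hinv m i l) (coord m n j))).
Proof.
move=> iN jN lN; apply: sfunP => S x; rewrite LopE !dupE !dlow_coord ?prt_lt //.
by rewrite !smulZr !smul1r /sadd /sscale /hinv; ring.
Qed.

(** Pairing with an upper derivation cancels the metric coefficient and picks component [j]. In the
    left slot the partner's coefficient appears instead, which leaves the sign (-1)^[j]. *)
Lemma Bf_hinvl m n j (F : sfun n) M : (j < m + 2 * n)%N ->
  Bf m n (fun l => sscale (hinv m j l) F) M = sscale (sgnb (par m j)) (smul F (sig (par m j) (M j))).
Proof.
move=> jN; apply: sfunP => S x; rewrite BfE.
have -> : sscale (sgnb (par m j)) (smul F (sig (par m j) (M j))) S x =
  geps m (prt m j) * / geps m j * smul F (sig (par m (prt m j)) (M (prt m (prt m j)))) S x.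
  by rewrite prtK par_prt geps_prt /sscale; field; apply: geps_neq0.
rewrite -(sum_kdelta (fun l => geps m l * / geps m j * smul F (sig (par m l) (M (prt m l))) S x) (prt_lt jN)).
by apply: eq_bigr => l _; rewrite smulZl /sscale /hinv; ring.
Qed.

Lemma Bf_hinvr m n j (F : sfun n) N : (j < m + 2 * n)%N ->
  Bf m n N (fun l => sscale (hinv m j l) F) = smul (N j) (sig (par m j) F).
Proof.
move=> jN; apply: sfunP => S x; rewrite BfE.
rewrite -(sum_kdelta (fun l => smul (N l) (sig (par m l) F) S x) jN).
apply: eq_bigr => l _; rewrite sigZ smulZr /sscale /hinv /kdelta.
rewrite (inj_eq (inv_inj (prtK m))); case: eqP => [->|_]; last by ring.
by field; apply: geps_neq0.
Qed.

(** After contraction by [Bf_hinvl] and [Bf_hinvr], two terms are multiples of [Y X_i] times [Z X_j]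
    and two of [Y X_j] times [Z X_i]; each pair cancels. *)
Lemma killing_Lop m n i j F : (i < m + 2 * n)%N -> (j < m + 2 * n)%N ->
  (forall G, sO m n G -> F G = Lop m n i j G) ->
  killing m n (xorb (par m i) (par m j)) F.
Proof.
move=> iN jN EF.
have hF : hder m n (xorb (par m i) (par m j)) F := hder_ext (hder_Lop iN jN) EF.
apply/(killingP hF) => q r Y Z hY hZ.
have E D s : hder m n s D -> forall l, (l < m + 2 * n)%N -> D (F (coord m n l)) =
    sadd (sscale (hinv m j l) (D (coord m n i)))
      (sscale (- sgnb (par m i && par m j)) (sscale (hinv m i l) (D (coord m n j)))).
  move=> hD l lN; rewrite EF; last exact: sO_coord.
  have sc k c : sO m n (sscale c (coord m n k)) by apply: sO_scale; apply: sO_coord.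
  rewrite Lop_coord // (hder_add hD) //; last exact: sO_scale.
  by rewrite !(hder_scale _ hD) //; apply: sO_coord.
rewrite (Bf_ext (E Y q hY) (fun _ _ => erefl)) (Bf_ext (fun _ _ => erefl) (E Z r hZ)).
rewrite BfDl BfDr BfZl BfZr !Bf_hinvl // !Bf_hinvr //.
have hi := homv_coord hZ iN; have hj := homv_coord hZ jN.
rewrite !(sig_hom _ hi) !(sig_hom _ hj) !smulZr.
apply: sfunP => S x; rewrite /sadd /sscale /szero; clear.
by case: (par m i); case: (par m j); case: r; rewrite /sgnb /=; ring.
Qed.

Lemma delta0_Lop m n i j G : (i < m + 2 * n)%N -> (j < m + 2 * n)%N ->
  delta0 (Lop m n i j G) = 0.
Proof.
move=> iN jN; rewrite /delta0 LopE -!/(delta0 (smul _ _)) !delta0_smul.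
by rewrite !delta0_coord //; ring.
Qed.

(** * Spans of operators *)

Lemma in_span_mono m n P T (Q : _ -> Prop) :
  (forall U, P U -> in_span m n Q U) -> in_span m n P T -> in_span m n Q T.
Proof.
move=> PQ [s [Ps ET]]; elim: s T Ps ET => [|[c U] s IH] T Ps ET.
  by exists [::]; split=> // F sF; rewrite ET.
have [t [Qt EU]] := PQ U (Ps (c, U) (or_introl erefl)).
have [|//|u [Qu Eu]] := IH (fun F => foldr (fun cU acc => sadd (sscale cU.1 (cU.2 F)) acc) (szero n) s).
  by move=> cU H; apply: Ps; right.
exists ([seq (c * dV.1, dV.2) | dV <- t] ++ u); split.
  move=> dV /List.in_app_iff[/List.in_map_iff[eW [<- /Qt//]]|/Qu//].
move=> F sF; rewrite ET //= foldr_cat -Eu // EU //.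
elim: t {Qt EU} => [|[e V] t IHt] /=.
  by apply: sfunP => S x; rewrite /sadd /sscale /szero; ring.
rewrite -IHt; apply: sfunP => S x; rewrite /sadd /sscale; ring.
Qed.

Lemma in_span_ext m n P T T' : (forall F, sO m n F -> T' F = T F) ->
  in_span m n P T -> in_span m n P T'.
Proof. by move=> E [s [Ps ET]]; exists s; split=> // F sF; rewrite E // ET. Qed.

Lemma in_span_scale m n (P : _ -> Prop) c U : P U -> in_span m n P (fun F => sscale c (U F)).
Proof.
move=> PU; exists [:: (c, U)]; split; first by move=> cU [<-|].
by move=> F _; apply: sfunP => S x; rewrite /= /sadd /szero; ring.
Qed.

Lemma in_span_sum m n P (r : seq nat) (D : pred nat) (T : nat -> sfun n -> sfun n) :
  (forall i, D i -> in_span m n P (T i)) ->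
  in_span m n P (fun F => \big[@sadd n/szero n]_(i <- r | D i) T i F).
Proof.
move=> H; elim: r => [|i r IH].
  by exists [::]; split=> // F _; rewrite big_nil.
case Di: (D i); last first.
  by apply: in_span_ext IH => F _; rewrite big_cons Di.
have [s [Ps Es]] := H i Di; have [t [Pt Et]] := IH.
exists (s ++ t); split; first by move=> cU /List.in_app_iff[/Ps|/Pt].
move=> F sF; rewrite big_cons Di foldr_cat -Et // Es //.
elim: s {Ps Es} => [|[e V] s IHs] /=.
  by apply: sfunP => S x; rewrite /sadd /szero; ring.
rewrite -IHs; apply: sfunP => S x; rewrite /sadd; ring.
Qed.

Definition Lop_gen (m n : nat) (F : sfun n -> sfun n) : Prop :=
  exists i j, (i <= j < m + 2 * n)%N /\ forall G, sO m n G -> F G = Lop m n i j G.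

(** For [i > j] the graded antisymmetry of [L] exchanges the indices. *)
Lemma in_span_Lop m n i j c : (i < m + 2 * n)%N -> (j < m + 2 * n)%N ->
  in_span m n (@Lop_gen m n) (fun F => sscale c (Lop m n i j F)).
Proof.
move=> iN jN; have [ij|ji] := leqP i j.
  by apply: in_span_scale; exists i, j; rewrite ij jN.
have := @in_span_scale m n (@Lop_gen m n) (- c * sgnb (par m i && par m j)) (Lop m n j i).
move=> /(_ _)/in_span_ext; apply; last by exists j, i; rewrite (ltnW ji) iN.
move=> F _; apply: sfunP => S x; rewrite /sscale !LopE.
by case: (par m i); case: (par m j); rewrite /sgnb /=; ring.
Qed.

Lemma killing_span m n T :
  in_span m n (fun F => exists p : bool, hder m n p F /\
     (forall G, sO m n G -> delta0 (F G) = 0) /\ killing m n p F) T <->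
  in_span m n (@Lop_gen m n) T.
Proof.
split; apply: in_span_mono => U.
  move=> [p [hU [U0 kU]]]; have [d Ed] := killing_Lop_sum hU kU U0.
  apply: in_span_ext Ed _.
  have := @in_span_sum m n (@Lop_gen m n) (index_iota 0 (m + 2 * n)) (fun a => a < m + 2 * n)%N
    (fun a F => \big[@sadd n/szero n]_(0 <= j < m + 2 * n) sscale (d a j) (Lop m n a j F)).
  move=> /(_ _)/in_span_ext; apply; first by move=> F _; rewrite [LHS]big_nat.
  move=> a aN.
  have := @in_span_sum m n (@Lop_gen m n) (index_iota 0 (m + 2 * n)) (fun a => a < m + 2 * n)%N
    (fun j F => sscale (d a j) (Lop m n a j F)).
  move=> /(_ _)/in_span_ext; apply; first by move=> F _; rewrite [LHS]big_nat.
  by move=> j jN; apply: in_span_Lop.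
move=> [i [j [/andP[ij jN] EU]]]; have iN := leq_ltn_trans ij jN.
exists [:: (1, U)]; split; last first.
  by move=> F _; apply: sfunP => S x; rewrite /= /sadd /sscale /szero; ring.
move=> cU [<-|//]; exists (xorb (par m i) (par m j)); split=> /=.
  exact: hder_ext (hder_Lop iN jN) EU.
split; last exact: killing_Lop.
by move=> G sG; rewrite EU // delta0_Lop.
Qed.

(** * Isometries *)

Definition hpart n (b : bool) (F : sfun n) : sfun n :=
  fun S x => if odd #|S| == b then F S x else 0.

Lemma hom_hpart n b (F : sfun n) : hom b (hpart b F).
Proof. by apply: homI => S x oS; rewrite /hpart (negbTE oS). Qed.

Lemma sO_hpart m n b (F : sfun n) : sO m n F -> sO m n (hpart b F).
Proof. by move=> sF S; rewrite /hpart; case: (odd #|S| == b); [exact: sF|exact: smooth_const]. Qed.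

(** [phi] preserves the parity of the even and the odd part of [F], and [sinv] acts on each part by
    a scalar. *)
Lemma smorph_sig m n phi b F : smorph m n phi -> sO m n F -> phi (sig b F) = sig b (phi F).
Proof.
case: b => // -[_ [pD [pZ [_ [_ ph]]]]] sF.
have s0 := sO_hpart false sF; have s1 := sO_hpart true sF.
have E : F = sadd (hpart false F) (hpart true F).
  by apply: sfunP => S x; rewrite /sadd /hpart; case: odd; rewrite /=; ring.
rewrite {2}E pD // /sig -/(sig true (sadd _ _)) sigD /sig.
rewrite (sinv_hom (ph _ _ s0 (@hom_hpart n false F))) (sinv_hom (ph _ _ s1 (@hom_hpart n true F))).
rewrite -!pZ // -pD; try exact: sO_scale.
congr phi; apply: sfunP => S x; rewrite /sinv /sadd /sscale /hpart /sgnb.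
by case: odd; rewrite /=; ring.
Qed.

Lemma hder_conj m n phi psi p Y : sdiffeo m n phi psi -> hder m n p Y ->
  hder m n p (fun F => phi (Y (psi F))).
Proof.
move=> [[a1 [a2 [a3 [a4 [a5 a6]]]]] [[b1 [b2 [b3 [b4 [b5 b6]]]]] inv]] hY.
have sY F : sO m n F -> sO m n (Y (psi F)) by move=> sF; apply: hder_sO hY _; apply: b1.
split; first by move=> F sF; apply/a1/sY.
split; first by move=> F G sF sG; rewrite b2 // (hder_add hY) ?a2 //; auto.
split; first by move=> c F sF; rewrite b3 // (hder_scale _ hY) ?a3 //; auto.
split; first by move=> q F sF hF; apply: a6; [exact: sY|apply: hder_hom hY _ _; auto].
move=> q F G sF sG hF.
rewrite b4 // (hder_mul hY (b1 _ sF) (b1 _ sG) (b6 _ _ sF hF)).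
rewrite a2; last 2 first.
- by apply: sO_mul; auto.
- by apply: sO_scale; apply: sO_mul; auto.
rewrite a3; last by apply: sO_mul; auto.
rewrite !a4; auto.
by have [_ ->] := inv F sF; have [_ ->] := inv G sG.
Qed.

Lemma vfield_conj m n phi psi Y : sdiffeo m n phi psi -> vfield m n Y ->
  vfield m n (fun F => phi (Y (psi F))).
Proof.
move=> sd [Y0 [Y1 [h0 [h1 E]]]].
exists (fun F => phi (Y0 (psi F))), (fun F => phi (Y1 (psi F))).
split; first exact: (hder_conj sd h0).
split; first exact: (hder_conj sd h1).
move=> F sF; have [[_ [pD _]] [[b1 _] _]] := sd.
rewrite E; last exact: b1.
by rewrite pD //; [apply: hder_sO h0 _|apply: hder_sO h1 _]; apply: b1.
Qed.

Lemma sdiffeo_sym m n phi psi : sdiffeo m n phi psi -> sdiffeo m n psi phi.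
Proof. by move=> [h1 [h2 inv]]; split=> //; split=> // F /inv[]. Qed.

Lemma smorph_Bf m n phi N M : smorph m n phi ->
  (forall j, (j < m + 2 * n)%N -> sO m n (N j)) ->
  (forall j, (j < m + 2 * n)%N -> sO m n (M j)) ->
  phi (Bf m n N M) = Bf m n (fun j => phi (N j)) (fun j => phi (M j)).
Proof.
move=> h sN sM; have [_ [_ [pZ [pM _]]]] := h.
rewrite /Bf !big_nat (smorph_sum _ h); last first.
  move=> j /= jN; apply: sO_scale; apply: sO_mul; first exact: sN.
  by apply: sO_sig; apply: sM; apply: prt_lt.
apply: eq_bigr => j /= jN; have sg := sO_sig (par m j) (sM _ (prt_lt jN)).
rewrite pZ; last by apply: sO_mul => //; apply: sN.
rewrite pM //; last exact: sN.
by rewrite (smorph_sig _ h) //; apply: sM; apply: prt_lt.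
Qed.

(** [phi] passes through the form and cancels the outer [psi] of both conjugated fields.
    Preservation of the metric thereby becomes a condition on the derivatives of the pulled-back
    coordinates. *)
Lemma smorph_metric_conj m n phi psi Y Z : sdiffeo m n phi psi ->
  vfield m n Y -> vfield m n Z ->
  phi (metric m n (fun F => psi (Y (phi F))) (fun F => psi (Z (phi F)))) =
  Bf m n (fun j => Y (phi (coord m n j))) (fun j => Z (phi (coord m n j))).
Proof.
move=> [h1 [h2 inv]] hY hZ; have [a1 _] := h1; have [b1 _] := h2.
have sc j := @sO_coord m n j.
rewrite metricE (smorph_Bf h1).
- by apply: Bf_ext => j jN; [case: (inv (Y (phi (coord m n j))))|case: (inv (Z (phi (coord m n j))))];
   rewrite //; apply: vfield_sO; auto.
- by move=> j jN; apply: b1; apply: vfield_sO; auto.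
- by move=> j jN; apply: b1; apply: vfield_sO; auto.
Qed.

(** The hypothesis is applied to the fields conjugated in the opposite direction, whose conjugates
    are the given ones. *)
Lemma preserves_metric_sym m n phi psi : sdiffeo m n phi psi ->
  preserves_metric m n phi psi -> preserves_metric m n psi phi.
Proof.
move=> sd pm Y1 Y2 h1 h2; have [[a1 _] [_ inv]] := sd.
have sc j := @sO_coord m n j.
rewrite -(pm _ _ (vfield_conj sd h1) (vfield_conj sd h2)) (metricE m) (metricE m).
have E Y : vfield m n Y -> forall j, (j < m + 2 * n)%N ->
    psi (phi (Y (psi (phi (coord m n j))))) = Y (coord m n j).
  move=> hY j jN; have [-> _] := inv (coord m n j) (sc j).
  by have [-> _] := inv _ (vfield_sO hY (sc j)).
rewrite (Bf_ext (E _ h1) (E _ h2)).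
by have [-> _] := inv (Bf m n (fun j => Y1 (coord m n j)) (fun j => Y2 (coord m n j)))
  (sO_Bf (fun j _ => vfield_sO h1 (sc j)) (fun j _ => vfield_sO h2 (sc j))).
Qed.

Lemma isometry_dlow_Bf m n phi psi a b : sdiffeo m n phi psi -> preserves_metric m n phi psi ->
  (a < m + 2 * n)%N -> (b < m + 2 * n)%N ->
  Bf m n (fun j => dlow m n a (phi (coord m n j))) (fun j => dlow m n b (phi (coord m n j))) =
  sscale (geps m a * kdelta (prt m a) b) (sone n).
Proof.
move=> sd pm aN bN.
have va := vfield_hder (hder_dlow aN); have vb := vfield_hder (hder_dlow bN).
rewrite -(smorph_metric_conj sd va vb) (pm _ _ va vb) metricE.
rewrite (Bf_ext (fun j jN => dlow_coord aN jN) (fun j jN => dlow_coord bN jN)).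
rewrite Bf_deltal // sigZ (sig_hom _ (@hom_one n)) andbF sscale1 sscale_sscale.
by rewrite (kdeltaC b).
Qed.

Lemma isometry_dlow_dlow m n phi psi a b k : sdiffeo m n phi psi -> preserves_metric m n phi psi ->
  (a < m + 2 * n)%N -> (b < m + 2 * n)%N -> (k < m + 2 * n)%N ->
  dlow m n a (dlow m n b (phi (coord m n k))) = szero n.
Proof.
move=> sd pm aN bN kN; have [[p1 [_ [pZ [_ [pone ph]]]]] [[q1 _] inv]] := sd.
pose Phi j := phi (coord m n j).
have sP j : sO m n (Phi j) by apply: p1; apply: sO_coord.
have hP j : hom (par m j) (Phi j) by apply: ph; [apply: sO_coord|apply: hom_coord].
have s1 a' j : (a' < m + 2 * n)%N -> sO m n (dlow m n a' (Phi j)).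
  by move=> aN'; apply: hder_sO (hder_dlow aN') _.
have s2 c a' j : (c < m + 2 * n)%N -> (a' < m + 2 * n)%N -> sO m n (dlow m n c (dlow m n a' (Phi j))).
  by move=> cN aN'; apply: hder_sO (hder_dlow cN) _; apply: s1.
have h1 a' : (a' < m + 2 * n)%N -> homv m n (par m a') (fun j => dlow m n a' (Phi j)).
  by move=> aN' j _; apply: hder_hom (hder_dlow aN') _ _.
have h2 c a' : (c < m + 2 * n)%N -> (a' < m + 2 * n)%N ->
    homv m n (xorb (par m c) (par m a')) (fun j => dlow m n c (dlow m n a' (Phi j))).
  move=> cN aN' j jN; have := hder_hom (hder_dlow cN) (s1 a' j aN') (h1 a' aN' j jN).
  by case: (par m c); case: (par m a'); case: (par m j).
(* The analogue of the Christoffel symbols of the first kind for the map [Phi], taken at a fixed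
   coefficient [S] and point [x]. *)
pose T S x c a' b' := Bf m n (fun j => dlow m n c (dlow m n a' (Phi j)))
   (fun j => dlow m n b' (Phi j)) S x.
have T0 S x c a' b' : (c < m + 2 * n)%N -> (a' < m + 2 * n)%N -> (b' < m + 2 * n)%N ->
    T S x c a' b' = 0.
  move: c a' b'; apply: (@ricci (m + 2 * n) (par m)) => c a' b' cN aN' bN'; rewrite /T.
    rewrite (Bf_ext (fun j _ => dlow_comm cN aN' (sP j)) (fun _ _ => erefl)) BfZl.
    by rewrite /sscale.
  have := f_equal (fun F => dlow m n c F S x) (isometry_dlow_Bf sd pm aN' bN').
  rewrite /= (Bf_leibniz (hder_dlow cN) (fun j _ => s1 a' j aN') (fun j _ => s1 b' j bN')
     (h1 a' aN') (h1 b' bN')).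
  rewrite (hder_scale _ (hder_dlow cN)); last exact: sO_one.
  (* The derivative of the constant right side is 0, and the symmetry of the form brings the second
     Leibniz term to the shape of [T] with the last two indices exchanged. *)
  rewrite (hder_one (hder_dlow cN)) (Bf_sym (h1 a' aN') (h2 c b' cN bN')).
  rewrite /sadd /sscale /szero /Phi.
  set A := Bf _ _ _ _ S x; set B := Bf _ _ _ _ S x; clear.
  by case: (par m c); case: (par m a'); case: (par m b'); rewrite /sgnb /=; lra.
pose M j := dlow m n a (dlow m n b (Phi j)).
have B0 c : (c < m + 2 * n)%N -> Bf m n (fun j => dlow m n c (Phi j)) M = szero n.
  move=> cN; rewrite (Bf_sym (h1 c cN) (h2 a b aN bN)); apply: sfunP => S x.
  by rewrite /sscale -/(T S x a b c) T0 // Rmult_0_r.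
(* [W] is the field whose components invert the Jacobian of [phi]. *)
pose W F := phi (dlow m n (prt m k) (psi F)).
have kN' := prt_lt kN.
have hW : hder m n (par m (prt m k)) W := hder_conj sd (hder_dlow kN').
(* [W] is a combination of coordinate derivations with coefficients on the left, and the form is
   linear over superfunctions in its left slot, so [B0] applies to every term. On the other hand
   [W (Phi j)] is a Kronecker delta and singles out [M k]. *)
have : Bf m n (fun j => W (Phi j)) M = szero n.
  rewrite (Bf_ext (fun j _ => hder_expand hW (sP j)) (fun _ _ => erefl)) Bf_suml.
  rewrite big_nat; apply: sfunP => S x; rewrite sumE big1 // => c /= cN.
  by rewrite -Bf_mull B0 // smul0r.
have WP j : (j < m + 2 * n)%N -> W (Phi j) = sscale (kdelta (prt m k) j) (sone n).
  move=> jN; rewrite /W /Phi; have [-> _] := inv _ (@sO_coord m n j).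
  by rewrite dlow_coord // pZ ?pone //; apply: sO_one.
rewrite (Bf_ext WP (fun _ _ => erefl)) Bf_deltal // prtK => E.
apply: (@sig_inv0 n (par m (prt m k))).
apply: (sscale_inj (geps_neq0 (m := m) (j := prt m k))); rewrite E.
by apply: sfunP => S x; rewrite /sscale /szero; ring.
Qed.

(** * Linear isometries and their matrices *)

Definition lin_comb (m n : nat) (f : nat -> R) : sfun n :=
  \big[@sadd n/szero n]_(0 <= a < m + 2 * n) sscale (f a) (coord m n a).
Arguments lin_comb : clear implicits.

Lemma dlow_lin_comb m n f a : (a < m + 2 * n)%N ->
  dlow m n a (lin_comb m n f) = sscale (f a) (sone n).
Proof.
move=> aN; rewrite (hder_sum _ (hder_dlow aN)); last first.
  by move=> b _; apply: sO_scale; apply: sO_coord.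
apply: sfunP => S x; rewrite sumE {2}/sscale -(sum_kdelta (fun b => f b * sone n S x) aN).
apply: eq_big_nat => b /= bN; rewrite (hder_scale _ (hder_dlow aN)); last exact: sO_coord.
by rewrite dlow_coord // /sscale; ring.
Qed.

Lemma lin_comb_kdelta m n k : (k < m + 2 * n)%N -> lin_comb m n (kdelta k) = coord m n k.
Proof.
by move=> kN; apply: sfunP => S x; rewrite /lin_comb sumE /sscale sum_kdelta.
Qed.

Lemma lin_comb_inj m n f g a : (a < m + 2 * n)%N -> lin_comb m n f = lin_comb m n g -> f a = g a.
Proof.
move=> aN E; have := f_equal (fun F => dlow m n a F set0 (fun=> 0)) E.
by rewrite /= !dlow_lin_comb // /sscale /sone eqxx; lra.
Qed.

Lemma smorph_lin_comb m n phi f (c : nat -> nat -> R) : smorph m n phi ->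
  (forall k, (k < m + 2 * n)%N -> phi (coord m n k) = lin_comb m n (c k)) ->
  phi (lin_comb m n f) = lin_comb m n (fun b => rsum (m + 2 * n) (fun a => f a * c a b)).
Proof.
move=> h H; rewrite (smorph_sum _ h); last first.
  by move=> b _; apply: sO_scale; apply: sO_coord.
have [_ [_ [pZ _]]] := h; apply: sfunP => S x; rewrite /lin_comb !sumE.
transitivity (\big[Rplus/0]_(0 <= a < m + 2 * n) \big[Rplus/0]_(0 <= b < m + 2 * n)
  (f a * c a b * coord m n b S x)).
  apply: eq_big_nat => a /= aN; rewrite pZ; last exact: sO_coord.
  rewrite H // /lin_comb /sscale sumE big_distrr /=; apply: eq_bigr => b _; rewrite /sscale; ring.
rewrite exchange_big /=; apply: eq_bigr => b _.
by rewrite /sscale /rsum big_distrl.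
Qed.

(** The matrix identity [c^T g c = g] for the metric matrix [g], with the sum over the second index
    already evaluated at the partner. *)
Definition isom (m n : nat) (c : nat -> nat -> R) : Prop :=
  forall a b, (a < m + 2 * n)%N -> (b < m + 2 * n)%N ->
    rsum (m + 2 * n) (fun j => geps m j * c j a * c (prt m j) b) = geps m a * kdelta (prt m a) b.

Lemma isometry_linear m n phi psi : sdiffeo m n phi psi -> preserves_metric m n phi psi ->
  fixes_origin m n phi -> exists c : nat -> nat -> R,
    [/\ forall k, (k < m + 2 * n)%N -> phi (coord m n k) = lin_comb m n (c k),
        forall k a, (k < m + 2 * n)%N -> (a < m + 2 * n)%N -> par m k != par m a -> c k a = 0
      & isom m n c].
Proof.
move=> sd pm fo; have [[p1 [_ [_ [_ [_ ph]]]]] _] := sd.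
have sP j : sO m n (phi (coord m n j)) by apply: p1; apply: sO_coord.
pose c k a := delta0 (dlow m n a (phi (coord m n k))).
have lin k : (k < m + 2 * n)%N -> phi (coord m n k) = lin_comb m n (c k).
  move=> kN; rewrite {1}(dlow_dlow0_affine (sP k)).
    by rewrite fo ?delta0_coord ?sscale0 ?sadd0l //; apply: sO_coord.
  by move=> a b aN bN; apply: (isometry_dlow_dlow sd pm).
exists c; split=> //.
  move=> k a kN aN ka.
  (* A derivative of the wrong parity is odd, and odd superfunctions vanish under [delta0]. *)
  have hk := ph _ _ (@sO_coord m n k) (@hom_coord m n k).
  apply: (delta0_hom (hder_hom (hder_dlow aN) (sP k) hk)).
  by move: ka; case: (par m k); case: (par m a).
move=> a b aN bN; have := f_equal (@delta0 n) (isometry_dlow_Bf sd pm aN bN).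
have E d : (d < m + 2 * n)%N -> forall j, (j < m + 2 * n)%N ->
    dlow m n d (phi (coord m n j)) = sscale (c j d) (sone n).
  by move=> dN j jN; rewrite lin // dlow_lin_comb.
rewrite (Bf_ext (E a aN) (E b bN)) /delta0 BfE /sscale /sone eqxx Rmult_1_r => <-.
apply: eq_bigr => j _; rewrite -/(sscale _ (sone n)) -/(sscale _ (sone n)).
rewrite sigZ (sig_hom _ (@hom_one n)) andbF sscale1 smulZl smul1l /sscale /sone eqxx; ring.
Qed.

(** * Block matrices *)

Definition blk (m : nat) (P Q : nat -> nat -> R) (k a : nat) : R :=
  if (k < m)%N then (if (a < m)%N then P k a else 0)
  else if (a < m)%N then 0 else Q (k - m)%N (a - m)%N.

Lemma blk_ee m P Q k a : (k < m)%N -> (a < m)%N -> blk m P Q k a = P k a.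
Proof. by rewrite /blk => -> ->. Qed.

Lemma blk_eo m P Q k a : (k < m)%N -> blk m P Q k (m + a) = 0.
Proof. by rewrite /blk => ->; rewrite ltnNge leq_addr. Qed.

Lemma blk_oe m P Q k a : (a < m)%N -> blk m P Q (m + k) a = 0.
Proof. by rewrite /blk => ->; rewrite ltnNge leq_addr. Qed.

Lemma blk_oo m P Q k a : blk m P Q (m + k) (m + a) = Q k a.
Proof. by rewrite /blk !ltnNge !leq_addr /= !addKn. Qed.

Lemma blk_par m P Q k a : par m k != par m a -> blk m P Q k a = 0.
Proof. by rewrite /par /blk !ltnNge; case: (m <= k)%N; case: (m <= a)%N. Qed.

Lemma rsum_split m k f : rsum (m + k) f = rsum m f + rsum k (fun l => f (m + l)%N).
Proof.
rewrite /rsum; elim: k => [|k IH]; first by rewrite addn0 [X in _ + X]big_geq // Rplus_0_r.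
by rewrite addnS !big_nat_recr //= IH; ring.
Qed.

Lemma rsum0 k f : (forall l, (l < k)%N -> f l = 0) -> rsum k f = 0.
Proof. by move=> H; rewrite /rsum big_nat big1. Qed.

Lemma kdelta_eo m i j : (i < m)%N -> kdelta i (m + j) = 0.
Proof. by move=> im; rewrite /kdelta; case: eqP => // E; move: im; rewrite E ltnNge leq_addr. Qed.

Lemma kdelta_oo m i j : kdelta (m + i) (m + j) = kdelta i j.
Proof. by rewrite /kdelta eqn_add2l. Qed.

Lemma rsum_blk m n P Q P' Q' i j : (i < m + 2 * n)%N -> (j < m + 2 * n)%N ->
  rsum (m + 2 * n) (fun l => blk m P Q i l * blk m P' Q' l j) =
  blk m (fun i j => rsum m (fun l => P i l * P' l j))
        (fun i j => rsum (2 * n) (fun l => Q i l * Q' l j)) i j.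
Proof.
move=> iN jN; rewrite rsum_split; case/idxP: iN => [i' im|i']; case/idxP: jN => [j' jm|j'].
- rewrite blk_ee // [X in _ + X]rsum0 ?Rplus_0_r; last by move=> l _; rewrite blk_eo //; ring.
  by apply: rsum_ext => l lm; rewrite !blk_ee.
- rewrite blk_eo // !rsum0 ?Rplus_0_r // => l lm; first by rewrite blk_eo //; ring.
  by rewrite blk_eo //; ring.
- rewrite blk_oe // !rsum0 ?Rplus_0_r // => l lm; last by rewrite blk_oe //; ring.
  by rewrite [X in _ * X]blk_oe //; ring.
- rewrite blk_oo [X in X + _]rsum0 ?Rplus_0_l; last by move=> l lm; rewrite blk_oe //; ring.
  by apply: rsum_ext => l _; rewrite !blk_oo.
Qed.

Lemma mx_inverse_blk m n P Q P' Q' :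
  (mx_inverse m P P' /\ mx_inverse (2 * n) Q Q') <->
  mx_inverse (m + 2 * n) (blk m P Q) (blk m P' Q').
Proof.
split=> [[HP HQ] i j iN jN|H].
  rewrite !rsum_blk //; case/idxP: iN => [i' im|i']; case/idxP: jN => [j' jm|j'].
  - by rewrite !blk_ee //; apply: HP.
  - by rewrite !blk_eo // kdelta_eo.
  - by rewrite !blk_oe // kdeltaC kdelta_eo.
  - by rewrite !blk_oo kdelta_oo; apply: HQ.
split=> i j iN jN.
  by have := H i j (ltn_addr _ iN) (ltn_addr _ jN); rewrite !rsum_blk ?ltn_addr // !blk_ee.
have := H (m + i)%N (m + j)%N; rewrite !rsum_blk ?ltn_add2l // !blk_oo kdelta_oo.
by apply.
Qed.

(** [J] is the negative of the odd block of the metric: partners are the two indices with the same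
    half, and the signs of the entries are opposite. *)
Lemma Jmx_geps m i j : Jmx i j = - (geps m (m + i) * kdelta (prt m (m + i)) (m + j)).
Proof.
rewrite /Jmx geps_odd prt_odd kdelta_oo /kdelta.
have Ei := odd_double_half i; have Ej := odd_double_half j.
case oi: (odd i) Ei => Ei; case oj: (odd j) Ej => Ej /=.
- case: (i.-1 =P j) => [E|_]; last by case: eqP => _; ring.
  by move: oj; rewrite -E -Ei add1n /= odd_double.
- have -> : (i.-1 == j) = (i./2 == j./2).
    by rewrite -{1}Ei -{1}Ej add0n add1n /= (inj_eq double_inj).
  by case: eqP => _; ring.
- have -> : (i.+1 == j) = (i./2 == j./2).
    by rewrite -{1}Ei -{1}Ej add0n add1n eqSS (inj_eq double_inj).
  by case: eqP => _; ring.
- case: (i.+1 =P j) => [E|_]; last by case: eqP => _; ring.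
  by move: oj; rewrite -E /= oi.
Qed.

Lemma prt_shift m l : prt m (m + l) = (m + prt 0 l)%N.
Proof. by rewrite prt_odd /prt subn0. Qed.

Lemma geps_shift m l : geps m (m + l) = geps 0 l.
Proof. by rewrite geps_odd /geps subn0. Qed.

Lemma geps_even m i : (i < m)%N -> geps m i = 1.
Proof. by rewrite /geps => ->. Qed.

Lemma inSp_rsum n (Q : nat -> nat -> R) i j :
  rsum (2 * n) (fun k => rsum (2 * n) (fun l => Q k i * Jmx k l * Q l j)) =
  - rsum (2 * n) (fun k => geps 0 k * Q k i * Q (prt 0 k) j).
Proof.
transitivity (-1 * rsum (2 * n) (fun k => geps 0 k * Q k i * Q (prt 0 k) j)); last by ring.
rewrite {1 3}/rsum big_distrr /=; apply: eq_big_nat => k /= kn.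
rewrite -(sum_kdelta (N := 2 * n) (a := prt 0 k) (fun l => Q l j)); last exact: (@prt_lt 0 n k).
rewrite !big_distrr /=; apply: eq_bigr => l _.
by rewrite (Jmx_geps 0 k l) !add0n; ring.
Qed.

(** The identity splits into blocks: the even one is orthogonality, the odd one is the symplectic
    condition up to a common sign, and in the mixed ones both sides are 0. *)
Lemma isom_blk m n P Q : isom m n (blk m P Q) <-> inOm m P /\ inSp n Q.
Proof.
have Eee a b : (a < m)%N -> (b < m)%N ->
    rsum (m + 2 * n) (fun j => geps m j * blk m P Q j a * blk m P Q (prt m j) b) =
    rsum m (fun l => P l a * P l b).
  move=> am bm; rewrite rsum_split [X in _ + X]rsum0 ?Rplus_0_r.
    by apply: rsum_ext => l lm; rewrite geps_even // prt_even // !blk_ee //; ring.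
  by move=> l _; rewrite blk_oe //; ring.
have Eoo a b :
    rsum (m + 2 * n) (fun j => geps m j * blk m P Q j (m + a) * blk m P Q (prt m j) (m + b)) =
    rsum (2 * n) (fun l => geps 0 l * Q l a * Q (prt 0 l) b).
  rewrite rsum_split [X in X + _]rsum0 ?Rplus_0_l.
    by apply: rsum_ext => l lm; rewrite prt_shift geps_shift !blk_oo.
  by move=> l lm; rewrite blk_eo //; ring.
split=> [H|[HP HQ] a b].
  split=> i j iN jN.
    have := H i j (ltn_addr _ iN) (ltn_addr _ jN).
    by rewrite Eee // geps_even // prt_even // Rmult_1_l.
  have := H (m + i)%N (m + j)%N; rewrite !ltn_add2l => /(_ iN jN).
  rewrite Eoo inSp_rsum => ->; rewrite (Jmx_geps m); ring.
case/idxP => [a' am|a']; case/idxP => [b' bm|b'].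
- by rewrite Eee // geps_even // prt_even // Rmult_1_l; apply: HP.
- rewrite prt_even // kdelta_eo // Rmult_0_r rsum_split !rsum0 ?Rplus_0_r // => l lm.
    by rewrite blk_oe //; ring.
  by rewrite prt_even // [X in _ * X]blk_eo //; ring.
- rewrite prt_shift kdeltaC kdelta_eo // Rmult_0_r rsum_split !rsum0 ?Rplus_0_r // => l lm.
    by rewrite prt_shift [X in _ * X]blk_oe //; ring.
  by rewrite blk_eo //; ring.
- rewrite Eoo; have := HQ a' b' (ltn_ord a') (ltn_ord b').
  by rewrite inSp_rsum (Jmx_geps m); lra.
Qed.

(** From [e^T g e = g] and [e c = 1] follows [c^T g c = c^T e^T g e c = g]. *)
Lemma isom_inv m n e c : isom m n e ->
  (forall i j, (i < m + 2 * n)%N -> (j < m + 2 * n)%N ->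
     rsum (m + 2 * n) (fun l => e i l * c l j) = kdelta i j) -> isom m n c.
Proof.
move=> He Hc i j iN jN; set N := (m + 2 * n)%N.
transitivity (rsum N (fun a => rsum N (fun b => c a i * (geps m a * kdelta (prt m a) b) * c b j))).
  apply: rsum_ext => a aN.
  rewrite -(sum_kdelta (fun b => c b j) (prt_lt aN)) big_distrr /=.
  by apply: eq_bigr => b _; ring.
transitivity (rsum N (fun a => rsum N (fun b => rsum N (fun l =>
    geps m l * (e l a * c a i) * (e (prt m l) b * c b j))))).
  apply: rsum_ext => a aN; apply: rsum_ext => b bN; rewrite -He //.
  by rewrite /rsum big_distrr big_distrl /=; apply: eq_bigr => l _; ring.
transitivity (rsum N (fun l => geps m l * kdelta l i * kdelta (prt m l) j)).
  rewrite /rsum; under eq_bigr => a _ do rewrite exchange_big /=.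
  rewrite exchange_big /=; apply: eq_big_nat => l /= lN.
  rewrite -(Hc l i lN iN) -(Hc _ j (prt_lt lN) jN) /rsum Rmult_assoc big_distrlr big_distrr /=.
  apply: eq_bigr => a _; rewrite big_distrr /=; apply: eq_bigr => b _; ring.
rewrite -(sum_kdelta (fun l => geps m l * kdelta (prt m l) j) iN).
by apply: eq_bigr => l _; rewrite (kdeltaC l); ring.
Qed.

(** Real coefficients leave the form in front of both slots. Since [c] preserves parity, the sign of
    index [j] may be replaced by that of [a], after which [isom] evaluates the sum over [j]. *)
Lemma Bf_isom m n c (N M : nat -> sfun n) : isom m n c ->
  (forall k a, (k < m + 2 * n)%N -> (a < m + 2 * n)%N -> par m k != par m a -> c k a = 0) ->
  Bf m n (fun j => \big[@sadd n/szero n]_(0 <= a < m + 2 * n) sscale (c j a) (N a))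
         (fun j => \big[@sadd n/szero n]_(0 <= a < m + 2 * n) sscale (c j a) (M a)) = Bf m n N M.
Proof.
move=> ic pc; apply: sfunP => S x; rewrite !BfE.
have sig_sum b (f : nat -> sfun n) (r : seq nat) :
    sig b (\big[@sadd n/szero n]_(a <- r) f a) = \big[@sadd n/szero n]_(a <- r) sig b (f a).
  apply: (big_morph (@sig n b)); first by move=> F G; apply: sigD.
  by case: b => //; apply: sfunP => T y; rewrite /sig /sinv /szero; case: odd; ring.
pose f a b := smul (N a) (sig (par m a) (M b)) S x.
transitivity (rsum (m + 2 * n) (fun j => rsum (m + 2 * n) (fun a => rsum (m + 2 * n) (fun b =>
    geps m j * c j a * c (prt m j) b * f a b)))).
  apply: eq_big_nat => j /= jN; rewrite smul_suml sumE big_distrr /=.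
  apply: eq_big_nat => a /= aN; rewrite sig_sum smul_sumr sumE big_distrr /=.
  apply: eq_bigr => b _; rewrite sigZ smulZl smulZr /sscale /f.
  have [->|ja] := eqVneq (par m j) (par m a); first by ring.
  by rewrite pc //; ring.
transitivity (rsum (m + 2 * n) (fun a => rsum (m + 2 * n) (fun b =>
    geps m a * kdelta (prt m a) b * f a b))).
  rewrite /rsum exchange_big /=; apply: eq_big_nat => a /= aN.
  rewrite exchange_big /=; apply: eq_big_nat => b /= bN.
  by rewrite -ic // /rsum big_distrl.
apply: eq_big_nat => a /= aN; rewrite -/(f a (prt m a)) -(sum_kdelta (f a) (prt_lt aN)).
by rewrite big_distrr /=; apply: eq_bigr => b _; ring.
Qed.

(** * Linear pullbacks as isometries *)

Lemma pull_coord m n P Q k : (k < m + 2 * n)%N ->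
  pull m n P Q (coord m n k) = lin_comb m n (blk m P Q k).
Proof.
case/idxP => [i im|i]; apply: sfunP => S x; rewrite /lin_comb sumE -/(rsum _ _) rsum_split.
  rewrite [X in _ + X]rsum0 ?Rplus_0_r; last first.
    by move=> l _; rewrite blk_eo // /sscale; ring.
  rewrite /coord im pull_semb /semb /lin_pt im.
  case: (S =P set0) => [->|S0]; last first.
    rewrite rsum0 // => l lm; rewrite lm /sscale /=; case: eqP => // _; ring.
  by apply: rsum_ext => l lm; rewrite lm blk_ee // /sscale eqxx.
rewrite [X in X + _]rsum0 ?Rplus_0_l; last first.
  by move=> l lm; rewrite blk_oe // /sscale; ring.
rewrite coord_odd pull_gen lin_genE; apply: eq_big_nat => b /= bn.
by rewrite blk_oo /sscale /coord ltnNge leq_addr /= addKn.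
Qed.

Lemma mx_inverse_sym k P Q : mx_inverse k P Q -> mx_inverse k Q P.
Proof. by move=> H i j ik jk; have [] := H i j ik jk. Qed.

(** On coordinates this is a product of block matrices; [smorph_uniq], with the coordinates
    themselves as images, extends it to all superfunctions. *)
Lemma pull_pull m n A B Ainv Binv F : mx_inverse m A Ainv -> mx_inverse (2 * n) B Binv ->
  sO m n F -> pull m n A B (pull m n Ainv Binv F) = F.
Proof.
move=> HA HB; have /mx_inverse_blk H := conj HA HB.
have E k : (k < m + 2 * n)%N -> pull m n A B (pull m n Ainv Binv (coord m n k)) = coord m n k.
  move=> kN; rewrite pull_coord // (smorph_lin_comb _ (smorph_pull m n A B) (fun k kN => pull_coord A B kN)).
  rewrite -(lin_comb_kdelta kN); apply: eq_big_nat => b /= bN.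
  by have [_ ->] := H k b kN bN.
apply: (smorph_uniq (l := fun i x => x i)
  (smorph_comp (smorph_pull m n A B) (smorph_pull m n Ainv Binv)) (@smorph_id m n) E).
by move=> i im; rewrite E ?ltn_addr // /coord im.
Qed.

Lemma sdiffeo_pull m n A B Ainv Binv : mx_inverse m A Ainv -> mx_inverse (2 * n) B Binv ->
  sdiffeo m n (pull m n Ainv Binv) (pull m n A B).
Proof.
move=> HA HB; split; first exact: smorph_pull.
split; first exact: smorph_pull.
by move=> F sF; rewrite !pull_pull //; apply: mx_inverse_sym.
Qed.

(** A linear map fixes 0, and a nonempty product of odd elements has no value at the origin. *)
Lemma fixes_origin_pull m n P Q : fixes_origin m n (pull m n P Q).
Proof.
move=> F _; rewrite /delta0 pullE (bigD1 set0) //= big1 ?Rplus_0_r.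
  rewrite etaP0 /sone eqxx Rmult_1_r; congr (F set0 _).
  apply: functional_extensionality => i; rewrite /lin_pt; case: ifP => // _.
  by apply: rsum0 => l _; ring.
move=> S S0; suff -> : etaP (fun i : 'I_(2 * n) => lin_gen n Q i) S set0 (fun=> 0) = 0 by ring.
elim/set_min_ind: S S0 => [|b S bS _ _]; first by rewrite eqxx.
rewrite etaPU // -/(delta0 (smul _ _)) delta0_smul.
by rewrite (delta0_hom (@hom_lin_gen n Q b)) //; ring.
Qed.

Lemma isometry_pull m n phi psi : sdiffeo m n phi psi ->
  preserves_metric m n phi psi /\ fixes_origin m n phi <->
  exists A B Ainv Binv : nat -> nat -> R,
    inOm m A /\ inSp n B /\ mx_inverse m A Ainv /\ mx_inverse (2 * n) B Binv /\
    forall F, sO m n F -> phi F = pull m n Ainv Binv F.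
Proof.
move=> sd; have sd' := sdiffeo_sym sd; have [h1 [h2 inv]] := sd; split.
  move=> [pm fo]; have pm' := preserves_metric_sym sd pm.
  have fo' : fixes_origin m n psi.
    move=> F sF; have [p1 _] := h2; rewrite -(fo (psi F)); last exact: p1.
    by have [_ ->] := inv F sF.
  have [c [lc pc ic]] := isometry_linear sd pm fo.
  have [e [le pe ie]] := isometry_linear sd' pm' fo'.
  (* [P] and [Q] are the blocks of [phi]; [A] and [B] come from [psi], so that [phi] acts through
     the inverse of [S]. *)
  pose P i j := c i j; pose Q i j := c (m + i)%N (m + j)%N.
  pose A i j := e i j; pose B i j := e (m + i)%N (m + j)%N.
  have blkP d : (forall k a, (k < m + 2 * n)%N -> (a < m + 2 * n)%N ->
        par m k != par m a -> d k a = 0) -> forall k a, (k < m + 2 * n)%N -> (a < m + 2 * n)%N ->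
      blk m d (fun i j => d (m + i)%N (m + j)%N) k a = d k a.
    move=> pd k a kN aN; have [/eqP E|ne] := boolP (par m k == par m a); last first.
      by rewrite blk_par // pd.
    case/idxP: kN E => [i im|i]; case/idxP: aN => [j jm|j] E.
    - by rewrite blk_ee.
    - by move: E; rewrite par_odd /par leqNgt im.
    - by move: E; rewrite par_odd /par leqNgt jm.
    - by rewrite blk_oo.
  have bc := blkP c pc; have be := blkP e pe.
  have isomP d d' : (forall k a, (k < m + 2 * n)%N -> (a < m + 2 * n)%N -> d k a = d' k a) ->
      isom m n d' -> isom m n d.
    move=> E I a b aN bN; rewrite -(I a b aN bN); apply: rsum_ext => j jN.
    by rewrite !E //; apply: prt_lt.
  have [iA iB] : inOm m A /\ inSp n B by apply/isom_blk; apply: isomP be ie.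
  (* Stated for a general pair so that both orders of composition yield the two halves of
     [mx_inverse]. The composite of linear morphisms has the product matrix, and coefficients of
     linear superfunctions are unique. *)
  have inv' f g d d' : smorph m n f -> (forall F, sO m n F -> f (g F) = F) ->
      (forall k, (k < m + 2 * n)%N -> f (coord m n k) = lin_comb m n (d k)) ->
      (forall k, (k < m + 2 * n)%N -> g (coord m n k) = lin_comb m n (d' k)) ->
      forall i j, (i < m + 2 * n)%N -> (j < m + 2 * n)%N ->
      rsum (m + 2 * n) (fun l => d' i l * d l j) = kdelta i j.
    move=> hf fg ld ld' i j iN jN.
    apply: (@lin_comb_inj m n (fun j => rsum (m + 2 * n) (fun l => d' i l * d l j)) _ j jN).
    by rewrite lin_comb_kdelta // -(smorph_lin_comb _ hf ld) -ld' // fg //; apply: sO_coord.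
  have /mx_inverse_blk[mA mB] : mx_inverse (m + 2 * n) (blk m A B) (blk m P Q).
    move=> i j iN jN; split.
      rewrite -(inv' _ _ _ _ h1 (fun F sF => proj2 (inv F sF)) lc le i j iN jN).
      by apply: rsum_ext => l lN; rewrite be // bc.
    rewrite -(inv' _ _ _ _ h2 (fun F sF => proj1 (inv F sF)) le lc i j iN jN).
    by apply: rsum_ext => l lN; rewrite be // bc.
  exists A, B, P, Q; do 4!split=> //.
  have E k : (k < m + 2 * n)%N -> phi (coord m n k) = pull m n P Q (coord m n k).
    move=> kN; rewrite pull_coord // lc //; apply: eq_big_nat => a /= aN.
    by rewrite bc.
  apply: (smorph_uniq (l := fun i x => lin_pt m P x i) h1 (smorph_pull m n P Q) E).
  by move=> i im; rewrite E ?ltn_addr // /coord im pull_semb.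
move=> [A [B [P [Q [iA [iB [mA [mB E]]]]]]]]; split; last first.
  by move=> F sF; rewrite E //; apply: fixes_origin_pull.
move=> Y Z hY hZ; rewrite (smorph_metric_conj sd hY hZ) metricE.
(* The group conditions are given for [A] and [B], while [phi] involves their inverses. *)
have ib : isom m n (blk m P Q).
  apply: (@isom_inv m n (blk m A B)); first by apply/isom_blk.
  by have /mx_inverse_blk H := conj mA mB => i j iN jN; have [] := H i j iN jN.
rewrite -[RHS](Bf_isom _ _ ib (fun k a _ _ => @blk_par m P Q k a)).
have EY V : vfield m n V -> forall j, (j < m + 2 * n)%N -> V (phi (coord m n j)) =
    \big[@sadd n/szero n]_(0 <= a < m + 2 * n) sscale (blk m P Q j a) (V (coord m n a)).
  move=> hV j jN; rewrite E; last exact: sO_coord.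
  rewrite pull_coord // (vfield_sum _ hV); last by move=> a; apply: sO_scale; apply: sO_coord.
  by apply: eq_bigr => a _; rewrite (vfield_scale _ hV) //; apply: sO_coord.
by rewrite (Bf_ext (EY Y hY) (EY Z hZ)).
Qed.

Local Close Scope R_scope.

Theorem theorem3p4 (m n : nat) :
  (* (i) origin-stabilizing metric-preserving superdiffeomorphisms
         = O(m) x Sp(2n) acting by f(x) |-> f(S^{-1} x) *)
  ((forall phi psi : sfun n -> sfun n,
      sdiffeo m n phi psi ->
      (preserves_metric m n phi psi /\ fixes_origin m n phi <->
       exists A B Ainv Binv : nat -> nat -> R,
         inOm m A /\ inSp n B /\ mx_inverse m A Ainv /\ mx_inverse (2 * n) B Binv /\
         forall F, sO m n F -> phi F = pull m n Ainv Binv F)) /\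
   (forall A B Ainv Binv : nat -> nat -> R,
      inOm m A -> inSp n B -> mx_inverse m A Ainv -> mx_inverse (2 * n) B Binv ->
      sdiffeo m n (pull m n Ainv Binv) (pull m n A B))) /\
  (* (ii) homogeneous graded Killing vector fields F with delta_0 o F = 0
          span exactly osp(m|2n) = span of the L_ij, i <= j *)
  (forall T : sfun n -> sfun n,
     in_span m n
       (fun F => exists p : bool, hder m n p F /\
                  (forall G, sO m n G -> delta0 (F G) = 0%R) /\ killing m n p F) T
     <->
     in_span m n
       (fun F => exists i j, i <= j < m + 2 * n /\
                  forall G, sO m n G -> F G = Lop m n i j G) T).
Proof.
split; last exact: killing_span.
split; first by move=> phi psi; apply: isometry_pull.
by move=> A B Ainv Binv _ _; apply: sdiffeo_pull.
Qed.
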